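(* Let $\lambda\in\mathfrak h^*_{red}$, let $v_\lambda$ be the highest weight vector of the reduced quantized imaginary Verma module $\tilde M_q(\lambda)$, and put $$\mathcal L(\lambda)=\sum_{k\ge0,\ i_1\ge\cdots\ge i_k,\ i_j\in\mathbb Z}\mathbb A_0\,x^-_{i_1}\cdots x^-_{i_k}v_\lambda\subset\tilde M_q(\lambda),$$ $$\mathcal B(\lambda)=\{\text{classes of } x^-_{i_1}\cdots x^-_{i_k}v_\lambda\text{ in }\mathbb F\otimes_{\mathbb A_0}\mathcal L(\lambda)\ :\ k\ge0,\ i_1\ge\cdots\ge i_k\}.$$ Then the pair $(\mathcal L(\lambda),\mathcal B(\lambda))$ is an imaginary crystal basis of $\tilde M_q(\lambda)$.
   Context: **Algebra.** Let $\mathbb F$ be a field of characteristic zero, $q$ an indeterminate, $[n]=\frac{q^n-q^{-n}}{q-q^{-1}}$. $U_q=U_q(\widehat{\mathfrak{sl}(2)})$ (Drinfeld realization) is the unital associative $\mathbb F(q^{1/2})$-algebra generated by $x_k^\pm$ ($k\in\mathbb Z$), $h_l$ ($l\in\mathbb Z\setminus\{0\}$), $K^{\pm1},D^{\pm1},\gamma^{\pm1/2}$, with relations: $K^{\pm1}$, $D^{\pm1}$, $\gamma^{\pm1/2}$ mutually inverse pairs; $\gamma^{\pm1/2}$ central; $[h_k,h_l]=\delta_{k+l,0}\frac{[2k]}{k}\frac{\gamma^k-\gamma^{-k}}{q-q^{-1}}$; $[h_k,K]=[D,K]=0$; $Dh_kD^{-1}=q^kh_k$; $Dx_k^\pm D^{-1}=q^kx_k^\pm$;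 $Kx_k^\pm K^{-1}=q^{\pm2}x_k^\pm$; $[h_k,x_l^\pm]=\pm\frac{[2k]}{k}\gamma^{\mp|k|/2}x^\pm_{k+l}$; $x^\pm_{k+1}x^\pm_l-q^{\pm2}x^\pm_lx^\pm_{k+1}=q^{\pm2}x^\pm_kx^\pm_{l+1}-x^\pm_{l+1}x^\pm_k$; $[x_k^+,x_l^-]=\frac1{q-q^{-1}}(\gamma^{(k-l)/2}\psi(k+l)-\gamma^{(l-k)/2}\phi(k+l))$, where $\sum_{k\ge0}\psi(k)z^{-k}=K\exp((q-q^{-1})\sum_{k\ge1}h_kz^{-k})$, $\sum_{k\ge0}\phi(-k)z^k=K^{-1}\exp(-(q-q^{-1})\sum_{k\ge1}h_{-k}z^k)$, and $\psi(-k)=\phi(k)=0$ for $k>0$. **Modules.** Let $\mathfrak h=\mathbb Fh\oplus\mathbb Fc\oplus\mathbb Fd$ be the Cartan subalgebra of $\widehat{\mathfrak{sl}(2)}$. Let $\mathfrak h^*_{red}$ be the set of integral weights $\lambda\in\mathfrak h^*$ (integer values on $h,c,d$) with $\lambda(c)=0$, $\lambda(h)\ne0$. For integral $\lambda$ with $\lambda(c)=0$ the reduced quantized imaginary Verma module is $\tilde M_q(\lambda)=U_q/J^q(\lambda)$, where $J^q(\lambda)$ is the left ideal generated by $x_k^+$ ($k\in\mathbb Z$), $h_l$ ($l\ne0$), $K^{\pm1}-q^{\pm\lambda(h)}$, $\gamma^{\pm1/2}-1$, $D^{\pm1}-q^{\pm\lambda(d)}$; $v_\lambda$ is the image of $1$.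 Let $\mathcal N_q^-$ be the unital associative $\mathbb F(q^{1/2})$-algebra generated by the $x_n^-$ ($n\in\mathbb Z$) subject to the quadratic relations $x^-_{k+1}x^-_l-q^{-2}x^-_lx^-_{k+1}=q^{-2}x^-_kx^-_{l+1}-x^-_{l+1}x^-_k$ for all $k,l\in\mathbb Z$; it has basis the ordered monomials $x^-_{i_1}\cdots x^-_{i_k}$, $i_1\ge\cdots\ge i_k$, and $a\mapsto av_\lambda$ is a linear isomorphism $\mathcal N_q^-\to\tilde M_q(\lambda)$. The category $\mathcal O^q_{\mathrm{red,im}}$ consists of the $U_q$-modules isomorphic to $\bigoplus_{i\in I}\tilde M_q(\lambda_i)$ with all $\lambda_i\in\mathfrak h^*_{red}$. Weight spaces: $M_\nu=\{m: Km=q^{\nu(h)}m,\ Dm=q^{\nu(d)}m\}$. **Operators.** Let $g_{q^{-1}}(0)=q^2$ and $g_{q^{-1}}(r)=(q^4-1)q^{2(r-1)}$ for $r>0$ (Taylor coefficients at $t=0$ of $(q^{-2}t-1)/(t-q^{-2})$). The linear operators $\Omega_\psi(k)$ ($k\in\mathbb Z$) on $\mathcal N_q^-$ are determined by $\Omega_\psi(k)(1)=0$ and $\Omega_\psi(k)(x_m^-a)=\delta_{k,-m}a+\sum_{r\ge0}g_{q^{-1}}(r)x^-_{m+r}\Omega_\psi(k-r)(a)$ (a finite sum, since $\Omega_\psi(k-r)(a)=0$ for $r$ large). On each $\tilde M_q(\lambda)$, $\tilde\Omega_\psi(m)(av_\lambda)=\Omega_\psi(m)(a)v_\lambda$ and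 $\tilde x_m^-(av_\lambda)=x_m^-av_\lambda$ for $a\in\mathcal N_q^-$; on direct sums they act summandwise. **Imaginary crystal lattices and bases.** Let $\mathbb A_0\subset\mathbb F(q^{1/2})$ be the ring of rational functions in $q^{1/2}$ regular at $0$; $\mathbb F$ is an $\mathbb A_0$-module via $q^{1/2}\mapsto0$. For $M\in\mathcal O^q_{\mathrm{red,im}}$, a free $\mathbb A_0$-submodule $\mathcal L\subset M$ is an imaginary crystal $\mathbb A_0$-lattice if (i) $\mathbb F(q^{1/2})\otimes_{\mathbb A_0}\mathcal L\cong M$; (ii) $\mathcal L=\bigoplus_\mu\mathcal L_\mu$ over the weights $\mu$ of $M$, with $\mathcal L_\mu=\mathcal L\cap M_\mu$; (iii) $\tilde\Omega_\psi(m)\mathcal L\subseteq\mathcal L$ and $\tilde x_m^-\mathcal L\subseteq\mathcal L$ for all $m\in\mathbb Z$. An imaginary crystal basis of $M\in\mathcal O^q_{\mathrm{red,im}}$ is a pair $(\mathcal L,\mathcal B)$ with: (i) $\mathcal L$ an imaginary crystal lattice of $M$; (ii) $\mathcal B$ an $\mathbb F$-basis of $\overline{\mathcal L}:=\mathbb F\otimes_{\mathbb A_0}\mathcal L$; (iii) $\mathcal B=\bigcup_\mu\mathcal B_\mu$, where $\mathcal B_\mu=\mathcal B\cap(\mathbb F\otimes_{\mathbb A_0}\mathcal L_\mu)$; (iv) $\tilde x_m^-\mathcal B\subset\pm\mathcal B\cup\{0\}$ and $\tilde\Omega_\psi(m)\mathcal B\subset\pm\mathcal B\cup\{0\}$ for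 all $m\in\mathbb Z$ (induced operators on $\overline{\mathcal L}$); (v) for $m\in\mathbb Z$ and $b\in\mathcal B$, if $\tilde\Omega_\psi(-m)b\ne0$ and $\tilde x_m^-b\ne0$, then $\tilde x_m^-\tilde\Omega_\psi(-m)b=\tilde\Omega_\psi(-m)\tilde x_m^-b$. *)

(* Defs.v *)
From HB Require Import structures.
From mathcomp Require Import all_boot all_order all_algebra.
From mathcomp Require Import finmap monalg boolp.

Set Implicit Arguments.
Unset Strict Implicit.
Unset Printing Implicit Defensive.

Import GRing.Theory.
Local Open Scope ring_scope.
Local Open Scope quotient_scope.

(* [the_such P x0] is an object satisfying [P] when there is one; it is only
   used for predicates with exactly one solution. *)
Definition the_such (T : Type) (P : T -> Prop) (x0 : T) : T :=
  if pselect (exists x, P x) is left ex then projT1 (cid ex) else x0.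

Lemma the_suchP (T : Type) (P : T -> Prop) (x0 : T) :
  (exists x, P x) -> P (the_such P x0).
Proof. by rewrite /the_such; case: pselect => // ex _; case: cid. Qed.

Section Span.
Context {R : pzRingType} {V : lmodType R}.
Implicit Type G : V -> Prop.

(* The submodule generated by [G]. *)
Definition lspan G (x : V) : Prop :=
  exists2 s : seq (R * V),
    (forall p, p \in s -> G p.2) & x = \sum_(p <- s) p.1 *: p.2.

Definition in_lspan G : {pred V} := fun x => `[< lspan G x >].

Lemma in_lspanP G x : reflect (lspan G x) (x \in in_lspan G).
Proof. exact: asboolP. Qed.

Lemma lspan_gen G x : G x -> lspan G x.
Proof.
move=> Gx; exists [:: (1, x)]; last by rewrite big_seq1 scale1r.
by move=> p; rewrite inE => /eqP ->.
Qed.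

Lemma in_lspan_submod_closed G : submod_closed (in_lspan G).
Proof.
split=> [|a u v /in_lspanP[s Gs ->] /in_lspanP[t Gt ->]]; apply/in_lspanP.
  by exists [::]; rewrite ?big_nil.
exists ([seq (a * p.1, p.2) | p <- s] ++ t) => [p|].
  by rewrite mem_cat => /orP[/mapP[p' /Gs ? ->] //|/Gt].
rewrite big_cat big_map /= scaler_sumr; congr (_ + _).
by apply: eq_bigr => p _; rewrite scalerA.
Qed.

HB.instance Definition _ G :=
  GRing.isSubmodClosed.Build R V (in_lspan G) (in_lspan_submod_closed G).

Definition is_basis (B : V -> Prop) : Prop :=
  (forall x, lspan B x) /\
  (forall (s : seq V) (c : V -> R), uniq s -> (forall x, x \in s -> B x) ->
     \sum_(x <- s) c x *: x = 0 -> forall x, x \in s -> c x = 0).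

End Span.

Section DirectSum.
Context {V : zmodType} {I : choiceType}.

(* [V] is the internal direct sum of the subgroups [S i] with [P i]. *)
Definition is_direct_sum (P : I -> Prop) (S : I -> V -> Prop) : Prop :=
  (forall x, exists s : seq I, exists y : I -> V,
     (forall i, i \in s -> P i /\ S i (y i)) /\ x = \sum_(i <- s) y i) /\
  (forall (s : seq I) (y : I -> V), uniq s ->
     (forall i, i \in s -> P i /\ S i (y i)) ->
     \sum_(i <- s) y i = 0 -> forall i, i \in s -> y i = 0).

End DirectSum.

Section QuotientModule.
Context {R : pzRingType} {V : lmodType R} (G : V -> Prop).

(* The quotient of [V] by the submodule generated by [G]. *)
Definition quot_mod : Type := Quotient.quot (in_lspan G).
HB.instance Definition _ := GRing.Zmodule.on quot_mod.

Definition cls (x : V) : quot_mod := \pi_(Quotient.quot (in_lspan G)) x.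
Definition rep (x : quot_mod) : V := repr (x : Quotient.quot (in_lspan G)).

Lemma repK : cancel rep cls. Proof. exact: reprK. Qed.

Lemma cls_eq x y : (cls x = cls y) <-> lspan G (x - y).
Proof.
have E : (x - y \in in_lspan G) = (cls x == cls y).
  exact: Quotient.idealrBE.
by split=> [/eqP|/in_lspanP]; [rewrite -E => /in_lspanP | rewrite E => /eqP].
Qed.

Lemma clsD x y : cls (x + y) = cls x + cls y.
Proof. exact: (Quotient.pi_add (in_lspan G)). Qed.

Definition quot_scale (a : R) (x : quot_mod) : quot_mod := cls (a *: rep x).

Lemma clsZ a x : cls (a *: x) = quot_scale a (cls x).
Proof.
apply/cls_eq; rewrite -scalerBr.
have /cls_eq/in_lspanP : cls x = cls (rep (cls x)) by rewrite repK.
by move=> h; apply/in_lspanP; apply: rpredZ.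
Qed.

Lemma quot_scaleA a b x : quot_scale a (quot_scale b x) = quot_scale (a * b) x.
Proof. by rewrite -[x]repK -!clsZ scalerA. Qed.

Lemma quot_scale1 : left_id 1 quot_scale.
Proof. by move=> x; rewrite -[x]repK -!clsZ scale1r. Qed.

Lemma quot_scaleDr : right_distributive quot_scale +%R.
Proof.
by move=> a x y; rewrite -[x]repK -[y]repK -!(clsZ, clsD) scalerDr.
Qed.

Lemma quot_scaleDl x : {morph quot_scale^~ x : a b / a + b}.
Proof. by move=> a b; rewrite -[x]repK -!(clsZ, clsD) scalerDl. Qed.

HB.instance Definition _ := GRing.Zmodule_isLmodule.Build R quot_mod
  quot_scaleA quot_scale1 quot_scaleDr quot_scaleDl.

Lemma cls_is_linear : linear cls.
Proof. by move=> a x y; rewrite clsD clsZ. Qed.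

HB.instance Definition _ := GRing.isLinear.Build R V quot_mod _ cls
  cls_is_linear.

End QuotientModule.

Definition restr {R S : pzRingType} (f : {rmorphism R -> S}) (M : lmodType S)
  : Type := M.

Section RestrictionOfScalars.
Context {R S : pzRingType} (f : {rmorphism R -> S}) (M : lmodType S).

HB.instance Definition _ := GRing.Zmodule.on (restr f M).

Definition restr_scale (a : R) (x : restr f M) : restr f M := f a *: (x : M).

Lemma restr_scaleA a b x :
  restr_scale a (restr_scale b x) = restr_scale (a * b) x.
Proof. by rewrite /restr_scale scalerA rmorphM. Qed.
Lemma restr_scale1 : left_id 1 restr_scale.
Proof. by move=> x; rewrite /restr_scale rmorph1 scale1r. Qed.
Lemma restr_scaleDr : right_distributive restr_scale +%R.
Proof. by move=> a x y; rewrite /restr_scale scalerDr. Qed.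
Lemma restr_scaleDl x : {morph restr_scale^~ x : a b / a + b}.
Proof. by move=> a b; rewrite /restr_scale rmorphD scalerDl. Qed.

HB.instance Definition _ := GRing.Zmodule_isLmodule.Build R (restr f M)
  restr_scaleA restr_scale1 restr_scaleDr restr_scaleDl.

End RestrictionOfScalars.

Section LinearExtension.
Context {K : nzRingType} {X : choiceType} {W : lmodType K} (h : X -> W).

Definition lin_ext (g : {malg K[X]}) : W := \sum_(x <- msupp g) g@_x *: h x.

Lemma lin_extEw (d : {fset X}) (g : {malg K[X]}) :
  {subset msupp g <= d} -> lin_ext g = \sum_(x <- d) g@_x *: h x.
Proof.
move=> /fsubsetP le; rewrite [LHS](big_fset_incl _ le) => //= x xd.
by move=> /mcoeff_outdom ->; rewrite scale0r.
Qed.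

Lemma lin_ext_is_linear : linear lin_ext.
Proof.
move=> a g1 g2; pose d := (msupp g1 `|` msupp g2)%fset.
rewrite (lin_extEw (d := d) (g := g1)); last first.
  by move=> x; rewrite in_fsetU => ->.
rewrite (lin_extEw (d := d) (g := g2)); last first.
  by move=> x; rewrite in_fsetU => ->; rewrite orbT.
rewrite (lin_extEw (d := d)); last first.
  apply/fsubsetP; apply: (fsubset_trans (msuppD_le _ _)).
  exact/fsetSU/msuppZ_le.
rewrite scaler_sumr -big_split /=; apply: eq_bigr => x _.
by rewrite mcoeffD mcoeffZ scalerDl scalerA.
Qed.

HB.instance Definition _ := GRing.isLinear.Build K {malg K[X]} W _ lin_ext
  lin_ext_is_linear.

Lemma lin_extUZ c x : lin_ext << c *g x >> = c *: h x.
Proof.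
rewrite (lin_extEw (d := [fset x]%fset)); last by apply/fsubsetP/msuppU_le.
by rewrite big_seq_fset1 mcoeffUU.
Qed.

Lemma lin_extU x : lin_ext << x >> = h x.
Proof. by rewrite lin_extUZ scale1r. Qed.

End LinearExtension.

Section BaseChange.
Context {A : pzRingType} {B : nzRingType} (f : {rmorphism A -> B}).

Section Object.
Context (L : lmodType A).

(* The tensor product B (x)_A L along [f], presented as a B-module by the
   symbols 1 (x) x. *)
Inductive base_change_rel : {malg B[L]} -> Prop :=
| BaseChangeD x y : base_change_rel (<< x + y >> - << x >> - << y >>)
| BaseChangeZ a x : base_change_rel (<< a *: x >> - f a *: << x >>).

Definition base_change : Type := quot_mod base_change_rel.
HB.instance Definition _ := GRing.Lmodule.on base_change.

Definition tens (x : L) : base_change := cls base_change_rel << x >>.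

Lemma tensD x y : tens (x + y) = tens x + tens y.
Proof.
rewrite -clsD; apply/cls_eq; rewrite opprD addrA.
by apply: lspan_gen; exact: BaseChangeD.
Qed.

Lemma tensZ a x : tens (a *: x) = f a *: tens x.
Proof.
apply: (etrans (y := cls base_change_rel (f a *: << x >>))); last exact: clsZ.
by apply/cls_eq; apply: lspan_gen; exact: BaseChangeZ.
Qed.

Section Lift.
Context (W : lmodType B) (h : L -> W).

(* b (x) x |-> b *: h x, meaningful when [h] is semilinear along [f]. *)
Definition base_change_lift (t : base_change) : W := lin_ext h (rep t).

Hypothesis hD : {morph h : x y / x + y}.
Hypothesis hZ : forall a x, h (a *: x) = f a *: h x.

Lemma base_change_lift_cls g : base_change_lift (cls _ g) = lin_ext h g.
Proof.
have /cls_eq[s Gs E] := repK (cls base_change_rel g).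
apply/eqP; rewrite -subr_eq0 -linearB /= E linear_sum big_seq big1 //=.
move=> p /Gs; rewrite linearZ /=; case=> [x y|a x].
  by rewrite !linearB /= !lin_extU hD [h x + _]addrC addrK subrr scaler0.
by rewrite linearB linearZ /= !lin_extU hZ subrr scaler0.
Qed.

Lemma base_change_lift_tens x : base_change_lift (tens x) = h x.
Proof. by rewrite base_change_lift_cls lin_extU. Qed.

Lemma base_change_lift_is_linear : linear base_change_lift.
Proof.
move=> a t u; rewrite -[t]repK -[u]repK -[X in base_change_lift X]linearP /=.
by rewrite !base_change_lift_cls linearP.
Qed.

End Lift.
End Object.

Section Map.
Context (L L' : lmodType A) (h : {linear L -> L'}).

Definition base_change_map : base_change L -> base_change L' :=
  base_change_lift (fun x => tens (h x)).

Let hD : {morph (fun x => tens (h x)) : x y / x + y}.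
Proof. by move=> x y; rewrite linearD tensD. Qed.
Let hZ a x : tens (h (a *: x)) = f a *: tens (h x).
Proof. by rewrite linearZ tensZ. Qed.

Lemma base_change_map_tens x : base_change_map (tens x) = tens (h x).
Proof. exact: base_change_lift_tens. Qed.

HB.instance Definition _ := GRing.isLinear.Build B _ _ _ base_change_map
  (base_change_lift_is_linear hD hZ).

End Map.
End BaseChange.

Arguments base_change_map {A B} f {L L'} h t.
Arguments base_change_lift {A B} f {L W} h t.

Section FreeAlgebra.
Context (K : comNzRingType) (X : choiceType).

Definition free_alg : Type := {malg K[{fmonom X}]}.
HB.instance Definition _ := GRing.Lalgebra.on free_alg.

Lemma free_alg_scalerAr (c : K) (a b : free_alg) : c *: (a * b) = a * (c *: b).
Proof.
suff cC (g : free_alg) : c%:MP * g = g * c%:MP.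
  by rewrite -(mul_malgC c b) -(mul_malgC c) mulrA cC -mulrA.
rewrite [LHS]fgmulUg [RHS]fgmulgU; apply: eq_bigr => k _.
by rewrite mulrC mul1m mulm1.
Qed.

HB.instance Definition _ :=
  GRing.Lalgebra_isAlgebra.Build K free_alg free_alg_scalerAr.

End FreeAlgebra.

HB.lock Definition fvar (K : comNzRingType) (X : choiceType) (x : X)
  : free_alg K X := << fmu x >>.
Canonical fvar_unlockable := Unlockable fvar.unlock.
Arguments fvar {K X}.

Section FreeAlgebraEval.
Context {K : comNzRingType} {X : choiceType} {S : algType K} (h : X -> S).

Definition mon_eval (m : {fmonom X}) : S := \prod_(x <- m) h x.

Definition free_eval (g : free_alg K X) : S := lin_ext mon_eval g.

HB.instance Definition _ := GRing.isLinear.Build K (free_alg K X) S _ free_eval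
  (lin_ext_is_linear mon_eval).

Lemma free_eval_is_monoid_morphism : monoid_morphism free_eval.
Proof.
have mM k1 k2 : mon_eval (mmul k1 k2) = mon_eval k1 * mon_eval k2.
  by rewrite /mon_eval fmM big_cat.
split=> [|g1 g2]; first by rewrite [LHS]lin_extU /mon_eval fm1 big_nil.
have -> : g1 * g2 = \sum_(k1 <- msupp g1) \sum_(k2 <- msupp g2)
    << g1@_k1 * g2@_k2 *g mmul k1 k2 >> by exact: malgME.
rewrite /free_eval linear_sum /= [in RHS]/lin_ext mulr_suml.
apply: eq_bigr => k1 _; rewrite linear_sum mulr_sumr; apply: eq_bigr => k2 _.
apply: (etrans (lin_extUZ _ _ _)).
by rewrite mM -!(scalerAl, scalerAr) scalerA.
Qed.

HB.instance Definition _ := GRing.isMonoidMorphism.Build (free_alg K X) S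
  free_eval free_eval_is_monoid_morphism.

Lemma free_eval_var x : free_eval (fvar x) = h x.
Proof. by rewrite /free_eval unlock lin_extU /mon_eval fmU big_seq1. Qed.

End FreeAlgebraEval.

(* The K-algebra generated by [X] with relations u = v for [rel u v]: the
   quotient of the free algebra by a two-sided ideal, obtained as the left
   submodule generated by the (u - v) * b.  It may be trivial, hence is only a
   [pzRingType]. *)
Section PresentedAlgebra.
Context {K : comNzRingType} {X : choiceType}.
Local Notation T := (free_alg K X).
Context (rel : T -> T -> Prop).

Definition rel_ideal_gen (w : T^o) : Prop :=
  exists u v b : T, rel u v /\ w = (u - v) * b.

Definition presented : Type := quot_mod rel_ideal_gen.
HB.instance Definition _ := GRing.Zmodule.on presented.

Definition pcls (w : T) : presented := cls rel_ideal_gen w.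
Definition prep (x : presented) : T := rep x.

Lemma prepK : cancel prep pcls. Proof. exact: repK. Qed.

Lemma pcls_eq u v : pcls u = pcls v <-> lspan rel_ideal_gen (u - v : T^o).
Proof. exact: cls_eq. Qed.

Lemma rel_idealMr (u b : T) :
  lspan rel_ideal_gen (u : T^o) -> lspan rel_ideal_gen (u * b : T^o).
Proof.
case=> s Gs ->; exists [seq (p.1, (p.2 : T) * b) | p <- s].
  move=> p /mapP[p' /Gs[u' [v' [b' [uv ->]]]] ->] /=.
  by exists u', v', (b' * b); rewrite mulrA.
by rewrite big_map mulr_suml; apply: eq_bigr => p _; rewrite -mulrA.
Qed.

Lemma rel_idealMl (u b : T) :
  lspan rel_ideal_gen (u : T^o) -> lspan rel_ideal_gen (b * u : T^o).
Proof.
move=> /in_lspanP h; apply/in_lspanP.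
have -> : (b * u : T^o) = b *: (u : T^o) by [].
exact: rpredZ.
Qed.

Definition pone : presented := pcls 1.
Definition pmul (x y : presented) : presented := pcls (prep x * prep y).
Definition pscale (c : K) (x : presented) : presented := pcls (c *: prep x).

Lemma pclsD u v : pcls (u + v) = pcls u + pcls v. Proof. exact: clsD. Qed.

Lemma pclsM u v : pcls (u * v) = pmul (pcls u) (pcls v).
Proof.
have E w : lspan rel_ideal_gen (w - prep (pcls w) : T^o).
  by apply/cls_eq; rewrite repK.
apply: (etrans (y := pcls (prep (pcls u) * v))); apply/pcls_eq.
  by rewrite -mulrBl; apply: rel_idealMr.
by rewrite -mulrBr; apply: rel_idealMl.
Qed.

Lemma pclsZ c u : pcls (c *: u) = pscale c (pcls u).
Proof.
apply/pcls_eq; rewrite -scalerBr -mulr_algl; apply: rel_idealMl.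
by apply/cls_eq; rewrite repK.
Qed.

Lemma pmulA : associative pmul.
Proof.
by move=> x y z; rewrite -[x]prepK -[y]prepK -[z]prepK -!pclsM mulrA.
Qed.
Lemma pmul1l : left_id pone pmul.
Proof. by move=> x; rewrite -[x]prepK -pclsM mul1r. Qed.
Lemma pmul1r : right_id pone pmul.
Proof. by move=> x; rewrite -[x]prepK -pclsM mulr1. Qed.
Lemma pmulDl : left_distributive pmul +%R.
Proof.
by move=> x y z; rewrite -[x]prepK -[y]prepK -[z]prepK -!(pclsM, pclsD) mulrDl.
Qed.
Lemma pmulDr : right_distributive pmul +%R.
Proof.
by move=> x y z; rewrite -[x]prepK -[y]prepK -[z]prepK -!(pclsM, pclsD) mulrDr.
Qed.

HB.instance Definition _ := GRing.Zmodule_isPzRing.Build presented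
  pmulA pmul1l pmul1r pmulDl pmulDr.

Lemma pscaleA a b x : pscale a (pscale b x) = pscale (a * b) x.
Proof. by rewrite -[x]prepK -!pclsZ scalerA. Qed.
Lemma pscale1 : left_id 1 pscale.
Proof. by move=> x; rewrite -[x]prepK -!pclsZ scale1r. Qed.
Lemma pscaleDr : right_distributive pscale +%R.
Proof.
by move=> a x y; rewrite -[x]prepK -[y]prepK -!(pclsZ, pclsD) scalerDr.
Qed.
Lemma pscaleDl x : {morph pscale^~ x : a b / a + b}.
Proof. by move=> a b; rewrite -[x]prepK -!(pclsZ, pclsD) scalerDl. Qed.

HB.instance Definition _ := GRing.Zmodule_isLmodule.Build K presented
  pscaleA pscale1 pscaleDr pscaleDl.

Lemma presented_scalerAl (c : K) (x y : presented) : c *: (x * y) = (c *: x) * y.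
Proof.
change (pscale c (pmul x y) = pmul (pscale c x) y).
by rewrite -[x]prepK -[y]prepK -!(pclsM, pclsZ) scalerAl.
Qed.
Lemma presented_scalerAr (c : K) (x y : presented) : c *: (x * y) = x * (c *: y).
Proof.
change (pscale c (pmul x y) = pmul x (pscale c y)).
by rewrite -[x]prepK -[y]prepK -!(pclsM, pclsZ) scalerAr.
Qed.

Lemma pcls_is_monoid_morphism : monoid_morphism pcls.
Proof. by split; [reflexivity | exact: pclsM]. Qed.
Lemma pcls_is_linear : linear pcls.
Proof.
move=> c u v; change (pcls (c *: u + v) = pscale c (pcls u) + pcls v).
by rewrite -pclsZ -pclsD.
Qed.

HB.instance Definition _ := GRing.isLinear.Build K T presented _ pcls
  pcls_is_linear.
HB.instance Definition _ := GRing.isMonoidMorphism.Build T presented pcls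
  pcls_is_monoid_morphism.

Lemma pcls_rel u v : rel u v -> pcls u = pcls v.
Proof.
by move=> uv; apply/pcls_eq/lspan_gen; exists u, v, 1; rewrite mulr1.
Qed.

Section Lift.
Context (S : algType K) (h : X -> S).
Hypothesis h_rel : forall u v, rel u v -> free_eval h u = free_eval h v.

Definition presented_lift (x : presented) : S := free_eval h (prep x).

Lemma presented_lift_cls w : presented_lift (pcls w) = free_eval h w.
Proof.
have /pcls_eq[s Gs E] := prepK (pcls w).
apply/eqP; rewrite -subr_eq0 -[_ - _](raddfB (free_eval h)) /= E.
rewrite raddf_sum big_seq big1 //= => p /Gs[u [v [b [/h_rel uv ->]]]].
by rewrite !rmorphM rmorphB /= uv subrr mul0r mulr0.
Qed.

Lemma presented_lift_is_linear : linear presented_lift.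
Proof.
move=> c x y; rewrite -[x]prepK -[y]prepK -[X in presented_lift X]linearP /=.
by rewrite !presented_lift_cls linearP.
Qed.

Lemma presented_lift_is_monoid_morphism : monoid_morphism presented_lift.
Proof.
split=> [|x y]; first by rewrite presented_lift_cls rmorph1.
rewrite -[x]prepK -[y]prepK -[X in presented_lift X]rmorphM /=.
by rewrite !presented_lift_cls rmorphM.
Qed.

Lemma presented_neq0 : (1 : presented) != 0.
Proof.
apply/eqP => /(congr1 presented_lift) /eqP.
rewrite presented_lift_cls rmorph1.
have -> : (0 : presented) = pcls 0 by rewrite raddf0.
by rewrite presented_lift_cls raddf0 oner_eq0.
Qed.

End Lift.
End PresentedAlgebra.

Section ExpSeries.
Context {K : fieldType} {A : algType K} (X : nat -> A).

(* coefficient of t^n in (\sum_(i >= 1) X_i t^i)^j *)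
Fixpoint series_pow (j n : nat) : A :=
  if j is j'.+1 then \sum_(1 <= i < n.+1) X i * series_pow j' (n - i)
  else (n == 0%N)%:R.

(* coefficient of t^n in exp (\sum_(i >= 1) X_i t^i); the powers j > n do not
   contribute *)
Definition exp_series (n : nat) : A :=
  \sum_(j < n.+1) (j`!%:R : K)^-1 *: series_pow j n.

End ExpSeries.

(* The field F(q^(1/2)), with 'X in the role of q^(1/2). *)
Notation Fq F := {fraction {poly F}}.

Lemma sub_fracs (K : fieldType) (a b c d : K) : b != 0 -> d != 0 ->
  a / b - c / d = (a * d - c * b) / (b * d).
Proof. by move=> b0 d0; rewrite -mulNr addf_div // mulNr. Qed.

Section QuantumScalars.
Context (F : fieldType).

Definition qhalf : Fq F := FracField.tofrac 'X.
Definition q : Fq F := qhalf ^+ 2.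
Definition qint (n : int) : Fq F := (q ^ n - q ^ (- n)) / (q - q ^ (-1)).

(* Rational functions in q^(1/2) without pole at 0. *)
Definition regular0 (x : Fq F) : Prop :=
  exists p s : {poly F}, s.[0] != 0 /\
    x = FracField.tofrac p / FracField.tofrac s.

Definition in_A0 : {pred Fq F} := fun x => `[< regular0 x >].

Lemma horner0_tofrac_neq0 (s : {poly F}) :
  s.[0] != 0 -> FracField.tofrac s != 0.
Proof. by rewrite tofrac_eq0; apply: contra_neq => ->; rewrite horner0. Qed.

Lemma in_A0_subring_closed : subring_closed in_A0.
Proof.
split.
- by apply/asboolP; exists 1, 1; rewrite hornerE oner_neq0 rmorph1 divr1.
- move=> _ _ /asboolP[p [s [s0 ->]]] /asboolP[p' [s' [s'0 ->]]].
  apply/asboolP; exists (p * s' - p' * s), (s * s').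
  rewrite hornerM mulf_neq0 //; split => //.
  by rewrite rmorphB !rmorphM /= sub_fracs ?horner0_tofrac_neq0.
- move=> _ _ /asboolP[p [s [s0 ->]]] /asboolP[p' [s' [s'0 ->]]].
  apply/asboolP; exists (p * p'), (s * s').
  by rewrite hornerM mulf_neq0 // !rmorphM /= mulf_div.
Qed.

HB.instance Definition _ :=
  GRing.isSubringClosed.Build (Fq F) in_A0 in_A0_subring_closed.

Definition A0 : Type := {x : Fq F | x \in in_A0}.
HB.instance Definition _ := SubChoice.on A0.
HB.instance Definition _ := [SubChoice_isSubComNzRing of A0 by <:].

Definition A0_incl : A0 -> Fq F := val.
HB.instance Definition _ := GRing.RMorphism.on A0_incl.

Lemma A0_fracP (x : A0) : exists ps : {poly F} * {poly F}, ps.2.[0] != 0 /\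
  val x = FracField.tofrac ps.1 / FracField.tofrac ps.2.
Proof. by case: x => x /= /asboolP[p [s ?]]; exists (p, s). Qed.

(* evaluation at q^(1/2) = 0 *)
Definition A0_res (x : A0) : F :=
  let ps := projT1 (cid (A0_fracP x)) in ps.1.[0] / ps.2.[0].

Lemma A0_resE (x : A0) (p s : {poly F}) : s.[0] != 0 ->
  val x = FracField.tofrac p / FracField.tofrac s ->
  A0_res x = p.[0] / s.[0].
Proof.
rewrite /A0_res; case: cid => -[p' s'] /= [s'0 ->] s0 /eqP.
rewrite eqr_div ?horner0_tofrac_neq0 // -!rmorphM tofrac_eq => /eqP E.
by apply/eqP; rewrite eqr_div // -!hornerM E.
Qed.

Lemma A0_res_is_zmod_morphism : zmod_morphism A0_res.
Proof.
move=> x y; have [[p s] /= [s0 Ex]] := A0_fracP x.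
have [[p' s'] /= [s'0 Ey]] := A0_fracP y.
rewrite (A0_resE s0 Ex) (A0_resE s'0 Ey).
rewrite (@A0_resE _ (p * s' - p' * s) (s * s')).
- by rewrite !hornerE sub_fracs.
- by rewrite hornerM mulf_neq0.
- rewrite [LHS]raddfB [X in X - _]Ex [X in _ - X]Ey.
  by rewrite rmorphB !rmorphM /= sub_fracs ?horner0_tofrac_neq0.
Qed.

Lemma A0_res_is_monoid_morphism : monoid_morphism A0_res.
Proof.
split=> [|x y].
  rewrite (@A0_resE _ 1 1).
  - by rewrite -polyC1 hornerC divr1.
  - by rewrite hornerE oner_neq0.
  - by rewrite [FracField.tofrac 1]rmorph1 divr1.
have [[p s] /= [s0 Ex]] := A0_fracP x.
have [[p' s'] /= [s'0 Ey]] := A0_fracP y.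
rewrite (A0_resE s0 Ex) (A0_resE s'0 Ey).
rewrite (@A0_resE _ (p * p') (s * s')).
- by rewrite !hornerM mulf_div.
- by rewrite hornerM mulf_neq0.
- by rewrite [LHS]rmorphM [X in X * _]Ex [X in _ * X]Ey !rmorphM mulf_div.
Qed.

HB.instance Definition _ := GRing.isZmodMorphism.Build A0 F A0_res
  A0_res_is_zmod_morphism.
HB.instance Definition _ := GRing.isMonoidMorphism.Build A0 F A0_res
  A0_res_is_monoid_morphism.

End QuantumScalars.

Arguments qhalf {F}.
Arguments q {F}.
Arguments qint {F}.

Inductive Uq_gen : Type :=
| GenX of bool & int                  (* x_k^+ (true) and x_k^- (false) *)
| GenH of {l : int | l != 0}
| GenK of bool                        (* K (true) and K^-1 (false) *)
| GenD of bool
| GenG of bool.                       (* gamma^(1/2) and gamma^(-1/2) *)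

HB.instance Definition _ := gen_eqMixin Uq_gen.
HB.instance Definition _ := gen_choiceMixin Uq_gen.

Definition sgn (e : bool) : int := if e then 1 else -1.

Section Relations.
Context {F : fieldType} {T : algType (Fq F)}.

(* The defining relations of U_q, for elements [gen y] of any algebra [T]; for
   e : bool, e = true stands for the sign + and e = false for the sign -. *)
Section UqRelations.
Context (gen : Uq_gen -> T).

Definition gx (e : bool) (k : int) : T := gen (GenX e k).
(* [gh 0] is a dummy value, never used in the relations below. *)
Definition gh (l : int) : T := if insub l is Some l' then gen (GenH l') else 0.
Definition gK (e : bool) : T := gen (GenK e).
Definition gD (e : bool) : T := gen (GenD e).
Definition gG (e : bool) : T := gen (GenG e).

(* gamma^(n/2) *)
Definition ghalf (n : int) : T :=
  if n is Posz n' then gG true ^+ n' else gG false ^+ `|n|%N.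
Definition ggamma (n : int) : T := ghalf (n *+ 2).

Definition gpsi (k : int) : T :=
  if 0 <= k then
    gK true * exp_series (fun i : nat => (q - q^-1) *: gh i) `|k|%N
  else 0.
Definition gphi (k : int) : T :=
  if k <= 0 then
    gK false * exp_series (fun i : nat => - (q - q^-1) *: gh (- i%:Z)) `|k|%N
  else 0.

Inductive Uq_rel : T -> T -> Prop :=
| Rel_KV e : Uq_rel (gK e * gK (~~ e)) 1
| Rel_DV e : Uq_rel (gD e * gD (~~ e)) 1
| Rel_GV e : Uq_rel (gG e * gG (~~ e)) 1
| Rel_Gcentral e y : Uq_rel (gG e * gen y) (gen y * gG e)
| Rel_hh (k l : int) : k != 0 -> l != 0 ->
    Uq_rel (gh k * gh l - gh l * gh k)
      ((k + l == 0)%:R *: ((qint (2 * k) / k%:~R / (q - q^-1)) *: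
                            (ggamma k - ggamma (- k))))
| Rel_hK (k : int) : k != 0 -> Uq_rel (gh k * gK true) (gK true * gh k)
| Rel_DK : Uq_rel (gD true * gK true) (gK true * gD true)
| Rel_Dh (k : int) : k != 0 -> Uq_rel (gD true * gh k * gD false) (q ^ k *: gh k)
| Rel_Dx e k : Uq_rel (gD true * gx e k * gD false) (q ^ k *: gx e k)
| Rel_Kx e k :
    Uq_rel (gK true * gx e k * gK false) (q ^ (sgn e * 2) *: gx e k)
| Rel_hx e (k l : int) : k != 0 ->
    Uq_rel (gh k * gx e l - gx e l * gh k)
      (((sgn e)%:~R * (qint (2 * k) / k%:~R)) *:
         (ghalf (- sgn e * `|k|) * gx e (k + l)))
| Rel_xx e (k l : int) :
    Uq_rel (gx e (k + 1) * gx e l - q ^ (sgn e * 2) *: (gx e l * gx e (k + 1)))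
      (q ^ (sgn e * 2) *: (gx e k * gx e (l + 1)) - gx e (l + 1) * gx e k)
| Rel_xpxm k l :
    Uq_rel (gx true k * gx false l - gx false l * gx true k)
      ((q - q^-1)^-1 *:
         (ghalf (k - l) * gpsi (k + l) - ghalf (l - k) * gphi (k + l))).

End UqRelations.

Inductive Nq_rel (x : int -> T) : T -> T -> Prop :=
| NqRel (k l : int) :
    Nq_rel x (x (k + 1) * x l - q ^ (-2) *: (x l * x (k + 1)))
      (q ^ (-2) *: (x k * x (l + 1)) - x (l + 1) * x k).

End Relations.

(* The augmentation, which shows that the presented algebras are nontrivial. *)
Section Augmentation.
Context {F : fieldType} {T : algType (Fq F)} (S : comAlgType (Fq F)).
Context (f : {lrmorphism T -> S}).

Let fM u v : f (u * v) = f u * f v. Proof. exact: rmorphM. Qed.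
Let fB u v : f (u - v) = f u - f v. Proof. exact: rmorphB. Qed.
Let fZ c u : f (c *: u) = c *: f u. Proof. exact: linearZ. Qed.
Let f1 : f 1 = 1. Proof. exact: rmorph1. Qed.
Let f0 : f 0 = 0. Proof. exact: rmorph0. Qed.
Let fnat n : f n%:R = n%:R. Proof. exact: rmorph_nat. Qed.
Let fX u n : f (u ^+ n) = f u ^+ n. Proof. exact: rmorphXn. Qed.
Let f_sum (I : Type) (r : seq I) P (E : I -> T) :
  f (\sum_(i <- r | P i) E i) = \sum_(i <- r | P i) f (E i).
Proof. exact: rmorph_sum. Qed.

Definition Uq_aug_gen (y : Uq_gen) : S :=
  match y with GenX _ _ | GenH _ => 0 | _ => 1 end.

Lemma Uq_aug_rel (gen : Uq_gen -> T) u v :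
  (forall y, f (gen y) = Uq_aug_gen y) -> Uq_rel gen u v -> f u = f v.
Proof.
move=> fgen.
have Ex e k : f (gx gen e k) = 0 by exact: fgen.
have EK e : f (gK gen e) = 1 by exact: fgen.
have ED e : f (gD gen e) = 1 by exact: fgen.
have EG e : f (gG gen e) = 1 by exact: fgen.
have Eh k : f (gh gen k) = 0.
  by rewrite /gh; case: insub => [l|]; [exact: fgen | rewrite f0].
have EGh n : f (ghalf gen n) = 1.
  by case: n => n /=; rewrite fX /= EG expr1n.
have Es X n : (forall i, f (X i) = 0) -> f (exp_series X n) = (n == 0%N)%:R.
  move=> X0; have EP j m : f (series_pow X j m) = ((j == 0%N) && (m == 0%N))%:R.
    case: j => [|j] /=; first by rewrite fnat.
    by rewrite f_sum big1 //= => i _; rewrite fM X0 mul0r.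
  rewrite /exp_series f_sum big_ord_recl big1 => [|i _].
    by rewrite fZ EP fact0 invr1 scale1r addr0.
  by rewrite fZ EP scaler0.
have Epsi k : f (gpsi gen k) = (k == 0)%:R.
  rewrite /gpsi; case: k => [n|n] /=; last by rewrite f0.
  by rewrite fM EK mul1r Es // => i; rewrite fZ Eh scaler0.
have Ephi k : f (gphi gen k) = (k == 0)%:R.
  rewrite /gphi; case: k => [[|n]|n] /=; rewrite ?f0 //.
    by rewrite fM EK mul1r Es // => i; rewrite fZ Eh scaler0.
  by rewrite fM EK mul1r Es // => i; rewrite fZ Eh scaler0.
case=> [e|e|e|e y|k l _ _|k _||k _|e k|e k|e k l _|e k l|k l];
  rewrite ?(fB, fZ, fM, f1) /=
          ?(EK, ED, EG, Eh, Ex, EGh, Epsi, Ephi);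
  rewrite ?(mulr0, mul0r, mulr1, mul1r, subrr, scaler0) //.
Qed.

Lemma Nq_aug_rel (x : int -> T) u v :
  (forall k, f (x k) = 0) -> Nq_rel x u v -> f u = f v.
Proof.
move=> fx [k l].
by rewrite !(fB, fZ, fM) /= !fx !mulr0 !scaler0.
Qed.

End Augmentation.

Definition xx_rel {F : fieldType} {T : algType (Fq F)} (x : int -> T)
    (k l : int) : Prop :=
  x (k + 1) * x l - q ^ (-2) *: (x l * x (k + 1)) =
  q ^ (-2) *: (x k * x (l + 1)) - x (l + 1) * x k.

Lemma Nq_rel_morph {F : fieldType} {T T' : algType (Fq F)}
    (f : {lrmorphism T -> T'}) (x : int -> T) (y : int -> T') :
  (forall k, f (x k) = y k) ->
  (forall u v, Nq_rel x u v -> f u = f v) <-> (forall k l, xx_rel y k l).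
Proof.
move=> fx.
have fM a b : f (a * b) = f a * f b by exact: rmorphM.
have fB a b : f (a - b) = f a - f b by exact: rmorphB.
have fZ c a : f (c *: a) = c *: f a by exact: linearZ.
split=> [H k l|yrel _ _ [k l]]; last by rewrite !(fB, fZ, fM, fx) yrel.
by have := H _ _ (NqRel x k l); rewrite !(fB, fZ, fM, fx).
Qed.

Section QuantumAffineAlgebra.
Context (F : fieldType).

Definition Uq : Type := presented (Uq_rel (@fvar (Fq F) Uq_gen)).
HB.instance Definition _ := GRing.PzRing.on Uq.
HB.instance Definition _ := GRing.Lmodule.on Uq.

Lemma Uq_oner_neq0 : (1 : Uq) != 0.
Proof.
apply: (@presented_neq0 _ _ _ (Fq F)^o (Uq_aug_gen (Fq F)^o)) => u v.
by apply: Uq_aug_rel => y; exact: free_eval_var.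
Qed.

HB.instance Definition _ :=
  GRing.PzSemiRing_isNonZero.Build Uq Uq_oner_neq0.
HB.instance Definition _ := GRing.Lmodule_isLalgebra.Build (Fq F) Uq
  (@presented_scalerAl _ _ _).
HB.instance Definition _ := GRing.Lalgebra_isAlgebra.Build (Fq F) Uq
  (@presented_scalerAr _ _ _).

Definition Uq_proj (w : free_alg (Fq F) Uq_gen) : Uq := pcls _ w.
HB.instance Definition _ := GRing.isLinear.Build (Fq F)
  (free_alg (Fq F) Uq_gen) Uq _ Uq_proj (pcls_is_linear _).
HB.instance Definition _ := GRing.isMonoidMorphism.Build
  (free_alg (Fq F) Uq_gen) Uq Uq_proj (pcls_is_monoid_morphism _).

Definition Uq_var (y : Uq_gen) : Uq := Uq_proj (fvar y).

Definition Nq : Type := presented (Nq_rel (@fvar (Fq F) int)).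
HB.instance Definition _ := GRing.PzRing.on Nq.
HB.instance Definition _ := GRing.Lmodule.on Nq.

Lemma Nq_oner_neq0 : (1 : Nq) != 0.
Proof.
apply: (@presented_neq0 _ _ _ (Fq F)^o (fun=> 0)) => u v.
by apply: Nq_aug_rel => k; exact: free_eval_var.
Qed.

HB.instance Definition _ :=
  GRing.PzSemiRing_isNonZero.Build Nq Nq_oner_neq0.
HB.instance Definition _ := GRing.Lmodule_isLalgebra.Build (Fq F) Nq
  (@presented_scalerAl _ _ _).
HB.instance Definition _ := GRing.Lalgebra_isAlgebra.Build (Fq F) Nq
  (@presented_scalerAr _ _ _).

Definition Nq_var (k : int) : Nq := pcls _ (fvar k).

End QuantumAffineAlgebra.

Section NegativePart.
Context {F : fieldType}.

Lemma Nq_to_Uq_rel u v : Nq_rel (@fvar (Fq F) int) u v ->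
  free_eval (gx (@Uq_var F) false) u = free_eval (gx (@Uq_var F) false) v.
Proof.
apply: (iffRL (Nq_rel_morph _)) => [k|]; first exact: free_eval_var.
apply: (iffLR (Nq_rel_morph (f := @Uq_proj F)
  (x := gx (@fvar (Fq F) Uq_gen) false) _)) => // u' v' [k l].
exact: (pcls_rel (Rel_xx (@fvar (Fq F) Uq_gen) false k l)).
Qed.

Definition Nq_to_Uq (a : Nq F) : Uq F :=
  presented_lift (gx (@Uq_var F) false) a.
HB.instance Definition _ := GRing.isLinear.Build (Fq F) (Nq F) (Uq F) _ Nq_to_Uq
  (presented_lift_is_linear Nq_to_Uq_rel).
HB.instance Definition _ := GRing.isMonoidMorphism.Build (Nq F) (Uq F) Nq_to_Uq
  (presented_lift_is_monoid_morphism Nq_to_Uq_rel).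

Lemma Nq_to_Uq_var k : Nq_to_Uq (Nq_var F k) = gx (@Uq_var F) false k.
Proof.
exact: etrans (presented_lift_cls Nq_to_Uq_rel _) (free_eval_var _ _).
Qed.

(* Taylor coefficients at t = 0 of (q^-2 t - 1) / (t - q^-2). *)
Definition g_taylor (r : nat) : Fq F :=
  if r is r'.+1 then (q ^+ 4 - 1) * q ^+ (2 * r') else q ^+ 2.

(* The sum over r >= 0 in the recursion is finite: its terms of index r >= n
   vanish. *)
Definition is_Omega_psi (Om : int -> {linear Nq F -> Nq F}) : Prop :=
  (forall k, Om k 1 = 0) /\
  forall (k m : int) (a : Nq F), exists n : nat,
    (forall r : nat, (n <= r)%N -> Om (k - r%:Z) a = 0) /\
    Om k (Nq_var F m * a) = (k == - m)%:R *: a +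
      \sum_(r < n) g_taylor r *: (Nq_var F (m + r%:Z) * Om (k - r%:Z) a).

Definition Omega_psi : int -> {linear Nq F -> Nq F} :=
  the_such is_Omega_psi (fun=> \0).

End NegativePart.

(* An integral weight, given by its values on h, c and d. *)
Record weight : Type := Weight { wt_h : int; wt_c : int; wt_d : int }.

HB.instance Definition _ := gen_eqMixin weight.
HB.instance Definition _ := gen_choiceMixin weight.

Definition in_hred (lam : weight) : Prop := wt_c lam = 0 /\ wt_h lam != 0.

Definition sub_mod (R : pzRingType) (V : lmodType R) (L : submodClosed V)
  : Type := {x : V | x \in L}.

Section SubModule.
Context (R : pzRingType) (V : lmodType R) (L : submodClosed V).
HB.instance Definition _ := SubChoice.on (sub_mod L).
HB.instance Definition _ := [SubChoice_isSubLmodule of sub_mod L by <:].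

Lemma sub_mod_valP (a : R) (x y : sub_mod L) :
  val (a *: x + y) = a *: val x + val y.
Proof. by []. Qed.
End SubModule.

(* A U_q-module seen as a vector space over F(q^(1/2)), resp. as a module over
   [A0]. *)
Definition over_Fq (F : fieldType) (M : lmodType (Uq F)) : Type :=
  restr (in_alg (Uq F)) M.
HB.instance Definition _ (F : fieldType) (M : lmodType (Uq F)) :=
  GRing.Lmodule.on (over_Fq M).

Definition over_A0 (F : fieldType) (M : lmodType (Uq F)) : Type :=
  restr (@A0_incl F) (over_Fq M).
HB.instance Definition _ (F : fieldType) (M : lmodType (Uq F)) :=
  GRing.Lmodule.on (over_A0 M).

Section UqModules.
Context {F : fieldType}.

Section WeightSpaces.
Context {M : lmodType (Uq F)}.

Definition weight_space (mu : weight) (m : over_Fq M) : Prop :=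
  gK (@Uq_var F) true *: (m : M) = q ^ wt_h mu *: m /\
  gD (@Uq_var F) true *: (m : M) = q ^ wt_d mu *: m.

(* The weight spaces do not see the value at c; it is 0 since gamma acts as 1
   on the modules considered here. *)
Definition is_weight (mu : weight) : Prop :=
  wt_c mu = 0 /\ exists2 m : over_Fq M, m != 0 & weight_space mu m.

(* Multiplication by x_k^- : on a sum of reduced imaginary Verma modules this is
   the operator sending a v to x_k^- a v, summandwise. *)
Definition xminus (k : int) (m : over_Fq M) : over_Fq M :=
  gx (@Uq_var F) false k *: (m : M).

Lemma xminus_is_linear k : linear (xminus k).
Proof.
move=> c u v; rewrite /xminus scalerDr; congr (_ + _).
change (gx (@Uq_var F) false k *: (c%:A *: (u : M)) =
  c%:A *: (gx (@Uq_var F) false k *: (u : M))).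
by rewrite !scalerA mulr_algl mulr_algr.
Qed.
HB.instance Definition _ k := GRing.isLinear.Build (Fq F) (over_Fq M)
  (over_Fq M) _ (xminus k) (xminus_is_linear k).

End WeightSpaces.

Section ReducedVerma.
Context (lam : weight).

Inductive rverma_gen : (Uq F)^o -> Prop :=
| RV_x k : rverma_gen (gx (@Uq_var F) true k)
| RV_h (l : int) : l != 0 -> rverma_gen (gh (@Uq_var F) l)
| RV_K e : rverma_gen (gK (@Uq_var F) e - (q ^ (sgn e * wt_h lam))%:A)
| RV_G e : rverma_gen (gG (@Uq_var F) e - 1)
| RV_D e : rverma_gen (gD (@Uq_var F) e - (q ^ (sgn e * wt_d lam))%:A).

Definition rverma : Type := quot_mod rverma_gen.
HB.instance Definition _ := GRing.Lmodule.on rverma.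

Definition hwv : rverma := cls rverma_gen 1.

(* The elements [Nq_to_Uq a *: hwv] exhaust [rverma], so this condition
   determines [Om]. *)
Definition is_Omega_rverma (Om : int -> {linear over_Fq rverma -> over_Fq rverma})
  : Prop :=
  forall (m : int) (a : Nq F),
    Om m (Nq_to_Uq a *: hwv) = Nq_to_Uq (Omega_psi m a) *: hwv.

Definition Omega_rverma : int -> {linear over_Fq rverma -> over_Fq rverma} :=
  the_such is_Omega_rverma (fun=> \0).

End ReducedVerma.

(* An object of O^q_(red,im): a U_q-module with a decomposition as a direct sum
   of reduced imaginary Verma modules with weights in h^*_red. *)
Record Ored : Type := MkOred {
  Ored_mod :> lmodType (Uq F);
  Ored_idx : choiceType;
  Ored_wt : Ored_idx -> weight;
  Ored_wt_hred : forall i, in_hred (Ored_wt i);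
  Ored_emb : forall i, {linear rverma (Ored_wt i) -> Ored_mod};
  Ored_emb_inj : forall i, injective (Ored_emb i);
  Ored_dsum : is_direct_sum (fun=> True)
    (fun i (m : Ored_mod) => exists w, m = Ored_emb i w)
}.

Lemma rverma_dsum (lam : weight) :
  is_direct_sum (fun _ : unit => True)
    (fun _ (m : rverma lam) => exists w, m = (idfun : {linear _ -> _}) w).
Proof.
split=> [x|s y us _ + [] si].
  by exists [:: tt], (fun=> x); split=> [i _|]; [split=> //; exists x | rewrite big_seq1].
have -> : s = [:: tt] by case: s us si => [|[] [|[] s]].
by rewrite big_seq1.
Qed.

Definition rverma_Ored (lam : weight) (hlam : in_hred lam) : Ored :=
  @MkOred (rverma lam) unit (fun=> lam) (fun=> hlam) (fun=> idfun)
    (fun _ _ _ => id) (@rverma_dsum lam).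

Section CrystalBases.
Context (M : Ored).
Local Notation MK := (over_Fq M).

Definition is_Omega_tilde (Om : int -> {linear MK -> MK}) : Prop :=
  forall (m : int) (i : Ored_idx M) (w : rverma (Ored_wt i)),
    Om m (Ored_emb i w) = Ored_emb i (Omega_rverma (Ored_wt i) m w).

Definition Omega_tilde : int -> {linear MK -> MK} :=
  the_such is_Omega_tilde (fun=> \0).

Section Lattice.
Context (L : submodClosed (over_A0 M)).

Definition lattice_wt (mu : weight) (x : sub_mod L) : Prop :=
  weight_space mu (val x : MK).

(* [lattice_generates]: the canonical map F(q^(1/2)) (x)_A0 L -> M, sending
   c (x) x to c x, is bijective. *)
Record is_crystal_lattice : Prop := IsCrystalLattice {
  lattice_free : exists B : sub_mod L -> Prop, is_basis B;
  lattice_generates : bijective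
    (base_change_lift (@A0_incl F) (fun x : sub_mod L => (val x : MK)));
  lattice_weights : is_direct_sum (@is_weight M) lattice_wt;
  lattice_Omega : forall (m : int) (x : MK), x \in L -> Omega_tilde m x \in L;
  lattice_xminus : forall (m : int) (x : MK), x \in L -> xminus m x \in L
}.

(* F (x)_A0 L *)
Definition reduction : lmodType F := base_change (@A0_res F) (sub_mod L).

Section Induced.
Context (f : {linear MK -> MK}) (fL : forall x : MK, x \in L -> f x \in L).

Definition restr_op (x : sub_mod L) : sub_mod L :=
  exist _ (f (val x : MK) : over_A0 M) (fL (valP x)).

Lemma restr_op_is_linear : linear restr_op.
Proof.
move=> a x y; apply: val_inj.
have valP' (z w : sub_mod L) :
  (val (a *: z + w) : MK) = A0_incl a *: (val z : MK) + (val w : MK).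
  by rewrite sub_mod_valP.
have restrE z : (val (restr_op z) : MK) = f (val z : MK) by [].
apply: (etrans (restrE _)).
rewrite valP'.
rewrite linearP.
exact: (esym (valP' (restr_op x) (restr_op y))).
Qed.
HB.instance Definition _ := GRing.isLinear.Build (A0 F) (sub_mod L) (sub_mod L)
  _ restr_op restr_op_is_linear.

Definition induced : {linear reduction -> reduction} :=
  base_change_map (@A0_res F) restr_op.

End Induced.

(* The image of F (x)_A0 L_mu in F (x)_A0 L. *)
Definition reduction_wt (mu : weight) : reduction -> Prop :=
  lspan (fun t : reduction =>
    exists2 x : sub_mod L, lattice_wt mu x & t = tens (@A0_res F) x).

Definition basis_wt (B : reduction -> Prop) (mu : weight) (b : reduction)
  : Prop := B b /\ reduction_wt mu b.

Definition pm0 (B : reduction -> Prop) (b : reduction) : Prop :=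
  B b \/ B (- b) \/ b = 0.

Record is_crystal_basis (B : reduction -> Prop) : Prop := IsCrystalBasis {
  cb_lattice : is_crystal_lattice;
  cb_x := fun m => induced (lattice_xminus cb_lattice m);
  cb_Omega := fun m => induced (lattice_Omega cb_lattice m);
  cb_basis : is_basis B;
  cb_weights : forall b, B b <->
    exists2 mu, is_weight (M := M) mu & basis_wt B mu b;
  cb_x_stable : forall (m : int) b, B b -> pm0 B (cb_x m b);
  cb_Omega_stable : forall (m : int) b, B b -> pm0 B (cb_Omega m b);
  cb_comm : forall (m : int) b, B b -> cb_Omega (- m) b <> 0 -> cb_x m b <> 0 ->
    cb_x m (cb_Omega (- m) b) = cb_Omega (- m) (cb_x m b)
}.

End Lattice.
End CrystalBases.

Section TheCrystal.
Context (lam : weight).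

Definition nonincreasing (s : seq int) : bool := sorted (fun i j => j <= i) s.

Definition monomial (s : seq int) : rverma lam :=
  (\prod_(i <- s) gx (@Uq_var F) false i) *: hwv lam.

Definition is_ordered_monomial (m : over_A0 (rverma lam)) : Prop :=
  exists2 s, nonincreasing s & m = monomial s.

Definition crystal_L : submodClosed (over_A0 (rverma lam)) :=
  in_lspan is_ordered_monomial.

Definition crystal_B (b : base_change (@A0_res F) (sub_mod crystal_L)) : Prop :=
  exists2 x : sub_mod crystal_L,
    is_ordered_monomial (val x) & b = tens (@A0_res F) x.

End TheCrystal.
End UqModules.

(* Main.v *)
From HB Require Import structures.
Require Import Defs.
From mathcomp Require Import all_boot all_order all_algebra ssrAC.
From mathcomp Require Import finmap monalg boolp functions zify ring.
Set Implicit Arguments.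
Unset Strict Implicit.
Unset Printing Implicit Defensive.
Import Order.TTheory GRing.Theory Num.Theory.
Local Open Scope ring_scope.

(** Write [N] for the negative part and [v] for the highest weight vector.

    The map [a |-> a v] identifies [N] with the Verma module.  It is surjective
    because the relations of U_q move every other generator to the right of the
    x^-_k until it meets [v] ([Nq_hwv_surj]).  For injectivity U_q is made to act
    on [N] itself ([Uq_ops_exist], [Uq_action_on_vacuum]): K and D act by the two
    gradings, h_i is a derivation, and x^+_i is the operator whose commutators
    with left multiplication by the x^-_m are the currents psi - phi.  These
    operators exist by the universal property of [N] ([Nq_rec]).  Every relation
    between them says that some operator vanishes; it kills 1 and commutes with
    the x^-_m up to scalars, so it is 0.  The one computation is the exchange
    relation of currents ([current_exchange]), which follows from the differential
    equation of an exponential series.  Likewise, the operators Omega exist because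
    their recursion makes the x^-_m act on the pairs of an element of [N] and a
    sequence bounded below ([omega_exists]).

    In the quadratic relation every product with its indices in the wrong order is
    a combination of better ordered ones, with coefficients -1 and q^2.  Hence
    ordered monomials generate [N], and their span over the scalars regular at 0
    is stable under all x^-_m ([straighten], [ordered_span_stable]), therefore
    also under the operators Omega, by their recursion ([lattice_Om]).
    They are independent because Omega(-m), for [m] the largest first entry which
    occurs, kills the monomials that begin with a smaller entry and deletes the
    entry [m] from the others, up to a scalar which is 1 at q = 0
    ([ordered_independent]).  So the span is a lattice.  Its weight decomposition
    comes from the monomials being weight vectors: the weight of a vector is
    determined by its eigenvalues under K and D, as q has infinite order
    ([model_weights]).

    At q = 0 the relations become x_l x_(k+1) = - x_k x_(l+1), and in particular
    x_k x_(k+1) = 0, while Omega(k) x_m = delta_(k,-m) - x_(m+1) Omega(k-1).  By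
    induction on the length, x_m and Omega(m) send an ordered monomial to 0 or, up
    to sign, to an ordered monomial, and x_m Omega(-m) b = b as soon as
    Omega(-m) b is nonzero ([fermion_X_stable], [fermion_Om_stable],
    [fermion_X_Om]).  The commutation required of a crystal basis follows
    ([fermion_commute]), and the independence of the ordered monomials at q = 0 is
    proved as before ([red_basis]). *)

(** * The algebra of linear endomorphisms *)

Definition mklin {K : pzRingType} {U V : lmodType K} {f : U -> V}
    (f_lin : linear f) : {linear U -> V} :=
  HB.pack f (GRing.isLinear.Build K U V _ f f_lin).

Section Endomorphisms.
Context (K : comNzRingType) (V : lmodType K).

(** The proof [ntV] is a parameter so that the endomorphisms of [V] form a
    nontrivial ring, hence an algebra in which relations can be evaluated. *)
Record endo (ntV : exists v : V, v != 0) : Type :=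
  Endo { endo_fun :> {linear V -> V} }.

Context (ntV : exists v : V, v != 0).
Local Notation E := (endo ntV).
Local Notation mkE := (Endo ntV).

Lemma endoP (f g : E) : (forall v, f v = g v) -> f = g.
Proof.
case: f g => -[f [[af] [lf]]] [[g [[ag] [lg]]]] /= eqfg.
have {}eqfg : f = g by exact: funext.
rewrite -{}eqfg in ag lg *; congr Endo.
by rewrite (Prop_irrelevance af ag) (Prop_irrelevance lf lg).
Qed.

HB.instance Definition _ := gen_eqMixin E.
HB.instance Definition _ := gen_choiceMixin E.

Definition endo_opp (f : E) : E := mkE ((-1) \*: f).
Definition endo_zero : E := mkE (\0).
Definition endo_add (f g : E) : E := mkE (f \+ g).
Definition endo_one : E := mkE (idfun).
Definition endo_mul (f g : E) : E := mkE (f \o g).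
Definition endo_scale (c : K) (f : E) : E := mkE (c \*: f).

Fact endo_addA : associative endo_add.
Proof. by move=> f g h; apply: endoP => v /=; rewrite addrA. Qed.
Fact endo_addC : commutative endo_add.
Proof. by move=> f g; apply: endoP => v /=; rewrite addrC. Qed.
Fact endo_add0 : left_id endo_zero endo_add.
Proof. by move=> f; apply: endoP => v /=; rewrite add0r. Qed.
Fact endo_addN : left_inverse endo_zero endo_opp endo_add.
Proof. by move=> f; apply: endoP => v /=; rewrite scaleN1r addNr. Qed.
HB.instance Definition _ := GRing.isZmodule.Build E
  endo_addA endo_addC endo_add0 endo_addN.

Fact endo_mulA : associative endo_mul.
Proof. by move=> f g h; apply: endoP. Qed.
Fact endo_mul1 : left_id endo_one endo_mul.
Proof. by move=> f; apply: endoP. Qed.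
Fact endo_mulr1 : right_id endo_one endo_mul.
Proof. by move=> f; apply: endoP. Qed.
Fact endo_mulDl : left_distributive endo_mul +%R.
Proof. by move=> f g h; apply: endoP. Qed.
Fact endo_mulDr : right_distributive endo_mul +%R.
Proof. by move=> f g h; apply: endoP => v /=; rewrite linearD. Qed.
Fact endo_1neq0 : endo_one != 0.
Proof.
apply/eqP => eq10; case: ntV => v /eqP; apply.
by have : endo_one v = (0 : E) v by rewrite eq10.
Qed.
HB.instance Definition _ := GRing.Zmodule_isNzRing.Build E
  endo_mulA endo_mul1 endo_mulr1 endo_mulDl endo_mulDr endo_1neq0.

Fact endo_scaleA a b f : endo_scale a (endo_scale b f) = endo_scale (a * b) f.
Proof. by apply: endoP => v /=; rewrite scalerA. Qed.
Fact endo_scale1 : left_id 1 endo_scale.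
Proof. by move=> f; apply: endoP => v /=; rewrite scale1r. Qed.
Fact endo_scaleDr : right_distributive endo_scale +%R.
Proof. by move=> a f g; apply: endoP => v /=; rewrite scalerDr. Qed.
Fact endo_scaleDl f : {morph endo_scale^~ f : a b / a + b}.
Proof. by move=> a b; apply: endoP => v /=; rewrite scalerDl. Qed.
HB.instance Definition _ := GRing.Zmodule_isLmodule.Build K E
  endo_scaleA endo_scale1 endo_scaleDr endo_scaleDl.

Fact endo_scaleAl (a : K) (f g : E) : a *: (f * g) = (a *: f) * g.
Proof. by apply: endoP. Qed.
Fact endo_scaleAr (a : K) (f g : E) : a *: (f * g) = f * (a *: g).
Proof. by apply: endoP => v; exact: esym (linearZ_LR f _ _). Qed.
HB.instance Definition _ := GRing.Lmodule_isLalgebra.Build K E endo_scaleAl.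
HB.instance Definition _ := GRing.Lalgebra_isAlgebra.Build K E endo_scaleAr.

Lemma endoDE (f g : E) v : (f + g) v = f v + g v. Proof. by []. Qed.
Lemma endoNE (f : E) v : (- f) v = - f v. Proof. exact: scaleN1r. Qed.

Lemma endoBE (f g : E) v : (f - g) v = f v - g v.
Proof. by rewrite endoDE endoNE. Qed.
Lemma endoME (f g : E) v : (f * g) v = f (g v). Proof. by []. Qed.
Lemma endoZE c (f : E) v : (c *: f) v = c *: f v. Proof. by []. Qed.
Lemma endo1E v : (1 : E) v = v. Proof. by []. Qed.
Lemma endo0E v : (0 : E) v = 0. Proof. by []. Qed.
Definition endoE := (endoBE, endoDE, endoZE, endoME).

End Endomorphisms.
Arguments Endo {K V} ntV _.

(** * The universal property of the negative part *)

Lemma malg_UZ (K : nzRingType) (X : choiceType) (c : K) (k : X) :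
  << c *g k >> = c *: << k >> :> {malg K[X]}.
Proof. by apply/malgP => j; rewrite mcoeffZ !mcoeffU mulrnAr mulr1. Qed.

Lemma xx_mulr (K : comNzRingType) (A : algType K) (c : K) (u v w z a : A) :
  u * v - c *: (v * u) = c *: (w * z) - z * w ->
  u * (v * a) - c *: (v * (u * a)) = c *: (w * (z * a)) - z * (w * a).
Proof.
by move/(congr1 ( *%R^~ a)); rewrite !mulrBl -!scalerAl !mulrA.
Qed.

(** A presented algebra is spanned by words in its generators, so a property
    which is stable under linear combinations only has to be propagated through
    left multiplication by a generator. *)
Lemma presented_ind (K : comNzRingType) (X : choiceType)
    (rel : free_alg K X -> free_alg K X -> Prop) (P : presented rel -> Prop) :
  P 0 -> (forall c a b, P a -> P b -> P (c *: a + b)) ->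
  P 1 -> (forall m a, P a -> P (pcls rel (fvar m) * a)) -> forall a, P a.
Proof.
move=> P0 PD P1 Px a; rewrite -[a]prepK [prep a]monalgE.
have pM u v : pcls rel (u * v) = pcls rel u * pcls rel v by exact: pclsM.
have pD u v : pcls rel (u + v) = pcls rel u + pcls rel v by exact: pclsD.
have pZ c u : pcls rel (c *: u) = c *: pcls rel u by exact: pclsZ.
have Pm (k : {fmonom X}) : P (pcls rel << k >>).
  case: k => s; elim: s => [|m s IHs].
    by rewrite -[X in << X >>]fmoneE.
  have -> : << FMonom (m :: s) >> = fvar m * << FMonom s >> :> free_alg K X.
    rewrite unlock; apply: etrans (esym (fgmulUU _ _ _ _)) => //.
    by rewrite mulr1 [mmul _ _]fmmulE /= fmU.
  by rewrite pM; apply: Px.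
elim/big_rec: _ => [|k t _ Pt]; first by rewrite raddf0.
by rewrite malg_UZ pD pZ; apply: PD.
Qed.

Section NegativePartTheory.
Context {F : fieldType}.
Local Notation K := (Fq F).
Local Notation N := (Nq F).
Local Notation x := (@Nq_var F).
Local Notation q := (@q F).

Definition Nq_proj (w : free_alg K int) : N := pcls _ w.
HB.instance Definition _ := GRing.isLinear.Build K (free_alg K int) N _ Nq_proj
  (pcls_is_linear _).
HB.instance Definition _ := GRing.isMonoidMorphism.Build (free_alg K int) N
  Nq_proj (pcls_is_monoid_morphism _).

Lemma Nq_ind (P : N -> Prop) :
  P 0 -> (forall c a b, P a -> P b -> P (c *: a + b)) ->
  P 1 -> (forall m a, P a -> P (x m * a)) -> forall a, P a.
Proof. exact: presented_ind. Qed.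

Lemma Nq_xx k l : xx_rel x k l.
Proof.
apply: (iffLR (Nq_rel_morph (f := Nq_proj) (x := fvar) _)) => // u v uv.
exact: pcls_rel.
Qed.

Definition xx_op (W : lmodType K) (X : int -> {linear W -> W}) : Prop :=
  forall k l w,
    X (k + 1) (X l w) - q ^ (-2) *: X l (X (k + 1) w) =
    q ^ (-2) *: X k (X (l + 1) w) - X (l + 1) (X k w).

(** [N] is free of rank one over itself: a linear map out of [N] may be defined
    by its value at 1 and the effect of left multiplication by the generators, as
    soon as the latter satisfies the quadratic relations.  The graph of the map
    is the orbit of [(1, w)] under the action of [N] on [N * W], and pairing with
    [N] itself ensures that the space acted upon is nontrivial. *)
Lemma Nq_rec (W : lmodType K) (X : int -> {linear W -> W}) (w : W) :
  xx_op X ->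
  {f : {linear N -> W} | f 1 = w & forall m a, f (x m * a) = X m (f a)}.
Proof.
move=> Xxx.
pose V : lmodType K := (N * W)%type.
have ntV : exists v : V, v != 0.
  by exists (1, 0); apply/eqP => -[/eqP]; rewrite oner_eq0.
have Alin m : linear (fun v : V => (x m * v.1, X m v.2) : V).
  move=> c [a b] [a' b'] /=; rewrite mulrDr linearP -scalerAr.
  by congr (_, _).
have [A AE] : {A : int -> endo ntV | forall m v, A m v = (x m * v.1, X m v.2)}.
  by exists (fun m => Endo ntV (mklin (Alin m))).
have rel u v : Nq_rel (@fvar K int) u v -> free_eval A u = free_eval A v.
  apply: (iffRL (Nq_rel_morph _)) => [k|k l]; first exact: free_eval_var.
  apply: endoP => -[a b]; rewrite !endoE !AE.
  have pairP (u' v' : V) : u'.1 = v'.1 -> u'.2 = v'.2 -> u' = v'.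
    by case: u' v' => [? ?] [? ?] /= -> ->.
  apply: pairP => /=.
    exact: xx_mulr (Nq_xx k l).
  exact: Xxx.
pose g (a : N) : endo ntV := presented_lift A a.
have glin : linear g by exact: presented_lift_is_linear rel.
have gM : monoid_morphism g by exact: presented_lift_is_monoid_morphism rel.
have flin : linear (fun a => (g a (0, w)).2).
  by move=> c a b; rewrite glin endoDE endoZE.
exists (mklin flin) => /=.
  by rewrite gM.1.
move=> m a; rewrite gM.2 endoME.
suff -> : g (x m) = A m by rewrite AE.
by rewrite /g presented_lift_cls // free_eval_var.
Qed.

End NegativePartTheory.

(** * Exponential series and exchange relations of currents *)

Section ExponentialSeries.
Context {K : fieldType} {A : algType K} (X : nat -> A).
Local Notation P := (series_pow X).
Local Notation E := (exp_series X).

Lemma sum_nat_triangle (V : nmodType) (m n : nat) (f : nat -> nat -> V) :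
  \sum_(1 <= i < n.+1) \sum_(m <= k < (n - i).+1) f i k =
  \sum_(m <= k < n.+1) \sum_(1 <= i < (n - k).+1) f i k.
Proof.
have widen a b (g : nat -> V) : \sum_(a <= i < (n - b).+1) g i =
    \sum_(a <= i < n.+1 | (i <= n - b)%N) g i.
  by rewrite (big_nat_widen _ _ n.+1) // ltnS leq_subr.
under eq_bigr do rewrite widen; under [RHS]eq_bigr do rewrite widen.
rewrite [LHS](exchange_big_dep_nat xpredT) //=; apply: eq_big_nat => k /andP[_ k_le].
rewrite big_nat_cond [RHS]big_nat_cond; apply: eq_bigl => i.
by apply/idP/idP; lia.
Qed.

Lemma sum_nat_triangle_diag (V : nmodType) (n : nat) (f : nat -> nat -> V) :
  \sum_(1 <= i < n.+1) \sum_(0 <= k < (n - i).+1) f i (i + k)%N =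
  \sum_(0 <= s < n.+1) \sum_(1 <= i < s.+1) f i s.
Proof.
transitivity (\sum_(1 <= i < n.+1) \sum_(0 <= s < n.+1 | (i <= s)%N) f i s).
  apply: eq_big_nat => i /andP[_ i_le].
  rewrite [RHS](big_cat_nat (n := i)) //=; last by rewrite ltnW.
  rewrite [X in _ = X + _]big_nat_cond [X in _ = X + _]big1 ?add0r; last first.
    by move=> s; lia.
  have := big_addn (R := V) 0 n.+1 i (fun s => (i <= s)%N) (f i).
  rewrite add0n subSn // => ->.
  by apply: eq_big => [k|k _]; rewrite ?leq_addl // addnC.
rewrite [LHS](exchange_big_dep_nat xpredT) //=; apply: eq_big_nat => s /andP[_ s_le].
rewrite [RHS](big_nat_widen _ _ n.+1) //.
Qed.

Local Arguments series_pow : simpl never.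

Lemma series_pow0 n : P 0 n = (n == 0%N)%:R.
Proof. by []. Qed.

Lemma series_powS j n :
  P j.+1 n = \sum_(1 <= i < n.+1) X i * P j (n - i)%N.
Proof. by []. Qed.

Lemma series_pow_gt j n : (n < j)%N -> P j n = 0.
Proof.
elim: j n => // j IHj n n_lt; rewrite series_powS big_nat_cond big1 // => i.
by rewrite andbT => /andP[i_gt0 i_le]; rewrite IHj ?mulr0 //; lia.
Qed.

Lemma exp_seriesE M n : (n < M)%N ->
  E n = \sum_(j < M) (j`!%:R : K)^-1 *: P j n.
Proof.
move=> n_lt; rewrite /exp_series -!(big_mkord xpredT (fun j => (j`!%:R : K)^-1 *: P j n)).
rewrite [RHS](big_cat_nat (n := n.+1)) //= [X in _ = _ + X]big_nat_cond.
rewrite [X in _ = _ + X]big1 ?addr0 //.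
by move=> j /andP[/andP[j_gt _] _]; rewrite series_pow_gt ?scaler0.
Qed.

Lemma exp_series0 : E 0 = 1.
Proof. by rewrite /exp_series big_ord1 fact0 invr1 scale1r. Qed.

(** Conjugation by [a] rescales the variable of the generating series. *)
Lemma exp_series_twist (a : A) (c : K) :
  (forall i, (0 < i)%N -> a * X i = c ^+ i *: (X i * a)) ->
  forall n, a * E n = c ^+ n *: (E n * a).
Proof.
move=> aX n; have aP j m : a * P j m = c ^+ m *: (P j m * a).
  elim: j m => [|j IHj] m.
    by rewrite series_pow0 mulr_natr mulr_natl; case: m => [|m]; rewrite ?scale1r ?scaler0.
  rewrite series_powS mulr_sumr mulr_suml scaler_sumr.
  apply: eq_big_nat => i /andP[i_gt0 i_le].
  rewrite mulrA aX // -[in LHS]scalerAl -[in LHS]mulrA IHj -scalerAr scalerA.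
  by rewrite -exprD subnKC // mulrA.
rewrite /exp_series mulr_sumr mulr_suml scaler_sumr; apply: eq_bigr => j _.
by rewrite -scalerAr aP -scalerAl !scalerA mulrC.
Qed.

Hypothesis XC : forall i j, (0 < i)%N -> (0 < j)%N -> X i * X j = X j * X i.

(** The formula (X^(j+1))' = (j+1) X' X^j for the formal power series
    X = X_1 t + X_2 t^2 + ..., whose coefficients commute. *)
Lemma series_pow_deriv j n : n%:R *: P j.+1 n =
  j.+1%:R *: \sum_(1 <= i < n.+1) (i%:R *: X i) * P j (n - i)%N :> A.
Proof.
elim: j n => [|j IHj] n.
  rewrite scale1r series_powS scaler_sumr; apply: eq_big_nat => i /andP[i_gt0 i_le].
  rewrite series_pow0 -scalerAl.
  have [ni|_] := eqVneq (n - i)%N 0%N; last by rewrite !mulr0 !scaler0.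
  by congr (_%:R *: _); lia.
have Psplit : n%:R *: P j.+2 n =
    \sum_(1 <= i < n.+1) (i%:R *: X i) * P j.+1 (n - i)%N +
    \sum_(1 <= i < n.+1) X i * ((n - i)%:R *: P j.+1 (n - i)%N).
  rewrite series_powS -big_split scaler_sumr /=.
  apply: eq_big_nat => i /andP[i_gt0 i_le].
  by rewrite -scalerAl -scalerAr -scalerDl -natrD subnKC.
rewrite Psplit [j.+2%:R]mulrS scalerDl scale1r; congr (_ + _).
under eq_bigr => i _ do rewrite IHj -scalerAr mulr_sumr.
rewrite -scaler_sumr sum_nat_triangle; congr (_ *: _).
apply: eq_big_nat => k /andP[k_gt0 k_le] /=; rewrite mulr_sumr.
apply: eq_big_nat => i /andP[i_gt0 i_le].
by rewrite mulrA -scalerAr XC // scalerAl mulrA subnAC.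
Qed.

Hypothesis charK : [pchar K] =i pred0.

Lemma natr_neq0 n : (0 < n)%N -> n%:R != 0 :> K.
Proof. by rewrite lt0n; move/pcharf0P: charK => ->. Qed.

(** The differential equation E' = X' E, which determines the exponential
    series [E] by recursion: it replaces all computations with the explicit
    coefficients. *)
Lemma exp_series_deriv n :
  n%:R *: E n = \sum_(1 <= i < n.+1) (i%:R *: X i) * E (n - i)%N.
Proof.
case: n => [|n]; first by rewrite scale0r big_nil.
rewrite /exp_series big_ord_recl /= scalerDr scaler_sumr.
rewrite scaler0 scaler0 add0r.
under [LHS]eq_bigr => j _.
  rewrite scalerA mulrC -scalerA /bump /= add1n series_pow_deriv scalerA.
  have -> : (j.+1`!%:R : K)^-1 * j.+1%:R = (j`!%:R : K)^-1.
    by rewrite factS natrM invfM mulrAC mulVf ?mul1r // natr_neq0.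
  rewrite scaler_sumr.
over.
rewrite exchange_big /=; apply: eq_big_nat => i /andP[i_gt0 i_le].
rewrite -/(E _) (exp_seriesE (M := n.+1)); last by lia.
by rewrite mulr_sumr; apply: eq_bigr => j _; rewrite scalerAr.
Qed.

Context (p : K) (p0 : p != 0) (y : int -> A).
Hypothesis Xy : forall i l, (0 < i)%N ->
  X i * y l - y l * X i = ((p ^+ i - p ^- i) / i%:R) *: y (l + i%:Z).

(** The Taylor coefficients at 0 of (1 - p^-1 t) / (1 - p t), the exponential
    of the sum of the (p^i - p^-i) t^i / i. *)
Definition twist_coef (r : nat) : K :=
  if r is r'.+1 then (p - p^-1) * p ^+ r' else 1.

(** The differential equation of that exponential. *)
Lemma twist_coef_deriv s : s%:R * twist_coef s =
  \sum_(1 <= i < s.+1) (p ^+ i - p ^- i) * twist_coef (s - i).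
Proof.
case: s => [|s]; first by rewrite mul0r big_nil.
have H m : (m <= s)%N -> \sum_(1 <= i < m.+1) (p ^+ i - p ^- i) * twist_coef (s.+1 - i) =
    m%:R * ((p - p^-1) * p ^+ s) - (p ^+ s - p ^+ (s - m) * p ^- m) * p^-1.
  elim: m => [|m IHm] m_le.
    by rewrite big_nil mul0r subn0 expr0 invr1 mulr1 subrr mul0r subrr.
  rewrite big_nat_recr //= IHm ?(ltnW m_le) //.
  have -> : (s.+1 - m.+1 = (s - m.+1).+1)%N by lia.
  have -> : (s - m = (s - m.+1).+1)%N by lia.
  have -> : p ^+ s = p ^+ (s - m.+1) * p ^+ m * p.
    by rewrite -exprD -exprSr; congr (_ ^+ _); lia.
  rewrite /= !exprS -natr1; field.
  by rewrite p0 expf_neq0.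
rewrite big_nat_recr //= H // !subnn /= mulr1 expr0 mul1r.
rewrite -natr1 !exprS; field.
by rewrite p0 expf_neq0.
Qed.

(** Since the commutator of [X i] with [y] shifts the index of [y], moving the
    exponential past [y] multiplies it by an exponential series of shifts,
    namely (1 - p^-1 T) / (1 - p T) for the shift T.  Both sides satisfy the
    same first order differential equation, so they agree by induction. *)
Lemma exp_series_mul n l : E n * y l =
  \sum_(0 <= r < n.+1) twist_coef r *: (y (l + r%:Z) * E (n - r)%N).
Proof.
elim/ltn_ind: n l => n IHn l; case: (posnP n) => [->|n_gt0].
  by rewrite big_nat1 addr0 exp_series0 mul1r mulr1 scale1r.
apply: (scalerI (natr_neq0 n_gt0)); rewrite scalerAl exp_series_deriv.
have Xy' i m : (0 < i)%N -> (i%:R *: X i) * y m =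
    y m * (i%:R *: X i) + (p ^+ i - p ^- i) *: y (m + i%:Z).
  move=> i_gt0; rewrite -scalerAl -scalerAr.
  rewrite -[X i * y m](subrK (y m * X i)) Xy // scalerDr scalerA addrC.
  by rewrite mulrC divfK ?natr_neq0.
transitivity (\sum_(1 <= i < n.+1) \sum_(0 <= r < (n - i).+1)
   (twist_coef r *: (y (l + r%:Z) * ((i%:R *: X i) * E (n - r - i)%N)) +
    ((p ^+ i - p ^- i) * twist_coef (i + r - i)) *:
       (y (l + (i + r)%:Z) * E (n - (i + r))%N))).
  rewrite mulr_suml; apply: eq_big_nat => i /andP[i_gt0 i_le].
  rewrite -mulrA IHn; last by lia.
  rewrite mulr_sumr; apply: eq_big_nat => r _.
  rewrite -scalerAr mulrA Xy' // mulrDl scalerDr -!mulrA.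
  congr (_ + _); first by rewrite subnAC.
  rewrite -scalerAl scalerA mulrC addKn subnDA -addrA -PoszD.
  by rewrite [(r + i)%N]addnC.
under eq_bigr do rewrite big_split /=.
rewrite big_split /= sum_nat_triangle.
rewrite (sum_nat_triangle_diag n (fun i s => ((p ^+ i - p ^- i) * twist_coef (s - i)) *:
       (y (l + s%:Z) * E (n - s)%N))).
rewrite -big_split scaler_sumr; apply: eq_big_nat => r /andP[_ r_le] /=.
rewrite -scaler_sumr -mulr_sumr -exp_series_deriv -scaler_suml -twist_coef_deriv.
by rewrite -scalerAr !scalerA -scalerDl mulrC -mulrDl -natrD subnK.
Qed.

(** Multiplying [exp_series_mul] by the denominator 1 - p T leaves a relation
    with two terms on each side. *)
Lemma current_exchange (k0 : A) (Psi : int -> A) :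
  (forall l, k0 * y l = p *: (y l * k0)) ->
  (forall n : int, Psi n = if 0 <= n then k0 * E `|n|%N else 0) ->
  forall n l, Psi (n + 1) * y l - p *: (Psi n * y (l + 1)) =
    p *: (y l * Psi (n + 1)) - y (l + 1) * Psi n.
Proof.
move=> k0y PsiE [n|[|n]] l; last first.
- have -> : Negz n.+1 + 1 = Negz n by rewrite !NegzE; lia.
  by rewrite !PsiE /= !(mul0r, mulr0, scaler0, subr0).
- have -> : Negz 0 + 1 = 0 by [].
  rewrite !PsiE /= exp_series0 !(mul0r, mulr0, scaler0, subr0, mulr1).
  by rewrite k0y.
rewrite -PoszD addn1 !PsiE /=.
have Ey m j : k0 * E m * y j =
    p *: \sum_(0 <= r < m.+1) twist_coef r *: (y (j + r%:Z) * (k0 * E (m - r)%N)).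
  rewrite -mulrA exp_series_mul mulr_sumr scaler_sumr; apply: eq_bigr => r _.
  rewrite -(scalerAr _ k0) (mulrA k0) k0y -scalerAl !scalerA (mulrC p).
  by rewrite mulrA.
pose T r := y (l + 1 + r%:Z) * (k0 * E (n - r)%N).
have -> : k0 * E n.+1 * y l = p *: (y l * (k0 * E n.+1) +
    \sum_(0 <= r < n.+1) twist_coef r.+1 *: T r).
  rewrite Ey big_nat_recl // scale1r addr0 subn0; congr (_ *: (_ + _)).
  by apply: eq_bigr => r _; rewrite /T -addrA -PoszD add1n subSS.
have -> : k0 * E n * y (l + 1) = p *: \sum_(0 <= r < n.+1) twist_coef r *: T r by [].
rewrite scalerDr -addrA; congr (_ + _).
rewrite -scalerBr scaler_sumr -sumrB big_nat_recl //= big1 => [|r _]; last first.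
  by rewrite scalerA exprS mulrCA subrr.
rewrite expr0 mulr1 scale1r addr0 -scalerBl scalerA /T addr0 subn0.
by rewrite addrAC subrr sub0r mulrN divff // scaleN1r.
Qed.

End ExponentialSeries.

Lemma move_terms (K : pzRingType) (V : lmodType K) (c : K) (a b d e : V) :
  (a - c *: b = c *: d - e) <-> (a + e = c *: (b + d)).
Proof.
rewrite scalerDr; split=> [E|E].
  by rewrite -[a](subrK (c *: b)) E addrAC subrK addrC.
by rewrite -[a](addrK e) E addrAC [c *: b + _]addrC addrK.
Qed.

Section Currents.
Context {K : fieldType} (charK : [pchar K] =i pred0) (q : K).
Context {A : algType K} (h : int -> A) (kp km : A).
Hypothesis q_gen : q - q^-1 != 0.
Hypothesis hC : forall i j, h i * h j = h j * h i.

Definition psi (k : int) : A :=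
  if 0 <= k then kp * exp_series (fun i : nat => (q - q^-1) *: h i) `|k|%N else 0.
Definition phi (k : int) : A :=
  if k <= 0 then km * exp_series (fun i : nat => - (q - q^-1) *: h (- i%:Z)) `|k|%N
  else 0.

Context (p : K) (p0 : p != 0) (y : int -> A).
Hypothesis kpy : forall l, kp * y l = p *: (y l * kp).
Hypothesis kmy : forall l, km * y l = p^-1 *: (y l * km).
Hypothesis hy : forall (i : nat) l, (0 < i)%N -> h i * y l - y l * h i =
  ((q - q^-1)^-1 * ((p ^+ i - p ^- i) / i%:R)) *: y (l + i%:Z).
Hypothesis hNy : forall (i : nat) l, (0 < i)%N ->
  h (- i%:Z) * y l - y l * h (- i%:Z) =
  ((q - q^-1)^-1 * ((p ^+ i - p ^- i) / i%:R)) *: y (l - i%:Z).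

Let scaleC (c d : K) (a b : A) : a * b = b * a -> (c *: a) * (d *: b) = (d *: b) * (c *: a).
Proof. by move=> ab; rewrite -!scalerAl -!scalerAr ab !scalerA mulrC. Qed.

(** Both currents satisfy the same exchange relation with [y]; for [phi] it is
    the relation for the opposite indices, with [p^-1] in place of [p]. *)
Lemma psi_exchange n l : psi (n + 1) * y l + y (l + 1) * psi n =
  p *: (y l * psi (n + 1) + psi n * y (l + 1)).
Proof.
rewrite [in RHS]addrC; apply/move_terms.
apply: (current_exchange (X := fun i : nat => (q - q^-1) *: h i) _ charK p0 _ kpy) => //.
- by move=> i j _ _; apply: scaleC.
- move=> i m i_gt0; rewrite -scalerAl -scalerAr -scalerBr hy // scalerA.
  by rewrite mulrA divff ?mul1r.
Qed.

Lemma phi_exchange n l : phi (n + 1) * y l + y (l + 1) * phi n =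
  p *: (y l * phi (n + 1) + phi n * y (l + 1)).
Proof.
have pV0 : p^-1 != 0 by rewrite invr_eq0.
pose X (i : nat) := - (q - q^-1) *: h (- i%:Z).
have XX i j : (0 < i)%N -> (0 < j)%N -> X i * X j = X j * X i.
  by move=> _ _; apply: scaleC.
have Xy i l' : (0 < i)%N -> X i * y (- l') - y (- l') * X i =
    ((p^-1 ^+ i - p^-1 ^- i) / i%:R) *: y (- (l' + i%:Z)).
  move=> i_gt0; rewrite -scalerAl -scalerAr -scalerBr hNy // scalerA mulrA.
  rewrite mulNr divff // mulN1r -mulNr opprB opprD.
  by rewrite -exprVn invrK exprVn.
have phiE k : phi (- k) = if 0 <= k then km * exp_series X `|k|%N else 0.
  by rewrite /phi oppr_le0 abszN.
have /move_terms := current_exchange XX charK pV0 Xy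
  (fun l => kmy (- l)) phiE (- n - 1) (- l - 1).
have -> : - (- n - 1 + 1) = n by lia.
have -> : - (- n - 1) = n + 1 by lia.
have -> : - (- l - 1 + 1) = l by lia.
have -> : - (- l - 1) = l + 1 by lia.
move=> E; rewrite addrC [X in _ = _ *: X]addrC E scalerA divff // scale1r.
exact: addrC.
Qed.

(** The right-hand side of the relation between x^+ and x^- when gamma = 1. *)
Definition psi_phi (k : int) : A := (q - q^-1)^-1 *: (psi k - phi k).

Lemma psi_phi_exchange n l : psi_phi (n + 1) * y l + y (l + 1) * psi_phi n =
  p *: (y l * psi_phi (n + 1) + psi_phi n * y (l + 1)).
Proof.
rewrite /psi_phi -!scalerAl -!scalerAr -!scalerDr scalerA mulrC -scalerA.
congr (_ *: _); rewrite !mulrBl !mulrBr addrACA -opprD.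
by rewrite psi_exchange phi_exchange -scalerBr opprD addrACA.
Qed.

End Currents.

Section CurrentsCommute.
Context {K : fieldType} (q : K) {A : algType K} (h : int -> A) (kp km : A).
Local Notation psi_phi := (psi_phi q h kp km).

Lemma psi_phi_graded (a : A) (c : K) : c != 0 -> a * kp = kp * a ->
  a * km = km * a -> (forall i, a * h i = c ^ i *: (h i * a)) ->
  forall n, a * psi_phi n = c ^ n *: (psi_phi n * a).
Proof.
move=> c0 akp akm ah n.
have aP : a * psi q h kp n = c ^ n *: (psi q h kp n * a).
  rewrite /psi; case: ifP => n0; rewrite ?mulr0 ?mul0r ?scaler0 // mulrA.
  rewrite akp -!mulrA (exp_series_twist (c := c)) => [|i _]; last first.
    by rewrite -scalerAr ah scalerA mulrC -scalerA scalerAl.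
  by rewrite -scalerAr; congr (_ *: _); case: (n) n0.
have aQ : a * phi q h km n = c ^ n *: (phi q h km n * a).
  rewrite /phi; case: ifP => n0; rewrite ?mulr0 ?mul0r ?scaler0 // mulrA.
  rewrite akm -!mulrA (exp_series_twist (c := c^-1)) => [|i _]; last first.
    rewrite -scalerAr ah scalerA mulrC -scalerA scalerAl.
    by rewrite -exprz_inv.
  rewrite -scalerAr; congr (_ *: _).
  by rewrite exprnP exprz_inv; congr (c ^ _); lia.
by rewrite /psi_phi -scalerAl -scalerAr mulrBl mulrBr aP aQ -scalerBr !scalerA mulrC.
Qed.

Lemma psi_phi_commute (a : A) : a * kp = kp * a -> a * km = km * a ->
  (forall i, a * h i = h i * a) -> forall n, a * psi_phi n = psi_phi n * a.
Proof.
move=> akp akm ah n; rewrite (@psi_phi_graded a 1) ?oner_neq0 ?exp1rz ?scale1r //.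
by move=> i; rewrite exp1rz scale1r.
Qed.

End CurrentsCommute.

Section OperatorRelations.
Context {K : fieldType} (q : K).

Definition quad_rel (c : K) (T : algType K) (z : int -> T) : Prop :=
  forall k l, z (k + 1) * z l + z (l + 1) * z k =
    c *: (z l * z (k + 1) + z k * z (l + 1)).

Definition q_int (n : int) : K := (q ^ n - q ^ (- n)) / (q - q ^ (-1)).

Context {A : algType K} (y : int -> A).

(** The relations of U_q at gamma = 1, for [kp], [km], [dp], [dm] in the role of
    the two signs of K and D, [h] and [z] in the role of h and x^+, and [y] in
    the role of x^-. *)
Record Uq_ops (kp km dp dm : A) (h z : int -> A) : Prop := {
  ops_kV : kp * km = 1 /\ km * kp = 1;
  ops_dV : dp * dm = 1 /\ dm * dp = 1;
  ops_h0 : h 0 = 0;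
  ops_hh : forall i j, h i * h j = h j * h i;
  ops_hk : forall i, h i * kp = kp * h i;
  ops_dk : dp * kp = kp * dp;
  ops_dh : forall i, dp * h i * dm = q ^ i *: h i;
  ops_dy : forall i, dp * y i * dm = q ^ i *: y i;
  ops_dz : forall i, dp * z i * dm = q ^ i *: z i;
  ops_ky : forall i, kp * y i * km = q ^ (-2) *: y i;
  ops_kz : forall i, kp * z i * km = q ^ 2 *: z i;
  ops_hy : forall i l, h i * y l - y l * h i =
    - (q_int (2 * i) / i%:~R) *: y (i + l);
  ops_hz : forall i l, h i * z l - z l * h i =
    (q_int (2 * i) / i%:~R) *: z (i + l);
  ops_zz : quad_rel (q ^ 2) z;
  ops_zy : forall k l, z k * y l - y l * z k = psi_phi q h kp km (k + l)
}.

End OperatorRelations.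

(** * An action of the quantum affine algebra on the negative part *)

Lemma add_interleave (V : nmodType) (a1 a2 b1 b2 c1 c2 c3 c4 d1 d2 d3 d4 : V) :
  a1 + a2 = b1 + b2 -> c1 + c2 + (c3 + c4) = d1 + d2 + (d3 + d4) ->
  a1 + c1 + c2 + (a2 + c3 + c4) = b1 + d1 + d2 + (b2 + d3 + d4).
Proof.
move=> E1 E2; rewrite [LHS](AC (3*3) ((1*4)*((2*3)*(5*6)))) /= E1 E2.
by rewrite [RHS](AC (3*3) ((1*4)*((2*3)*(5*6)))).
Qed.

Section FreeQuadraticModule.
Context {K : fieldType} (charK : [pchar K] =i pred0) (q : K).
Hypothesis q0 : q != 0.
Hypothesis q_gen : q - q^-1 != 0.
Local Notation q_int := (q_int q).
Context {V : lmodType K} (ntV : exists v : V, v != 0).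
Context (y : int -> endo ntV) (v0 : V).
Local Notation A := (endo ntV).

Hypothesis yy : quad_rel (q ^ (-2)) y.
Hypothesis V_ind : forall P : V -> Prop,
  P 0 -> (forall c a b, P a -> P b -> P (c *: a + b)) ->
  P v0 -> (forall m a, P a -> P (y m a)) -> forall a, P a.
Hypothesis V_rec : forall (W : lmodType K) (X : int -> {linear W -> W}) (w : W),
  (forall k l u, X (k + 1) (X l u) + X (l + 1) (X k u) =
     q ^ (-2) *: (X l (X (k + 1) u) + X k (X (l + 1) u))) ->
  {f : {linear V -> W} | f v0 = w & forall m a, f (y m a) = X m (f a)}.

(** All relations between operators on [V] are proved by this principle: an
    operator which kills [v0] and commutes with each [y m] up to a scalar
    vanishes. *)
Lemma endo_eq0 (S : A) (u : int -> K) :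
  S v0 = 0 -> (forall m, S * y m = u m *: (y m * S)) -> S = 0.
Proof.
move=> S0 Sy; apply: endoP => a; rewrite endo0E; move: a.
apply: V_ind => //; first by rewrite linear0.
- by move=> c a b Sa Sb; rewrite linearP Sa Sb scaler0 addr0.
- move=> m a Sa; rewrite -[LHS](endoME S) Sy endoZE endoME Sa.
  by rewrite linear0 scaler0.
Qed.

Lemma endo_ext (S T : A) (u : int -> K) :
  S v0 = T v0 -> (forall m, (S - T) * y m = u m *: (y m * (S - T))) -> S = T.
Proof.
move=> ST0 STy; apply/eqP; rewrite -subr_eq0; apply/eqP.
by apply: endo_eq0 STy; rewrite endoBE ST0 subrr.
Qed.

(** The quadratic relations are homogeneous for the number of factors and for the
    sum of the indices, so these two gradings give diagonal operators. *)
Lemma diagonal_op (c a b : K) : b != 0 ->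
  {f : A | f v0 = c *: v0 & forall m, f * y m = (a * b ^ m) *: (y m * f)}.
Proof.
move=> b0.
have [k l w|f f0 fy] := V_rec (X := fun m => ((a * b ^ m) *: y m : A)) (c *: v0).
  rewrite -!endoME -!scalerAl -!scalerAr !scalerA.
  have E i j : (a * b ^ (i + 1) * (a * b ^ j)) = (a * a * b ^ (i + j + 1)).
    by rewrite mulrACA -expfzDr //; congr (_ * b ^ _); lia.
  have E' i j : (a * b ^ j * (a * b ^ (i + 1))) = (a * a * b ^ (i + j + 1)).
    by rewrite mulrC E.
  rewrite !E !E' (addrC l k) -!endoDE -!scalerDr yy.
  by rewrite -!endoZE !scalerA mulrC.
exists (Endo ntV f) => // m; apply: endoP => v.
by rewrite endoME endoZE endoME; exact: fy.
Qed.

(** An operator is determined by its commutators [Z m] with the [y m], and these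
    may be prescribed when they satisfy the relation obtained by differentiating
    the quadratic relations.  The square [V * V] carries the action of the y_m
    by first-order deformations, and the second component of the orbit of
    [(v0, 0)] is the operator. *)
Lemma derivation_op (Z : int -> A) :
  (forall k l, y (k + 1) * Z l + Z (k + 1) * y l +
               (y (l + 1) * Z k + Z (l + 1) * y k) =
     q ^ (-2) *: (y l * Z (k + 1) + Z l * y (k + 1) +
               (y k * Z (l + 1) + Z k * y (l + 1)))) ->
  {f : A | f v0 = 0 & forall m, f * y m = y m * f + Z m}.
Proof.
move=> HZ.
pose W : lmodType K := (V * V)%type.
have Xlin m : linear (fun w : W => (y m w.1, y m w.2 + Z m w.1) : W).
  move=> c [a b] [a' b'] /=; rewrite !linearP -[(_, _) + _]/(_, _).
  by congr (_, _) => /=; rewrite scalerDr addrACA.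
have [k l [a b]|f f0 fy] := V_rec (X := fun m => mklin (Xlin m)) (v0, 0).
  have pairP (u v : W) : u.1 = v.1 -> u.2 = v.2 -> u = v.
    by case: u v => [? ?] [? ?] /= -> ->.
  have Ey c : y (k + 1) (y l c) + y (l + 1) (y k c) =
      q ^ (-2) *: (y l (y (k + 1) c) + y k (y (l + 1) c)).
    exact: (congr1 (fun S : A => S c) (yy k l)).
  have Ea : y (k + 1) (Z l a) + Z (k + 1) (y l a) +
      (y (l + 1) (Z k a) + Z (l + 1) (y k a)) =
      q ^ (-2) *: (y l (Z (k + 1) a) + Z l (y (k + 1) a) +
        (y k (Z (l + 1) a) + Z k (y (l + 1) a))).
    exact: (congr1 (fun S : A => S a) (HZ k l)).
  apply: pairP => /=; first exact: Ey.
  have := Ey b; rewrite !linearD /= in Ea *.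
  by move=> Eb; exact: add_interleave Eb Ea.
have f1 a : (f a).1 = a.
  elim/V_ind: a => [|c a b Ha Hb||m a Ha].
  - by rewrite linear0.
  - by rewrite linearP /= Ha Hb.
  - by rewrite f0.
  - by rewrite fy /= Ha.
have flin : linear (fun a => (f a).2) by move=> c a b; rewrite linearP.
exists (Endo ntV (mklin flin)) => [|m]; first by rewrite /= f0.
by apply: endoP => v; rewrite endoDE !endoME /= fy /= f1.
Qed.

Lemma q_int_double (i : nat) :
  q_int (2 * i) = (q - q^-1)^-1 * ((q ^ 2) ^+ i - (q ^ 2) ^- i).
Proof.
rewrite /q_int mulrC; congr (_ * (_ - _)); first by rewrite exprnP exprz_exp.
by rewrite exprnN exprz_exp mulrN.
Qed.

Lemma commut_mul (a b c da db : A) :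
  a * c = c * a + da -> b * c = c * b + db ->
  a * b * c = c * (a * b) + (a * db + da * b).
Proof.
move=> ac bc; rewrite -mulrA bc mulrDr mulrA ac mulrDl -mulrA.
by rewrite -!addrA [da * b + _]addrC.
Qed.

Lemma commutator_mul (a b c da db : A) :
  a * c = c * a + da -> b * c = c * b + db ->
  (a * b - b * a) * c =
  c * (a * b - b * a) + ((a * db - db * a) + (da * b - b * da)).
Proof.
move=> ac bc; rewrite mulrBl (commut_mul ac bc) (commut_mul bc ac) mulrBr.
rewrite !opprD [LHS](AC ((1*2)*(1*2)) ((1*4)*((2*6)*(3*5)))).
by [].
Qed.

Lemma twisted_commutator_mul (f a c da : A) (s t : K) :
  f * c = s *: (c * f) -> a * c = c * a + da ->
  (f * a - t *: (a * f)) * c =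
  s *: (c * (f * a - t *: (a * f))) + (f * da - (t * s) *: (da * f)).
Proof.
move=> fc ac.
have fac : f * a * c = s *: (c * (f * a)) + f * da.
  by rewrite -mulrA ac mulrDr mulrA fc -scalerAl mulrA.
have afc : a * f * c = s *: (c * (a * f)) + s *: (da * f).
  by rewrite -mulrA fc -scalerAr (mulrA a c f) ac mulrDl scalerDr mulrA.
rewrite mulrBl -scalerAl fac afc mulrBr scalerBr scalerDr opprD addrACA.
by rewrite -scalerAr !scalerA [t * s]mulrC.
Qed.

Lemma twisted_commute (f a : A) (t : K) (s : int -> K) (da : int -> A) :
  (forall m, f * y m = s m *: (y m * f)) ->
  (forall m, a * y m = y m * a + da m) ->
  (forall m, f * da m = (t * s m) *: (da m * f)) ->
  (f * a) v0 = t *: (a * f) v0 -> f * a = t *: (a * f).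
Proof.
move=> fy ay fda fa0; apply: (@endo_ext _ _ s) => [|m]; first by rewrite endoZE.
by rewrite (twisted_commutator_mul _ (fy m) (ay m)) fda subrr addr0.
Qed.

Lemma derivation_ext (S T : A) (Z : int -> A) :
  S v0 = T v0 -> (forall m, S * y m = y m * S + Z m) ->
  (forall m, T * y m = y m * T + Z m) -> S = T.
Proof.
move=> ST0 Sy Ty; apply: (@endo_ext _ _ (fun=> 1)) => // m.
by rewrite mulrBl Sy Ty mulrBr scale1r opprD addrACA subrr addr0.
Qed.

Lemma coef_plus (i : nat) : (q - q^-1)^-1 * (((q ^ 2) ^+ i - (q ^ 2) ^- i) / i%:R) =
  q_int (2 * i) / i%:R.
Proof. by rewrite mulrA q_int_double. Qed.

Lemma coef_minus (i : nat) :
  (q - q^-1)^-1 * (((q ^ (-2)) ^+ i - (q ^ (-2)) ^- i) / i%:R) =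
  - (q_int (2 * i) / i%:R).
Proof.
rewrite mulrA q_int_double -mulNr -mulrN opprB -invr_expz.
by rewrite exprVn invrK.
Qed.

Lemma q_int_opp n : q_int (- n) = - q_int n.
Proof. by rewrite /q_int opprK -mulNr opprB. Qed.

Lemma q_int_coef_opp (i : nat) :
  q_int (2 * - i%:Z) / (- i%:Z)%:~R = q_int (2 * i) / i%:R.
Proof. by rewrite mulrN q_int_opp mulrNz invrN mulrNN. Qed.

Lemma diagonal_inverse (f g : A) (c : K) (u : int -> K) :
  c != 0 -> (forall m, u m != 0) -> f v0 = c *: v0 -> g v0 = c^-1 *: v0 ->
  (forall m, f * y m = u m *: (y m * f)) ->
  (forall m, g * y m = (u m)^-1 *: (y m * g)) -> f * g = 1 /\ g * f = 1.
Proof.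
move=> c0 u0 f0 g0 fy gy.
split; apply: (@endo_ext _ _ (fun=> 1)) => [|m].
- by rewrite endoME g0 linearZ /= f0 scalerA mulVf // scale1r.
- rewrite scale1r mulrBl mulrBr -mulrA gy -scalerAr mulrA fy -scalerAl scalerA.
  by rewrite mulVf // scale1r mulrA mul1r mulr1.
- by rewrite endoME f0 linearZ /= g0 scalerA divff // scale1r.
- rewrite scale1r mulrBl mulrBr -mulrA fy -scalerAr mulrA gy -scalerAl scalerA.
  by rewrite divff // scale1r mulrA mul1r mulr1.
Qed.

(** K and D act diagonally, h_i is the derivation which shifts indices by [i],
    and x^+_i is the operator whose commutator with [y m] is the current of index
    [i + m]; the exchange relations of currents are exactly what its existence
    requires.  The relations among these operators hold at [v0], and both sides
    have the same commutators with the [y m]. *)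
Lemma Uq_ops_exist (ck cd : K) : ck != 0 -> cd != 0 ->
  exists kp km dp dm : A, exists h z : int -> A, Uq_ops q y kp km dp dm h z /\
    [/\ kp v0 = ck *: v0, km v0 = ck^-1 *: v0, dp v0 = cd *: v0
      & dm v0 = cd^-1 *: v0] /\
    (forall i, h i v0 = 0) /\ forall i, z i v0 = 0.
Proof.
move=> ck0 cd0; set p := q ^ (-2).
have p0 : p != 0 by rewrite expfz_neq0.
have pV : p^-1 = q ^ 2 by rewrite /p -invr_expz invrK.
have qV0 : q^-1 != 0 by rewrite invr_eq0.
have [kp kp0] := diagonal_op ck p (oner_neq0 K).
have [km km0] := diagonal_op ck^-1 p^-1 (oner_neq0 K).
have [dp dp0] := diagonal_op cd 1 q0.
have [dm dm0] := diagonal_op cd^-1 1 qV0.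
move=> dmy dpy kmy kpy.
have {}kpy m : kp * y m = p *: (y m * kp) by rewrite kpy exp1rz mulr1.
have {}kmy m : km * y m = p^-1 *: (y m * km) by rewrite kmy exp1rz mulr1.
have {}dpy m : dp * y m = q ^ m *: (y m * dp) by rewrite dpy mul1r.
have {}dmy m : dm * y m = (q ^ m)^-1 *: (y m * dm).
  by rewrite dmy mul1r exprz_inv invr_expz.
have ex_h i : {f : A | f v0 = 0 & forall m, f * y m = y m * f +
    (- (q_int (2 * i) / i%:~R)) *: y (i + m)}.
  apply: derivation_op => k l; set c := - _.
  rewrite -!scalerAl -!scalerAr -!scalerDr scalerA mulrC -scalerA; congr (_ *: _).
  have E2 := yy k (i + l); have E1 := yy (i + k) l.
  rewrite -!addrA in E1 E2.
  rewrite [LHS](AC (2*2) ((1*4)*(2*3))) /= E1 E2 -scalerDr; congr (_ *: _).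
  by rewrite [LHS](AC (2*2) ((3*1)*(2*4))).
have [h h0 hyE] : {h : int -> A | forall i, h i v0 = 0
    & forall i m, h i * y m = y m * h i + (- (q_int (2 * i) / i%:~R)) *: y (i + m)}.
  by exists (fun i => s2val (ex_h i)) => i; case: (ex_h i).
have hy i m : h i * y m - y m * h i = - (q_int (2 * i) / i%:~R) *: y (i + m).
  by rewrite hyE addrC addKr.
have hC i j : h i * h j = h j * h i.
  apply: (@endo_ext _ _ (fun=> 1)) => [|m]; first by rewrite !endoME !h0 !linear0.
  rewrite (commutator_mul (hyE i m) (hyE j m)) scale1r -!scalerAl -!scalerAr.
  rewrite -!scalerBr hy -[y (i + m) * _ - _]opprB hy !scalerN !scalerA.
  by rewrite mulrC (addrCA j i m) subrr addr0.
have kV : kp * km = 1 /\ km * kp = 1 by exact: diagonal_inverse kp0 km0 kpy kmy.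
have qm0 m : q ^ m != 0 by exact: expfz_neq0.
have dV : dp * dm = 1 /\ dm * dp = 1 by exact: diagonal_inverse dp0 dm0 dpy dmy.
have hk i : kp * h i = h i * kp.
  rewrite -[RHS]scale1r; apply: (twisted_commute kpy (hyE i)) => [m|].
    by rewrite -scalerAr -scalerAl kpy !scalerA mul1r mulrC.
  by rewrite scale1r !endoME kp0 h0 linearZ /= h0 linear0 scaler0.
have dk : dp * kp = kp * dp.
  rewrite -[RHS]scale1r; apply: (@endo_ext _ _ (fun m => q ^ m * p)) => [|m].
    by rewrite scale1r !endoME kp0 dp0 !linearZ /= dp0 kp0 !scalerA mulrC.
  rewrite scale1r mulrBl mulrBr scalerBr -!mulrA kpy dpy -!scalerAr !mulrA kpy dpy.
  by rewrite -!scalerAl !scalerA (mulrC p).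
have dh i : dp * h i = q ^ i *: (h i * dp).
  apply: (twisted_commute dpy (hyE i)) => [m|].
    by rewrite -scalerAr -scalerAl dpy !scalerA expfzDr // mulrC.
  by rewrite !endoME dp0 h0 linearZ /= h0 linear0 !scaler0.
have hkm i : km * h i = h i * km.
  by rewrite -[LHS]mulr1 -kV.1 mulrA -[km * h i * kp]mulrA -hk mulrA kV.2 mul1r.
have dkm : dp * km = km * dp.
  by rewrite -[LHS]mul1r -kV.2 -mulrA [kp * _]mulrA -dk -!mulrA kV.1 mulr1.
(* the commutator of x^+ and x^- *)
pose D := psi_phi q h kp km.
have Dy n l : D (n + 1) * y l + y (l + 1) * D n = p *: (y l * D (n + 1) + D n * y (l + 1)).
  apply: (psi_phi_exchange charK q_gen hC p0 kpy kmy) => {}i {}l i_gt0.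
    by rewrite coef_minus hy addrC.
  by rewrite coef_minus hy addrC q_int_coef_opp.
have dD n : dp * D n = q ^ n *: (D n * dp) by exact: psi_phi_graded.
have hD i n : h i * D n = D n * h i by apply: psi_phi_commute.
have kD n : kp * D n = D n * kp.
  by apply: psi_phi_commute; rewrite ?kV.1 ?kV.2.
have DE : D = psi_phi q h kp km by [].
clearbody D.
have ex_z i : {f : A | f v0 = 0 & forall m, f * y m = y m * f + D (i + m)}.
  apply: derivation_op => k l.
  have E1 := Dy (i + k) l; have E2 := Dy (i + l) k; rewrite -!(addrA i) in E1 E2.
  rewrite [LHS](AC (2*2) ((2*3)*(4*1))) /= E1 E2 -scalerDr; congr (_ *: _).
  by rewrite [LHS](AC (2*2) ((1*4)*(3*2))).
have [z z0 zyE] : {z : int -> A | forall i, z i v0 = 0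
    & forall i m, z i * y m = y m * z i + D (i + m)}.
  by exists (fun i => s2val (ex_z i)) => i; case: (ex_z i).
have kz i : kp * z i = q ^ 2 *: (z i * kp).
  apply: (twisted_commute kpy (zyE i)) => [m|].
    by rewrite -pV mulVf // scale1r.
  by rewrite !endoME kp0 z0 linearZ /= z0 linear0 !scaler0.
have dz i : dp * z i = q ^ i *: (z i * dp).
  apply: (twisted_commute dpy (zyE i)) => [m|]; first by rewrite -expfzDr.
  by rewrite !endoME dp0 z0 linearZ /= z0 linear0 !scaler0.
have hz i l : h i * z l - z l * h i = (q_int (2 * i) / i%:~R) *: z (i + l).
  set c := _ / _; apply: (@derivation_ext _ _ (fun m => c *: D (i + l + m))) => [|m|m].
  - by rewrite endoBE endoZE !endoME !z0 h0 !linear0 addr0.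
  - rewrite (commutator_mul (hyE i m) (zyE l m)) hD subrr add0r -scalerAl -scalerAr.
    rewrite -scalerBr scaleNr -scalerN opprB zyE [_ + D _]addrC addrK addrCA.
    by rewrite -/c addrA.
  - by rewrite -scalerAl zyE scalerDr -scalerAr.
have kmz i : km * z i = (q ^ 2)^-1 *: (z i * km).
  have : km * (kp * z i) * km = km * (q ^ 2 *: (z i * kp)) * km by rewrite kz.
  rewrite mulrA kV.2 mul1r -scalerAr -scalerAl -!mulrA kV.1 mulr1 => ->.
  by rewrite scalerA mulVf ?scale1r // expfz_neq0.
have Dz n l : D (n + 1) * z l + z (l + 1) * D n =
    q ^ 2 *: (z l * D (n + 1) + D n * z (l + 1)).
  rewrite DE; apply: (psi_phi_exchange charK q_gen hC (expfz_neq0 _ q0) kz kmz) => {}i {}l i_gt0.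
    by rewrite coef_plus hz addrC.
  by rewrite coef_plus hz addrC q_int_coef_opp.
have zz k l : z (k + 1) * z l + z (l + 1) * z k =
    q ^ 2 *: (z l * z (k + 1) + z k * z (l + 1)).
  pose Z m := D (k + m + 1) * z l + z (l + 1) * D (k + m) +
              (D (l + m + 1) * z k + z (k + 1) * D (l + m)).
  have index i m : i + 1 + m = i + m + 1 by rewrite addrAC.
  apply: (@derivation_ext _ _ Z) => [|m|m].
  - by rewrite endoZE !endoDE !endoME !z0 !linear0 addr0 scaler0.
  - rewrite mulrDl (commut_mul (zyE _ _) (zyE _ _)) (commut_mul (zyE _ _) (zyE _ _)).
    rewrite mulrDr !index.
    by rewrite [LHS](AC ((1*2)*(1*2)) ((1*4)*((3*5)*(6*2)))).
  - rewrite -scalerAl mulrDl (commut_mul (zyE _ _) (zyE _ _)).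
    rewrite (commut_mul (zyE _ _) (zyE _ _)) !index -scalerAr mulrDr.
    rewrite [X in _ *: X](AC ((1*2)*(1*2)) ((1*4)*((2*6)*(5*3)))) /= scalerDr.
    by rewrite /Z !Dz -[in RHS]scalerDr.
exists kp, km, dp, dm, h, z; split; last by [].
have conj (a b c : A) (t : K) : a * c = 1 -> a * b = t *: (b * a) -> a * b * c = t *: b.
  by move=> ac ->; rewrite -scalerAl -mulrA ac mulr1.
split=> //.
- apply: (@endo_eq0 _ (fun=> 1)) => // m.
  by rewrite hyE mulr0 /q_int oppr0 subrr !mul0r oppr0 scale0r addr0 scale1r.
- by move=> i; apply: conj; [exact: dV.1 | exact: dh].
- by move=> i; apply: conj; [exact: dV.1 | exact: dpy].
- by move=> i; apply: conj; [exact: dV.1 | exact: dz].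
- by move=> i; apply: conj; [exact: kV.1 | exact: kpy].
- by move=> i; apply: conj; [exact: kV.1 | exact: kz].
- by move=> k l; rewrite zyE addrC addKr DE.
Qed.

End FreeQuadraticModule.

Section LeftMultiplication.
Context {K : comNzRingType} {A : algType K}.

Lemma alg_nontrivial : exists v : A, v != 0.
Proof. by exists 1; rewrite oner_eq0. Qed.

Lemma left_mul_is_linear (a : A) : linear (fun b : A => a * b).
Proof. by move=> c b b'; rewrite mulrDr -scalerAr. Qed.

Definition left_mul (a : A) : endo alg_nontrivial :=
  Endo alg_nontrivial (mklin (left_mul_is_linear a)).

Lemma left_mulE a b : left_mul a b = a * b. Proof. by []. Qed.

Lemma left_mulM a b : left_mul (a * b) = left_mul a * left_mul b.
Proof. by apply: endoP => c; rewrite endoME !left_mulE mulrA. Qed.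

Lemma left_mulD a b : left_mul (a + b) = left_mul a + left_mul b.
Proof. by apply: endoP => c; rewrite endoDE !left_mulE mulrDl. Qed.

Lemma left_mulZ c a : left_mul (c *: a) = c *: left_mul a.
Proof. by apply: endoP => d; rewrite endoZE !left_mulE scalerAl. Qed.

End LeftMultiplication.

Lemma left_mul_quad (K : fieldType) (A : algType K) (c : K) (x : int -> A) :
  quad_rel c x -> quad_rel c (fun m => left_mul (x m)).
Proof.
by move=> xx k l; rewrite -!left_mulM -!left_mulD xx left_mulZ.
Qed.

Section QuantumParameter.
Context {F : fieldType}.
Local Notation q := (@q F).

Lemma qhalf_neq0 : @qhalf F != 0.
Proof. by rewrite /qhalf tofrac_eq0 polyX_eq0. Qed.

Lemma q_neq0 : q != 0.
Proof. by rewrite expf_neq0 // qhalf_neq0. Qed.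

Lemma qhalf_expr n : @qhalf F ^+ n = FracField.tofrac 'X^n.
Proof. by rewrite rmorphXn. Qed.

Lemma q_expr_eq1 n : q ^+ n = 1 -> n = 0%N.
Proof.
rewrite -exprM qhalf_expr -[1]tofrac1 => /eqP; rewrite tofrac_eq => /eqP.
move/(congr1 (fun p : {poly F} => size p)); rewrite size_polyXn size_poly1.
by case: n.
Qed.

Lemma q_exprz_inj : injective (fun n : int => q ^ n).
Proof.
suff H n : q ^ n = 1 -> n = 0.
  move=> m n /= E; apply/eqP; rewrite -subr_eq0; apply/eqP/H.
  by rewrite expfzDr ?q_neq0 // E -expfzDr ?q_neq0 // subrr.
case: n => n; first by move/q_expr_eq1 ->.
by rewrite NegzE -exprnN => /(congr1 GRing.inv); rewrite invrK invr1 => /q_expr_eq1.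
Qed.

Lemma q_generic : q - q^-1 != 0.
Proof.
rewrite subr_eq0; apply/eqP; rewrite -[q in LHS]expr1z -[q^-1]/(q ^ -1).
by move/q_exprz_inj.
Qed.

Lemma pchar_Fq : [pchar F] =i pred0 -> [pchar Fq F] =i pred0.
Proof.
move/pcharf0P => char0; apply/pcharf0P => n.
by rewrite -(rmorph_nat (@FracField.tofrac _)) tofrac_eq0 -polyC_natr polyC_eq0.
Qed.

End QuantumParameter.

Section RelationMorphism.
Context {F : fieldType} {T S : algType (Fq F)} (f : {lrmorphism T -> S}).
Context (gen : Uq_gen -> T) (gen' : Uq_gen -> S).
Hypothesis fgen : forall y, f (gen y) = gen' y.

Let fM u v : f (u * v) = f u * f v. Proof. exact: rmorphM. Qed.
Let fB u v : f (u - v) = f u - f v. Proof. exact: rmorphB. Qed.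
Let fZ c u : f (c *: u) = c *: f u. Proof. exact: linearZ. Qed.
Let f1 : f 1 = 1. Proof. exact: rmorph1. Qed.
Let f0 : f 0 = 0. Proof. exact: rmorph0. Qed.
Let fX u n : f (u ^+ n) = f u ^+ n. Proof. exact: rmorphXn. Qed.

Let f_sum (I : Type) (r : seq I) P (E : I -> T) :
  f (\sum_(i <- r | P i) E i) = \sum_(i <- r | P i) f (E i).
Proof. exact: rmorph_sum. Qed.

Lemma exp_series_morph (X : nat -> T) n :
  f (exp_series X n) = exp_series (fun i => f (X i)) n.
Proof.
have P j m : f (series_pow X j m) = series_pow (fun i => f (X i)) j m.
  elim: j m => [|j IHj] m; first exact: rmorph_nat.
  by rewrite !series_powS f_sum; apply: eq_bigr => i _; rewrite fM IHj.
by rewrite f_sum; apply: eq_bigr => j _; rewrite fZ P.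
Qed.

Lemma gh_morph l : f (gh gen l) = gh gen' l.
Proof. by rewrite /gh; case: insub => [l'|]; rewrite ?f0 // fgen. Qed.

Lemma ghalf_morph n : f (ghalf gen n) = ghalf gen' n.
Proof. by case: n => n; rewrite [LHS]fX fgen. Qed.

Lemma gpsi_morph k : f (gpsi gen k) = gpsi gen' k.
Proof.
rewrite /gpsi; case: ifP => _; last exact: f0.
rewrite fM fgen exp_series_morph; congr (_ * exp_series _ _).
by apply: funext => i; rewrite fZ gh_morph.
Qed.

Lemma gphi_morph k : f (gphi gen k) = gphi gen' k.
Proof.
rewrite /gphi; case: ifP => _; last exact: f0.
rewrite fM fgen exp_series_morph; congr (_ * exp_series _ _).
by apply: funext => i; rewrite fZ gh_morph.
Qed.

Lemma Uq_rel_morph u v : Uq_rel gen u v -> Uq_rel gen' (f u) (f v).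
Proof.
have Ex e k : f (gx gen e k) = gx gen' e k by exact: fgen.
have EK e : f (gK gen e) = gK gen' e by exact: fgen.
have ED e : f (gD gen e) = gD gen' e by exact: fgen.
have EG e : f (gG gen e) = gG gen' e by exact: fgen.
case=> [e|e|e|e y|k l k0 l0|k k0||k k0|e k|e k|e k l k0|e k l|k l];
  rewrite ?(fB, fZ, fM, f1) /=
          ?(EK, ED, EG, gh_morph, Ex, fgen, ghalf_morph, gpsi_morph, gphi_morph).
- exact: Rel_KV.
- exact: Rel_DV.
- exact: Rel_GV.
- exact: Rel_Gcentral.
- exact: Rel_hh.
- exact: Rel_hK.
- exact: Rel_DK.
- exact: Rel_Dh.
- exact: Rel_Dx.
- exact: Rel_Kx.
- exact: Rel_hx.
- exact: Rel_xx.
- exact: Rel_xpxm.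
Qed.

(** Conversely, every instance of a relation for [gen'] comes from one for
    [gen]; taking [gen] to be the free generators, the relations hold in U_q. *)
Lemma Uq_rel_lift u' v' : Uq_rel gen' u' v' ->
  exists u v, [/\ Uq_rel gen u v, f u = u' & f v = v'].
Proof.
have Ex e k : f (gx gen e k) = gx gen' e k by exact: fgen.
have EK e : f (gK gen e) = gK gen' e by exact: fgen.
have ED e : f (gD gen e) = gD gen' e by exact: fgen.
have EG e : f (gG gen e) = gG gen' e by exact: fgen.
have lift u v : Uq_rel gen u v -> f u = u' -> f v = v' ->
    exists u v, [/\ Uq_rel gen u v, f u = u' & f v = v'] by exists u, v.
move=> r'; case: r' lift => [e|e|e|e y|k l k0 l0|k k0||k k0|e k|e k|e k l k0|e k l|k l];
  [ apply; first exact: (Rel_KV gen e)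
  | apply; first exact: (Rel_DV gen e)
  | apply; first exact: (Rel_GV gen e)
  | apply; first exact: (Rel_Gcentral gen e y)
  | apply; first exact: (Rel_hh gen k0 l0)
  | apply; first exact: (Rel_hK gen k0)
  | apply; first exact: (Rel_DK gen)
  | apply; first exact: (Rel_Dh gen k0)
  | apply; first exact: (Rel_Dx gen e k)
  | apply; first exact: (Rel_Kx gen e k)
  | apply; first exact: (Rel_hx gen e l k0)
  | apply; first exact: (Rel_xx gen e k l)
  | apply; first exact: (Rel_xpxm gen k l)];
  by rewrite ?(fB, fZ, fM, f1) /=
          ?(EK, ED, EG, gh_morph, Ex, fgen, ghalf_morph, gpsi_morph, gphi_morph).
Qed.

End RelationMorphism.

Section OperatorsToRelations.
Context {F : fieldType} {T : algType (Fq F)} (y : int -> T).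
Local Notation q := (@q F).

Lemma Uq_ops_rel (kp km dp dm : T) (h z : int -> T) (gen : Uq_gen -> T) :
  quad_rel (q ^ (-2)) y -> Uq_ops q y kp km dp dm h z ->
  gen = (fun g => match g with
    | GenX true k => z k | GenX false k => y k | GenH l => h (val l)
    | GenK e => if e then kp else km | GenD e => if e then dp else dm
    | GenG _ => 1 end) ->
  forall u v, Uq_rel gen u v -> u = v.
Proof.
move=> yy ops genE.
have Eh : gh gen = h.
  apply: funext => l; rewrite /gh; case: insubP => [l' _ <-|/negPn/eqP ->].
    by rewrite genE.
  by rewrite (ops_h0 ops).
have Epsi k : gpsi gen k = psi q h kp k by rewrite /gpsi Eh /gK genE.
have Ephi k : gphi gen k = phi q h km k by rewrite /gphi Eh /gK genE.
have EG n : ghalf gen n = 1.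
  by case: n => n; rewrite /ghalf /gG genE expr1n.
have EKt : gK gen true = kp by rewrite /gK genE.
have EKf : gK gen false = km by rewrite /gK genE.
have EDt : gD gen true = dp by rewrite /gD genE.
have EDf : gD gen false = dm by rewrite /gD genE.
have EGb e : gG gen e = 1 by rewrite /gG genE.
have Ext k : gx gen true k = z k by rewrite /gx genE.
have Exf k : gx gen false k = y k by rewrite /gx genE.
move=> u v; case; clear u v.
- by case; rewrite EKt EKf; case: (ops_kV ops).
- by case; rewrite EDt EDf; case: (ops_dV ops).
- by move=> e; rewrite !EGb mulr1.
- by move=> e g; rewrite !EGb mulr1 mul1r.
- move=> k l _ _; rewrite /ggamma !EG subrr !scaler0 Eh.
  by rewrite (ops_hh ops k l) subrr.
- by move=> k _; rewrite Eh EKt (ops_hk ops).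
- by rewrite EDt EKt (ops_dk ops).
- by move=> k _; rewrite EDt EDf Eh (ops_dh ops).
- by move=> [] k; rewrite EDt EDf ?Ext ?Exf (ops_dz ops, ops_dy ops).
- by move=> [] k; rewrite EKt EKf ?Ext ?Exf (ops_kz ops, ops_ky ops).
- move=> [] k l _; rewrite EG mul1r Eh ?Ext ?Exf.
    by rewrite [(sgn true)%:~R]mulr1z mul1r; exact: ops_hz ops k l.
  by rewrite [(sgn false)%:~R]mulrN1z mulN1r; exact: ops_hy ops k l.
- move=> [] k l; rewrite ?Ext ?Exf; apply/move_terms.
    exact: ops_zz ops k l.
  exact: yy k l.
- move=> k l; rewrite !EG !mul1r Ext Exf Epsi Ephi.
  by rewrite (ops_zy ops).
Qed.

End OperatorsToRelations.

Section VermaModule.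
Context {F : fieldType} (charF : [pchar F] =i pred0) (lam : weight).
Local Notation N := (Nq F).
Local Notation x := (@Nq_var F).
Local Notation q := (@q F).

Local Notation E := (endo (@alg_nontrivial _ N)).

Definition xop (m : int) : E := left_mul (x m).

Lemma xop_quad : quad_rel (q ^ (-2)) xop.
Proof. by apply: left_mul_quad => k l; apply/move_terms; exact: Nq_xx. Qed.

Lemma Nq_rec_quad (W : lmodType (Fq F)) (X : int -> {linear W -> W}) (w : W) :
  (forall k l u, X (k + 1) (X l u) + X (l + 1) (X k u) =
     q ^ (-2) *: (X l (X (k + 1) u) + X k (X (l + 1) u))) ->
  {f : {linear N -> W} | f 1 = w & forall m a, f (xop m a) = X m (f a)}.
Proof. by move=> XX; apply: Nq_rec => k l u; apply/move_terms/XX. Qed.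

(** U_q acts on [N] with 1 in the role of the highest weight vector; [f] is
    the action on 1.  Being 1 at 1 and compatible with the x^-_k, it is a left
    inverse of the inclusion of [N], and it kills the left ideal that defines the
    Verma module of weight [lam]: this is why that module is as large as [N]. *)
Lemma Uq_action_on_vacuum : exists f : {linear Uq F -> N},
  [/\ f 1 = 1, forall k u, f (gx (@Uq_var F) false k * u) = x k * f u &
      forall u g, rverma_gen lam g -> f (u * g) = 0].
Proof.
have [kp [km [dp [dm [h [z [ops [[kp0 km0 dp0 dm0] [h0 z0]]]]]]]]] :=
  Uq_ops_exist (pchar_Fq charF) q_neq0 q_generic xop_quad (@Nq_ind F) Nq_rec_quad
    (expfz_neq0 (wt_h lam) q_neq0) (expfz_neq0 (wt_d lam) q_neq0).
pose gen g : E := match g with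
    | GenX true k => z k | GenX false k => xop k | GenH l => h (val l)
    | GenK e => if e then kp else km | GenD e => if e then dp else dm
    | GenG _ => 1 end.
have genE := Uq_ops_rel xop_quad ops (erefl gen).
have rel u v : Uq_rel (@fvar (Fq F) Uq_gen) u v -> free_eval gen u = free_eval gen v.
  move=> uv; apply: genE; apply: Uq_rel_morph uv => y; exact: free_eval_var.
pose rho (u : Uq F) : E := presented_lift gen u.
have rho_lin : linear rho by exact: presented_lift_is_linear rel.
have rho_mul : monoid_morphism rho by exact: presented_lift_is_monoid_morphism rel.
have rho_var y : rho (Uq_var F y) = gen y.
  by rewrite /rho presented_lift_cls // free_eval_var.
clearbody rho.
have f_lin : linear (fun u => rho u 1).
  by move=> c u v; rewrite rho_lin endoDE endoZE.
exists (mklin f_lin); split=> [|k u|u g] /=; first by rewrite rho_mul.1.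
  by rewrite rho_mul.2 endoME [rho (gx _ _ _)]rho_var.
move=> Gg; rewrite (_ : rho (u * g) = rho u * rho g); last exact: rho_mul.2.
rewrite endoME; suff -> : rho g 1 = 0 by exact: (linear0 (rho u)).
have rhoB a b : rho (a - b) = rho a - rho b.
  exact: (linearB (mklin rho_lin)).
have rhoA c : rho c%:A = c *: 1.
  apply: etrans (linearZ_LR (mklin rho_lin) c 1) _.
  by rewrite -[RHS]/(c *: (1 : E)) -[in RHS]rho_mul.1.
have rhoK e : rho (gK (@Uq_var F) e) = gen (GenK e) by exact: rho_var.
have rhoD e : rho (gD (@Uq_var F) e) = gen (GenD e) by exact: rho_var.
have rhoG e : rho (gG (@Uq_var F) e) = 1 by exact: rho_var.
case: g / Gg => [k|l l0|e|e|e].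
- by rewrite [rho _]rho_var; exact: z0.
- by rewrite /gh insubT [rho _]rho_var; exact: h0.
- rewrite rhoB rhoA rhoK endoBE endoZE endo1E.
  by case: e; rewrite [_ 1](kp0, km0) ?invr_expz ?mul1r ?mulN1r subrr.
- by rewrite rhoB rho_mul.1 rhoG subrr.
- rewrite rhoB rhoA rhoD endoBE endoZE endo1E.
  by case: e; rewrite [_ 1](dp0, dm0) ?invr_expz ?mul1r ?mulN1r subrr.
Qed.

End VermaModule.

(** * The Verma module is free of rank one over the negative part *)

Lemma scaler_algP (K : comNzRingType) (A : algType K) (M : lmodType A)
    (c : K) (u v : A) (w : M) :
  (c *: u + v) *: w = c%:A *: (u *: w) + v *: w.
Proof. by rewrite scalerDl scalerA mulr_algl. Qed.

Lemma scaler_algC (K : comNzRingType) (A : algType K) (M : lmodType A)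
    (c : K) (u : A) (w w' : M) :
  u *: (c%:A *: w + w') = c%:A *: (u *: w) + u *: w'.
Proof. by rewrite scalerDr !scalerA mulr_algl mulr_algr. Qed.

Lemma cls_eq0 (R : pzRingType) (V : lmodType R) (G : V -> Prop) (u : V) :
  cls G u = 0 -> lspan G u.
Proof.
have E : cls G 0 = 0 by exact: (linear0 (cls G)).
by rewrite -E => /cls_eq; rewrite subr0.
Qed.

Section ConjugationSwap.
Context {K : fieldType} {A : algType K} (t : K) (a b c : A).
Hypothesis abc : a * b * c = t *: b.

Lemma conj_swap : c * a = 1 -> a * b = t *: (b * a) + 0.
Proof. by move=> ca; rewrite addr0 scalerAl -abc -(mulrA _ c a) ca mulr1. Qed.

Lemma conj_swapV : t != 0 -> c * a = 1 -> c * b = t^-1 *: (b * c) + 0.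
Proof.
move=> t0 ca; apply: (scalerI t0); rewrite addr0 scalerA divff // scale1r.
by rewrite scalerAr -abc !mulrA ca mul1r.
Qed.

End ConjugationSwap.

Lemma commutator_swap (K : fieldType) (A : algType K) (a b d : A) :
  a * b - b * a = d -> a * b = 1 *: (b * a) + d.
Proof. by move=> <-; rewrite scale1r addrC subrK. Qed.

Section Stabilizer.
Context {K : fieldType} {A : algType K} {M : lmodType A} (P : M -> Prop).
Hypothesis P0 : P 0.
Hypothesis PP : forall (c : K) w w', P w -> P w' -> P (c%:A *: w + w').

Definition stabilizes (u : A) : Prop := forall w, P w -> P (u *: w).

Lemma stabilizes0 : stabilizes 0.
Proof. by move=> w _; rewrite scale0r; exact: P0. Qed.

Lemma stabilizes1 : stabilizes 1.
Proof. by move=> w; rewrite scale1r. Qed.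

Lemma stabilizesP c u v : stabilizes u -> stabilizes v -> stabilizes (c *: u + v).
Proof. by move=> Su Sv w Pw; rewrite scaler_algP; apply: PP; auto. Qed.

Lemma stabilizesD u v : stabilizes u -> stabilizes v -> stabilizes (u + v).
Proof. by move=> Su Sv; rewrite -[u]scale1r; exact: stabilizesP. Qed.

Lemma stabilizesM u v : stabilizes u -> stabilizes v -> stabilizes (u * v).
Proof. by move=> Su Sv w Pw; rewrite -scalerA; auto. Qed.

Lemma stabilizesZ c u : stabilizes u -> stabilizes (c *: u).
Proof.
by move=> Su; rewrite -[c *: u]addr0; apply: stabilizesP => //; exact: stabilizes0.
Qed.

Lemma stabilizesB u v : stabilizes u -> stabilizes v -> stabilizes (u - v).
Proof. by move=> Su Sv; rewrite -scaleN1r addrC; exact: stabilizesP. Qed.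

Lemma stabilizesX u n : stabilizes u -> stabilizes (u ^+ n).
Proof.
move=> Su; elim: n => [|n IHn]; first by rewrite expr0; exact: stabilizes1.
by rewrite exprS; exact: stabilizesM.
Qed.

Lemma stabilizes_sum (I : eqType) (r : seq I) (E : I -> A) :
  (forall i, i \in r -> stabilizes (E i)) -> stabilizes (\sum_(i <- r) E i).
Proof.
move=> SE; rewrite big_seq; elim/big_ind: _ => //; first exact: stabilizes0.
exact: stabilizesD.
Qed.

Lemma stabilizes_exp_series (X : nat -> A) n :
  (forall i, stabilizes (X i)) -> stabilizes (exp_series X n).
Proof.
move=> SX; apply: stabilizes_sum => j _; apply: stabilizesZ.
elim: (nat_of_ord j) {2}n => [|j' IHj] n'.
  by rewrite series_pow0; case: eqP => _; [exact: stabilizes1 | exact: stabilizes0].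
by rewrite series_powS; apply: stabilizes_sum => i _; apply: stabilizesM.
Qed.

End Stabilizer.

Section CyclicImage.
Context {K : fieldType} {A : algType K} {M : lmodType A} {N : lmodType K}.
Context (nu : N -> M) (xm : int -> N -> N) (y : int -> A) (n0 : N).
Hypothesis nuP : forall c a b, nu (c *: a + b) = c%:A *: nu a + nu b.
Hypothesis nu0 : nu 0 = 0.
Hypothesis nuM : forall k a, nu (xm k a) = y k *: nu a.
Hypothesis N_ind : forall P : N -> Prop,
  P 0 -> (forall c a b, P a -> P b -> P (c *: a + b)) ->
  P n0 -> (forall m a, P a -> P (xm m a)) -> forall a, P a.

Definition image_of (w : M) : Prop := exists a, w = nu a.

Lemma image_ofP c w w' : image_of w -> image_of w' -> image_of (c%:A *: w + w').
Proof. by move=> [a ->] [b ->]; exists (c *: a + b); rewrite nuP. Qed.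

Lemma image_of0 : image_of 0.
Proof. by exists 0; rewrite nu0. Qed.

(** To see that the image of [N] is stable under [u], it suffices to move [u]
    to the right of every generator, up to elements already known to stabilize
    it, until it reaches [n0]. *)
Lemma image_stable u : image_of (u *: nu n0) ->
  (forall k, exists c u', stabilizes image_of u' /\
     u * y k = c *: (y k * u) + u') ->
  stabilizes image_of u.
Proof.
move=> u0 H w [a ->]; elim/N_ind: a => [|c a b Pa Pb||k a Pa] //.
- by rewrite nu0 scaler0; exact: image_of0.
- by rewrite nuP scaler_algC; exact: image_ofP.
have [c [u' [Su' E]]] := H k.
rewrite nuM scalerA E scaler_algP -scalerA; apply: image_ofP.
  by case: Pa => b ->; exists (xm k b); rewrite nuM.
by apply: Su'; exists a.
Qed.

End CyclicImage.

Section VermaModuleBijection.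
Context {F : fieldType} (charF : [pchar F] =i pred0) (lam : weight).
Local Notation N := (Nq F).
Local Notation x := (@Nq_var F).
Local Notation q := (@q F).
Local Notation M := (rverma (F := F) lam).

Lemma Nq_to_UqP c (a b : N) :
  Nq_to_Uq (c *: a + b) = c *: Nq_to_Uq a + Nq_to_Uq b.
Proof. exact: linearP. Qed.

Lemma Nq_to_UqM (a b : N) : Nq_to_Uq (a * b) = Nq_to_Uq a * Nq_to_Uq b.
Proof. exact: rmorphM. Qed.

Lemma Nq_to_Uq1 : Nq_to_Uq (1 : N) = 1.
Proof. exact: rmorph1. Qed.

Lemma Nq_to_Uq0 : Nq_to_Uq (0 : N) = 0.
Proof. exact: raddf0. Qed.

Lemma Nq_to_UqB (a b : N) : Nq_to_Uq (a - b) = Nq_to_Uq a - Nq_to_Uq b.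
Proof. exact: raddfB. Qed.

Definition Nq_hwv (a : N) : M := Nq_to_Uq a *: hwv lam.

Lemma Nq_hwvP c a b : Nq_hwv (c *: a + b) = c%:A *: Nq_hwv a + Nq_hwv b.
Proof. by rewrite /Nq_hwv Nq_to_UqP; exact: scaler_algP. Qed.

Lemma Nq_hwv0 : Nq_hwv 0 = 0.
Proof. by rewrite /Nq_hwv Nq_to_Uq0; exact: scale0r. Qed.

Lemma Nq_hwv1 : Nq_hwv 1 = hwv lam.
Proof. by rewrite /Nq_hwv Nq_to_Uq1; exact: scale1r. Qed.

Lemma Nq_hwvM k a : Nq_hwv (x k * a) = gx (@Uq_var F) false k *: Nq_hwv a.
Proof. by rewrite /Nq_hwv Nq_to_UqM Nq_to_Uq_var; exact: esym (scalerA _ _ _). Qed.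

(** Otherwise some nonzero [c] would lie in the left ideal that defines the
    Verma module, which the action of U_q on [N] sends to 0. *)
Lemma Nq_hwv_inj : injective Nq_hwv.
Proof.
have [f [f1 fx f_gen]] := Uq_action_on_vacuum charF lam.
have fE a : f (Nq_to_Uq a) = a.
  elim/(@Nq_ind F): a => [|c a b Ha Hb||m a Ha].
  - by rewrite Nq_to_Uq0 linear0.
  - by rewrite Nq_to_UqP -[RHS]/(c *: a + b) -{2}Ha -{2}Hb; exact: linearP.
  - by rewrite Nq_to_Uq1 f1.
  - by rewrite Nq_to_UqM Nq_to_Uq_var fx Ha.
suff H c : Nq_hwv c = 0 -> c = 0.
  move=> a b ab; apply/eqP; rewrite -subr_eq0; apply/eqP/H.
  rewrite /Nq_hwv Nq_to_UqB; apply: etrans (scalerBl _ _ _) _.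
  by apply: etrans (congr1 (fun w => w - Nq_hwv b) ab) _; exact: subrr.
move=> c0; have /cls_eq0 [s Gs E] : cls (rverma_gen lam) (Nq_to_Uq c) = 0.
  rewrite -c0 /Nq_hwv /hwv; apply: etrans (clsZ _ _ _).
  by congr (cls _ _); exact: esym (mulr1 _).
rewrite -[c]fE {}E raddf_sum big_seq big1 // => p /Gs.
exact: f_gen.
Qed.

Lemma Uq_ind (P : Uq F -> Prop) :
  P 0 -> (forall c a b, P a -> P b -> P (c *: a + b)) ->
  P 1 -> (forall g a, P a -> P (Uq_var F g * a)) -> forall a, P a.
Proof. exact: presented_ind. Qed.

Lemma Uq_var_rel u v : Uq_rel (@Uq_var F) u v -> u = v.
Proof.
move=> /(@Uq_rel_lift _ _ _ (@Uq_proj F) (@fvar _ _) _ _)[//|u' [v' [uv <- <-]]].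
exact: (pcls_rel uv).
Qed.

Lemma hwvE (u : Uq F) : u *: hwv lam = cls (rverma_gen lam) u.
Proof.
by apply: etrans (esym (clsZ _ _ _)) _; congr (cls _ _); exact: (mulr1 u).
Qed.

End VermaModuleBijection.

Lemma gh0 (F : fieldType) (T : algType (Fq F)) (gen : Uq_gen -> T) : gh gen 0 = 0.
Proof. by rewrite /gh insubF. Qed.

Lemma cls_gen (R : pzRingType) (V : lmodType R) (G : V -> Prop) (u : V) :
  G u -> cls G u = 0.
Proof.
move=> Gu; have <- : cls G 0 = 0 by exact: (linear0 (cls G)).
by apply/cls_eq; rewrite subr0; exact: lspan_gen.
Qed.

Section VermaModuleSurjection.
Context {F : fieldType} (lam : weight).
Local Notation N := (Nq F).
Local Notation x := (@Nq_var F).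
Local Notation q := (@q F).
Local Notation M := (rverma (F := F) lam).
Local Notation Nq_hwv := (@Nq_hwv F lam).
Local Notation S := (stabilizes (image_of Nq_hwv)).

(** The relations of U_q move each generator to the right of the x^-_k: first K,
    D and gamma, then h, hence the currents, and finally x^+, whose commutators
    with the x^-_k are given by the currents. *)
Lemma stable_generator g : S (Uq_var F g).
Proof.
have Sind u := @image_stable _ _ _ _ Nq_hwv _ _ 1 (Nq_hwvP lam) (Nq_hwv0 lam)
  (Nq_hwvM lam) (@Nq_ind F) u.
have S0 : S 0 by exact: (stabilizes0 (image_of0 (Nq_hwv0 lam))).
have S1 : S 1 by exact: stabilizes1.
have SM (u v : Uq F) : S u -> S v -> S (u * v) by exact: stabilizesM.
have SZ c (u : Uq F) : S u -> S (c *: u).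
  exact: (stabilizesZ (image_of0 (Nq_hwv0 lam)) (image_ofP (Nq_hwvP lam))).
have SB (u v : Uq F) : S u -> S v -> S (u - v).
  exact: (stabilizesB (image_ofP (Nq_hwvP lam))).
have hwvZ c (u : Uq F) : lspan (rverma_gen lam) (u - c%:A) ->
    image_of Nq_hwv (u *: Nq_hwv 1).
  move=> /cls_eq E; exists (c *: 1 + 0); rewrite Nq_hwvP Nq_hwv1 Nq_hwv0 addr0.
  by rewrite !hwvE.
have gK0 e : image_of Nq_hwv (gK (@Uq_var F) e *: Nq_hwv 1).
  by apply/hwvZ/lspan_gen; exact: RV_K.
have gD0 e : image_of Nq_hwv (gD (@Uq_var F) e *: Nq_hwv 1).
  by apply/hwvZ/lspan_gen; exact: RV_D.
have KV e : gK (@Uq_var F) e * gK (@Uq_var F) (~~ e) = 1.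
  by apply: Uq_var_rel; exact: Rel_KV.
have DV e : gD (@Uq_var F) e * gD (@Uq_var F) (~~ e) = 1.
  by apply: Uq_var_rel; exact: Rel_DV.
have SK e : S (gK (@Uq_var F) e).
  apply: Sind => [|k]; first by [exact: gK0 | exact: gD0].
  have E : gK (@Uq_var F) true * gx (@Uq_var F) false k * gK (@Uq_var F) false =
      q ^ (sgn false * 2) *: gx (@Uq_var F) false k.
    by apply: Uq_var_rel; exact: Rel_Kx.
  case: e; eexists; exists 0; split; first by exact: S0.
  - by apply: (conj_swap E); exact: (KV false).
  - exact: S0.
  - by apply: (conj_swapV E); [exact: (expfz_neq0 _ q_neq0) | exact: (KV false)].
have SD e : S (gD (@Uq_var F) e).
  apply: Sind => [|k]; first by [exact: gK0 | exact: gD0].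
  have E : gD (@Uq_var F) true * gx (@Uq_var F) false k * gD (@Uq_var F) false =
      q ^ k *: gx (@Uq_var F) false k.
    by apply: Uq_var_rel; exact: Rel_Dx.
  case: e; eexists; exists 0; split; first by exact: S0.
  - by apply: (conj_swap E); exact: (DV false).
  - exact: S0.
  - by apply: (conj_swapV E); [exact: (expfz_neq0 _ q_neq0) | exact: (DV false)].
have SG e : S (gG (@Uq_var F) e).
  apply: Sind => [|k].
    apply: (@hwvZ 1); rewrite scale1r; apply: lspan_gen; exact: RV_G.
  exists 1, 0; split=> //; rewrite scale1r addr0; apply: Uq_var_rel.
  exact: Rel_Gcentral.
have Sx k : S (gx (@Uq_var F) false k).
  by move=> _ [a ->]; exists (x k * a); rewrite Nq_hwvM.
have Sghalf n : S (ghalf (@Uq_var F) n).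
  by case: n => n; exact: (stabilizesX _ (SG _)).
have hwv0 (u : Uq F) : rverma_gen lam u -> image_of Nq_hwv (u *: Nq_hwv 1).
  move=> Gu; exists 0; rewrite Nq_hwv0 Nq_hwv1 hwvE.
  exact: cls_gen.
have Sh l : S (gh (@Uq_var F) l).
  case: (eqVneq l 0) => [->|l0].
    by rewrite gh0; exact: S0.
  apply: Sind => [|k]; first by apply: hwv0; exact: RV_h.
  have E := Uq_var_rel (Rel_hx (@Uq_var F) false k l0).
  exists 1; eexists; split; last exact: (commutator_swap E).
  apply: SZ; apply: SM; [exact: Sghalf | exact: Sx].
have Sexp (X : nat -> Uq F) n : (forall i, S (X i)) -> S (exp_series X n).
  exact: (stabilizes_exp_series (image_of0 (Nq_hwv0 lam)) (image_ofP (Nq_hwvP lam))).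
have Spsi k : S (gpsi (@Uq_var F) k).
  rewrite /gpsi; case: ifP => _; last exact: S0.
  by apply: SM; [exact: SK | apply: Sexp => i; apply: SZ; exact: Sh].
have Sphi k : S (gphi (@Uq_var F) k).
  rewrite /gphi; case: ifP => _; last exact: S0.
  by apply: SM; [exact: SK | apply: Sexp => i; apply: SZ; exact: Sh].
case: g => [[] k|l|e|e|e].
- apply: Sind => [|l]; first by apply: hwv0; exact: RV_x.
  have E := Uq_var_rel (Rel_xpxm (@Uq_var F) k l).
  exists 1; eexists; split; last exact: (commutator_swap E).
  apply: SZ; apply: SB; apply: SM; by [exact: Sghalf | exact: Spsi | exact: Sphi].
- exact: Sx.
- by have := Sh (val l); rewrite /gh valK.
- exact: SK.
- exact: SD.
- exact: SG.
Qed.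

Lemma Nq_hwv_surj (w : M) : image_of Nq_hwv w.
Proof.
have -> : w = (rep w : Uq F) *: hwv lam.
  by rewrite hwvE; exact: esym (repK w).
apply: (@Uq_ind F (fun u => image_of Nq_hwv (u *: hwv lam))) => [|c a b Pa Pb||g a Pa].
- by exists 0; rewrite Nq_hwv0; exact: scale0r.
- have -> : (c *: a + b) *: hwv lam = c%:A *: (a *: hwv lam) + b *: hwv lam :> M.
    exact: scaler_algP.
  exact (image_ofP (Nq_hwvP lam) c Pa Pb).
- by exists 1; rewrite Nq_hwv1; exact: scale1r.
- have -> : (Uq_var F g * a) *: hwv lam = Uq_var F g *: (a *: hwv lam) :> M.
    exact: esym (scalerA _ _ _).
  exact (stable_generator g Pa).
Qed.

End VermaModuleSurjection.

(** * Existence of the operators Omega *)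

Section OmegaOperators.
Context {K : fieldType} (q : K).
Hypothesis q0 : q != 0.
Context {V : lmodType K} (ntV : exists v : V, v != 0).
Context (y : int -> endo ntV) (v0 : V).
Hypothesis yy : quad_rel (q ^ (-2)) y.
Hypothesis V_ind : forall P : V -> Prop,
  P 0 -> (forall c a b, P a -> P b -> P (c *: a + b)) ->
  P v0 -> (forall m a, P a -> P (y m a)) -> forall a, P a.
Hypothesis V_rec : forall (W : lmodType K) (X : int -> {linear W -> W}) (w : W),
  (forall k l u, X (k + 1) (X l u) + X (l + 1) (X k u) =
     q ^ (-2) *: (X l (X (k + 1) u) + X k (X (l + 1) u))) ->
  {f : {linear V -> W} | f v0 = w & forall m a, f (y m a) = X m (f a)}.

Definition taylor (r : nat) : K :=
  if r is r'.+1 then (q ^+ 4 - 1) * q ^+ (2 * r') else q ^+ 2.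

Definition taylorz (j : int) : K := if j is Posz r then taylor r else 0.

(** The coefficients of (q^-2 t - 1) / (t - q^-2), multiplied by the denominator;
    the two Kronecker symbols are the coefficients of the numerator. *)
Lemma taylorz_rec j : taylorz j + (j + 1 == 0)%:R =
  q ^ (-2) * ((j == 0)%:R + taylorz (j + 1)).
Proof.
have q2 : q ^ (-2) * q ^+ 2 = 1.
  by rewrite [q ^ (-2)]exprnN mulVf // expf_neq0.
case: j => [[|r]|[|r]].
- rewrite addr0 /= muln0 expr0 mulr1 addrC subrK.
  by rewrite (exprM q 2 2) expr2 mulrA q2 mul1r.
- rewrite -PoszD addn1 /= addr0 add0r mulnS exprD.
  by rewrite [RHS]mulrCA (mulrA (q ^ (-2))) q2 mul1r.
- by rewrite add0r /= add0r q2.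
- have -> : Negz r.+1 + 1 = Negz r by rewrite !NegzE; lia.
  by rewrite /= !addr0 mulr0.
Qed.

Definition eventual_sum (f : nat -> V) : V :=
  if pselect (exists n, forall r, (n <= r)%N -> f r = 0) is left ex
  then \sum_(r < projT1 (cid ex)) f r else 0.

Lemma sum_stable (f : nat -> V) n m : (forall r, (n <= r)%N -> f r = 0) ->
  (n <= m)%N -> \sum_(r < m) f r = \sum_(r < n) f r.
Proof.
move=> f0 nm; rewrite -!(big_mkord xpredT f) (big_cat_nat (n := n)) //=.
by rewrite [X in _ + X]big_nat_cond [X in _ + X]big1 ?addr0 // => r; case/andP => /andP[/f0].
Qed.

Lemma eventual_sumE (f : nat -> V) n : (forall r, (n <= r)%N -> f r = 0) ->
  eventual_sum f = \sum_(r < n) f r.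
Proof.
move=> f0; rewrite /eventual_sum; case: pselect => [ex|[]]; last by exists n.
case: cid => m /= fm0; rewrite -(sum_stable f0 (leq_maxl n m)).
by rewrite -(sum_stable fm0 (leq_maxr n m)).
Qed.

Definition below (B : int) (phi : int -> V) : Prop := forall j, j < B -> phi j = 0.

Definition bounded_below : {pred (int -> V)} :=
  fun phi => `[< exists B, below B phi >].

Lemma belowP (phi psi : int -> V) B : below B phi -> below B psi ->
  forall c : K, below B (c *: phi + psi).
Proof.
move=> H1 H2 c j jB; rewrite -[LHS]/(c *: phi j + psi j) H1 // H2 //.
by rewrite scaler0 addr0.
Qed.

Lemma below_le B B' phi : B' <= B -> below B phi -> below B' phi.
Proof. by move=> le H j jB; apply: H; apply: lt_le_trans le. Qed.

Lemma bounded_below_submod : submod_closed bounded_below.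
Proof.
split=> [|c phi psi /asboolP[B HB] /asboolP[B' HB']]; apply/asboolP.
  by exists 0.
exists (Num.min B B'); apply: belowP.
  by apply: below_le HB; rewrite ge_min lexx.
by apply: below_le HB'; rewrite ge_min lexx orbT.
Qed.

HB.instance Definition _ :=
  GRing.isSubmodClosed.Build K (int -> V) bounded_below bounded_below_submod.

Let P : lmodType K := sub_mod bounded_below.

(** The sum over r in the recursion of Omega. *)
Definition conv (m : int) (phi : int -> V) (k : int) : V :=
  eventual_sum (fun r => taylor r *: y (m + r%:Z) (phi (k - r%:Z))).

Lemma convE B phi m k n : below B phi -> k - n%:Z < B ->
  conv m phi k = \sum_(r < n) taylor r *: y (m + r%:Z) (phi (k - r%:Z)).
Proof.
move=> HB kn; apply: eventual_sumE => r nr; rewrite HB ?linear0 ?scaler0 //; lia.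
Qed.

Lemma conv_below B phi m : below B phi -> below B (conv m phi).
Proof.
move=> HB k kB; rewrite (convE (n := 0) m HB) ?big_ord0 //.
by rewrite subr0.
Qed.

Lemma convP B phi psi m : below B phi -> below B psi -> forall c k,
  conv m (c *: phi + psi) k = c *: conv m phi k + conv m psi k.
Proof.
move=> H1 H2 c k; have H12 := belowP H1 H2 c.
pose n := `|k - B|.+1; have nB : k - n%:Z < B by lia.
rewrite (convE m H1 nB) (convE m H2 nB) (convE m H12 nB) scaler_sumr -big_split.
apply: eq_bigr => r _ /=; rewrite -[(c *: phi + psi) _]/(c *: phi _ + psi _).
by rewrite linearP scalerDr !scalerA mulrC.
Qed.

(** A pair [(a, phi)] stands for an element [a] together with the family of all
    the [Omega(k) a]; [omega_fun] is the recursion for [Omega(k) (y m a)]. *)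
Definition omega_fun (m : int) (w : V * P) (k : int) : V :=
  (k == - m)%:R *: w.1 + conv m (val w.2) k.

Lemma omega_fun_bounded m w : omega_fun m w \in bounded_below.
Proof.
case: w => a [phi]; rewrite /omega_fun /=; move=> /[dup] phiP /asboolP[B HB].
apply/asboolP; exists (Num.min B (- m)) => k; rewrite lt_min => /andP[kB km].
by rewrite (conv_below m HB kB) addr0 (lt_eqF km) scale0r.
Qed.

Definition omega_act (m : int) (w : V * P) : V * P :=
  (y m w.1, exist _ (omega_fun m w) (omega_fun_bounded m w)).

Lemma omega_act_is_linear m : linear (omega_act m).
Proof.
move=> c [a phi] [b psi]; apply/pair_eqP => /=; rewrite linearP eqxx /=.
apply/eqP/val_inj => /=; apply: funext => k.
rewrite -[RHS]/(c *: omega_fun m (a, phi) k + omega_fun m (b, psi) k).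
rewrite /omega_fun /=.
have /asboolP[B HB] := valP phi; have /asboolP[B' HB'] := valP psi.
have Hm : below (Num.min B B') (val phi) by apply: below_le HB; rewrite ge_min lexx.
have Hm' : below (Num.min B B') (val psi).
  by apply: below_le HB'; rewrite ge_min lexx orbT.
by rewrite (convP m Hm Hm') scalerDr !scalerDr addrACA !scalerA mulrC.
Qed.

Definition conv2 (N : nat) (k l : int) (phi : int -> V) (n : int) : V :=
  \sum_(r < N) \sum_(s < N) (taylor r * taylor s) *:
    y (k + r%:Z) (y (l + s%:Z) (phi (n - r%:Z - s%:Z))).

Lemma conv_omega_fun k l (a : V) (phi : P) B (n : int) (N : nat) :
  below B (val phi) -> n - N%:Z < B -> n - N%:Z < - l ->
  conv k (omega_fun l (a, phi)) n =
  taylorz (n + l) *: y (n + k + l) a + conv2 N k l (val phi) n.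
Proof.
move=> HB nB nl.
have below_omega : below (Num.min B (- l)) (omega_fun l (a, phi)).
  move=> j; rewrite lt_min => /andP[jB jl].
  by rewrite /omega_fun /= (conv_below l HB jB) addr0 (lt_eqF jl) scale0r.
rewrite (convE k (n := N) below_omega) ?lt_min ?nB //.
under eq_bigr => r _.
  rewrite /omega_fun /= (convE l (n := N) HB); last by lia.
  rewrite linearD linearZ scalerDr /= linear_sum scaler_sumr /=.
  under eq_bigr do rewrite linearZ scalerA.
over.
rewrite big_split /=; congr (_ + _).
case nlE: (n + l) => [r0|r0]; last first.
  rewrite scale0r big1 // => r _.
  have -> : (n - r%:Z == - l) = false by apply/eqP; lia.
  by rewrite scale0r scaler0.
have r0N : (r0 < N)%N by lia.
rewrite (bigD1 (Ordinal r0N)) //= big1 ?addr0 => [|r /eqP r_neq]; last first.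
  have -> : (n - r%:Z == - l) = false.
    by apply/eqP => nr; apply: r_neq; apply: val_inj => /=; lia.
  by rewrite scale0r scaler0.
have -> : (n - r0%:Z == - l) by apply/eqP; lia.
by rewrite scale1r; congr (_ *: y _ a); lia.
Qed.

Lemma conv2_quad N k l phi n :
  conv2 N (k + 1) l phi n + conv2 N (l + 1) k phi n =
  q ^ (-2) *: (conv2 N l (k + 1) phi n + conv2 N k (l + 1) phi n).
Proof.
have swap i j : conv2 N i j phi n = \sum_(r < N) \sum_(s < N)
    (taylor r * taylor s) *: y (i + s%:Z) (y (j + r%:Z) (phi (n - r%:Z - s%:Z))).
  rewrite /conv2 exchange_big; apply: eq_bigr => r _; apply: eq_bigr => s _.
  by rewrite mulrC addrAC.
rewrite (swap (l + 1)) (swap l) /conv2 -!big_split scaler_sumr.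
apply: eq_bigr => r _ /=; rewrite -!big_split scaler_sumr; apply: eq_bigr => s _ /=.
rewrite -!scalerDr [RHS]scalerA [q ^ _ * _]mulrC -[RHS]scalerA; congr (_ *: _).
have := congr1 (fun S : endo ntV => S (phi (n - r%:Z - s%:Z))) (yy (k + r%:Z) (l + s%:Z)).
by rewrite !endoE !(addrAC _ _ 1) => ->.
Qed.

(** The recursion respects the quadratic relations.  Its double sums do so term
    by term, as the coefficients are symmetric in the two summation indices; what
    remains are multiples of [y (n + k + l + 1) a], and there the claim is the
    recursion satisfied by the Taylor coefficients. *)
Lemma omega_act_quad k l (w : V * P) :
  omega_act (k + 1) (omega_act l w) + omega_act (l + 1) (omega_act k w) =
  q ^ (-2) *: (omega_act l (omega_act (k + 1) w) + omega_act k (omega_act (l + 1) w)).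
Proof.
case: w => a phi; apply/pair_eqP => /=; apply/andP; split; apply/eqP.
  by have := congr1 (fun S : endo ntV => S a) (yy k l); rewrite !endoE.
apply: val_inj; apply: funext => n.
have /asboolP[B HB] := valP phi.
pose N := (`|(n - B)%R| + `|(n + l)%R| + `|(n + k)%R|).+3%N.
have second i j : n - N%:Z < - j ->
    omega_fun i (omega_act j (a, phi)) n = (n == - i)%:R *: y j a +
     (taylorz (n + j) *: y (n + i + j) a + conv2 N i j (val phi) n).
  by move=> Nj; rewrite /omega_fun /= (conv_omega_fun _ _ HB _ Nj) //; lia.
rewrite -[LHS]/(omega_fun (k + 1) (omega_act l (a, phi)) n +
  omega_fun (l + 1) (omega_act k (a, phi)) n).
rewrite -[RHS]/(q ^ (-2) *: (omega_fun l (omega_act (k + 1) (a, phi)) n +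
  omega_fun k (omega_act (l + 1) (a, phi)) n)).
rewrite !second //; [|lia..].
set W := y (n + k + l + 1) a.
have delta i j : i + j = k + l + 1 -> (n == - i)%:R *: y j a = (n + i == 0)%:R *: W.
  move=> ij; rewrite addr_eq0; case: eqP => [ni|_]; last by rewrite !scale0r.
  by rewrite !scale1r /W; congr (y _ a); lia.
have idx i j : i + j = k + l + 1 -> y (n + i + j) a = W.
  by move=> ij; rewrite /W; congr (y _ a); lia.
rewrite !delta; [|lia..]; rewrite !idx; [|lia..].
have -> : n + (k + 1) = n + k + 1 by rewrite addrA.
have -> : n + (l + 1) = n + l + 1 by rewrite addrA.
set C1 := conv2 _ _ _ _ _; set C2 := conv2 _ _ _ _ _.
set C3 := conv2 _ _ _ _ _; set C4 := conv2 _ _ _ _ _.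
have C : C1 + C2 = q ^ (-2) *: (C3 + C4) by exact: conv2_quad.
have Ek := taylorz_rec (n + k); have El := taylorz_rec (n + l).
have combine (d1 t1 d2 t2 : K) (D1 D2 : V) : d1 *: W + (t1 *: W + D1) +
    (d2 *: W + (t2 *: W + D2)) = ((t2 + d1) + (t1 + d2)) *: W + (D1 + D2).
  by rewrite !scalerDl [LHS](AC ((1*2)*(1*2)) ((5*1)*(2*4)*(3*6))).
rewrite !combine Ek El C -mulrDr -scalerA -scalerDr; congr (_ *: (_ *: _ + _)).
by rewrite [LHS]addrC; congr (_ + _); exact: addrC.
Qed.

(** The orbit of [(v0, 0)] under [omega_act] is the graph of the operators. *)
Lemma omega_exists : exists Om : int -> {linear V -> V},
  (forall k, Om k v0 = 0) /\
  forall k m a, exists n : nat,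
    (forall r : nat, (n <= r)%N -> Om (k - r%:Z) a = 0) /\
    Om k (y m a) = (k == - m)%:R *: a +
      \sum_(r < n) taylor r *: y (m + r%:Z) (Om (k - r%:Z) a).
Proof.
have [k l w|f f0 fy] := V_rec (X := fun m => mklin (omega_act_is_linear m)) (v0, 0).
  exact: omega_act_quad.
have f1 a : (f a).1 = a.
  elim/V_ind: a => [|c a b Ha Hb||m a Ha].
  - by rewrite linear0.
  - by rewrite linearP /= Ha Hb.
  - by rewrite f0.
  - by rewrite fy /= Ha.
have flin k : linear (fun a => val (f a).2 k) by move=> c a b; rewrite linearP.
exists (fun k => mklin (flin k)); split=> [k|k m a] /=; first by rewrite f0.
have /asboolP[B HB] := valP (f a).2.
exists `|k - B|.+1; split=> [r rk|]; first by apply: HB; lia.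
rewrite fy /= /omega_fun f1; congr (_ + _); apply: (convE m HB); lia.
Qed.

End OmegaOperators.

(** * Ordered monomials *)

Lemma lspan_ind (R : pzRingType) (V : lmodType R) (G P : V -> Prop) :
  P 0 -> (forall a x y, P x -> P y -> P (a *: x + y)) ->
  (forall x, G x -> P x) -> forall x, lspan G x -> P x.
Proof.
move=> P0 PP GP x [s Gs ->]; rewrite big_seq; elim/big_rec: _ => // p y ps Py.
by apply: PP => //; apply/GP/Gs.
Qed.

Lemma lspan0 (R : pzRingType) (V : lmodType R) (G : V -> Prop) : lspan G 0.
Proof. by apply/in_lspanP/rpred0. Qed.

Lemma lspanP (R : pzRingType) (V : lmodType R) (G : V -> Prop) a x y :
  lspan G x -> lspan G y -> lspan G (a *: x + y).
Proof.
move=> /in_lspanP Lx /in_lspanP Ly; apply/in_lspanP.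
by rewrite rpredD // rpredZ.
Qed.

Lemma lspanZ (R : pzRingType) (V : lmodType R) (G : V -> Prop) a x :
  lspan G x -> lspan G (a *: x).
Proof. by move=> Gx; rewrite -[_ *: _]addr0; apply: lspanP => //; apply: lspan0. Qed.

Lemma lspan_map (R : pzRingType) (V W : lmodType R) (G : V -> Prop) (G' : W -> Prop)
    (f : {linear V -> W}) :
  (forall x, G x -> lspan G' (f x)) -> forall x, lspan G x -> lspan G' (f x).
Proof.
move=> Gf; apply: lspan_ind => //; first by rewrite linear0; apply: lspan0.
by move=> a x y Px Py; rewrite linearP; apply: lspanP.
Qed.

Lemma lspan_sub (R : pzRingType) (V : lmodType R) (G G' : V -> Prop) :
  (forall x, G x -> G' x) -> forall x, lspan G x -> lspan G' x.
Proof. by move=> GG' x [s Gs ->]; exists s => // p /Gs /GG'. Qed.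

Lemma nonincreasing_cons i (s : seq int) :
  nonincreasing (i :: s) = all (fun j => j <= i) s && nonincreasing s.
Proof.
apply: path_sortedE => j k l kj lk; exact: le_trans lk kj.
Qed.

Lemma int_upper_bound m (s : seq int) :
  exists2 c, m <= c & all (fun i => i <= c) s.
Proof.
elim: s => [|i s [c mc sc]]; first by exists m.
exists (Num.max i c) => /=; first by rewrite le_max mc orbT.
by rewrite le_max lexx /=; apply: sub_all sc => j jc; rewrite le_max jc orbT.
Qed.

Section Straightening.
Context {R : comNzRingType} {V : lmodType R} (X : int -> {linear V -> V}) (t : R).
Context (mon : seq int -> V).
Hypothesis mon_cons : forall i s, mon (i :: s) = X i (mon s).
Hypothesis XX : forall k l w, l < k -> X l (X (k + 1) w) =
  t *: (X (k + 1) (X l w) + X (l + 1) (X k w)) - X k (X (l + 1) w).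
Hypothesis XX1 : forall k w, X k (X (k + 1) w) = t *: X (k + 1) (X k w).

Definition mon_le (n : nat) (c : int) (m : V) : Prop :=
  exists s, [/\ nonincreasing s, size s = n, all (fun i => i <= c) s & m = mon s].

Lemma mon_le_prefix n c w : lspan (mon_le n c) w -> lspan (mon_le n.+1 c) (X c w).
Proof.
apply: lspan_map => _ [s [s_ord <- s_le ->]]; apply: lspan_gen.
exists (c :: s); rewrite nonincreasing_cons s_ord s_le /= s_le lexx.
by split=> //; rewrite mon_cons.
Qed.

Lemma mon_le_trans n c c' w : c <= c' -> lspan (mon_le n c) w -> lspan (mon_le n c') w.
Proof.
move=> cc'; apply: lspan_sub => _ [s [s_ord sn s_le ->]]; exists s; split=> //.
by apply: sub_all s_le => i /le_trans; apply.
Qed.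

(** When the first entry [i] exceeds [m], the quadratic relation rewrites
    [x_m x_i] through products with outer index [i], [m + 1] or [i - 1].  The
    inner factor is straightened by induction on the length, within the bound
    [i]; then the outer factor [i] can be put in front, and for the other two
    the distance to the bound is smaller than for [m].  No division occurs, so
    the span may be taken over any ring which contains [t]. *)
Lemma straighten n c m w :
  m <= c -> lspan (mon_le n c) w -> lspan (mon_le n.+1 c) (X m w).
Proof.
elim: n c m w => [|n IHn] c m w.
  move=> mc; apply: lspan_map => _ [s [_ /size0nil -> _ ->]]; apply: lspan_gen.
  by exists [:: m]; rewrite mon_cons /= mc.
have [d] := ubnP `|c - m|%N; elim: d c m w => // d IHd c m w cm mc.
apply: lspan_map => _ [[|i s] [] // si_ord [sn] /= /andP[ic s_le] ->].
have := si_ord; rewrite nonincreasing_cons => /andP[s_lei s_ord].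
have [im|mi] := leP i m.
  apply: lspan_gen; exists [:: m, i & s]; split; last by rewrite [RHS]mon_cons.
  - rewrite nonincreasing_cons si_ord /= im andbT; apply: sub_all s_lei => j ji.
    exact: le_trans ji im.
  - by rewrite /= sn.
  - by rewrite /= mc ic s_le.
apply: (mon_le_trans ic).
have Lw : lspan (mon_le n i) (mon s) by apply: lspan_gen; exists s.
pose k := i - 1; have iE : i = k + 1 by rewrite subrK.
have Lk : lspan (mon_le n.+1 i) (X k (mon s)) by apply: IHn => //; lia.
rewrite mon_cons iE; have [mk|km] := eqVneq m k.
  rewrite mk XX1 -iE; apply: lspanZ; exact: mon_le_prefix.
have Lm : lspan (mon_le n.+1 i) (X m (mon s)) by apply: IHn => //; lia.
have Lm1 : lspan (mon_le n.+1 i) (X (m + 1) (mon s)) by apply: IHn => //; lia.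
rewrite XX; last by lia.
apply/in_lspanP; rewrite rpredB ?rpredZ ?rpredD //; apply/in_lspanP; rewrite -iE.
- exact: mon_le_prefix.
- by apply: IHd => //; lia.
- by apply: IHd => //; lia.
Qed.

Lemma ordered_span_stable m w :
  lspan (fun u => exists2 s, nonincreasing s & u = mon s) w ->
  lspan (fun u => exists2 s, nonincreasing s & u = mon s) (X m w).
Proof.
apply: lspan_map => _ [s s_ord ->].
have [c mc sc] := int_upper_bound m s.
have := @straighten (size s) c m (mon s) mc; move=> H.
apply: lspan_sub (H _); last by apply: lspan_gen; exists s.
by move=> _ [s' [s'_ord _ _ ->]]; exists s'.
Qed.

End Straightening.

Lemma seq_int_max (h : seq int) x : x \in h ->
  exists2 m, m \in h & all (fun i => i <= m) h.
Proof.
elim: h x => // i h IHh x _; case: h IHh => [_|j h IHh].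
  by exists i; rewrite /= ?inE ?eqxx ?lexx.
have [|m mh m_max] := IHh j; first by rewrite inE eqxx.
have [im|mi] := leP i m.
  by exists m; [rewrite in_cons mh orbT | apply/andP; split].
exists i; first by rewrite inE eqxx.
apply/andP; split; first exact: lexx.
by apply: sub_all m_max => k km; apply: le_trans km (ltW mi).
Qed.

Lemma ltn_sum_has (T : Type) (r : seq T) (p : pred T) (f g : T -> nat) :
  has p r -> (forall i, p i -> (f i < g i)%N) ->
  (\sum_(i <- r | p i) f i < \sum_(i <- r | p i) g i)%N.
Proof.
move=> + fg; elim: r => //= i r IHr.
have le : (\sum_(i <- r | p i) f i <= \sum_(i <- r | p i) g i)%N.
  by apply: leq_sum => j /fg /ltnW.
rewrite !big_cons; case: ifP => /= [pi _|_]; last exact: IHr.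
by rewrite -addSn leq_add // fg.
Qed.

Section Independence.
Context {K : fieldType} {V : lmodType K} (Om : int -> {linear V -> V}).
Context (mon : seq int -> V).
Hypothesis Om_small : forall j s, all (fun i => i < - j) s -> Om j (mon s) = 0.
Hypothesis Om_head : forall m s, nonincreasing (m :: s) ->
  exists2 d, d != 0 & Om (- m) (mon (m :: s)) = d *: mon s.
Hypothesis mon_nil : mon [::] != 0.

(** Let [m] be the largest first entry in the linear relation.  Applying
    [Om (- m)] kills the monomials whose first entry is smaller and, up to a
    nonzero scalar, deletes the first entry [m] of the others: the result is a
    shorter linear relation. *)
Lemma ordered_independent (ss : seq (seq int)) (c : seq int -> K) :
  uniq ss -> all nonincreasing ss -> \sum_(s <- ss) c s *: mon s = 0 ->
  forall s, s \in ss -> c s = 0.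
Proof.
have [N] := ubnP (\sum_(s <- ss) (size s).+1)%N.
elim: N ss c => // N IHN ss c lt_N ss_uniq ss_ord sum0.
have [nilss|/allPn[s1 s1ss s1nil]] := boolP (all (pred1 [::]) ss).
  move=> s sss; have /eqP s0 := allP nilss s sss.
  have ssE : ss = [:: [::]].
    case: ss ss_uniq nilss sss {lt_N ss_ord sum0} => [//|u [|u' r]] /=.
      by move=> _ /andP[/eqP ->].
    move=> /andP[uu' _] /and3P[/eqP u0 /eqP u'0 _] _; move: uu'.
    by rewrite u0 u'0 inE eqxx.
  move: sum0; rewrite ssE big_seq1 s0 => /eqP.
  by rewrite scaler_eq0 (negPf mon_nil) orbF => /eqP.
pose heads := [seq head 0 s | s <- ss & s != [::]].
have s1heads : head 0 s1 \in heads by apply: map_f; rewrite mem_filter s1nil.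
have [m mheads m_max] := seq_int_max s1heads.
pose p (s : seq int) := if s is i :: _ then i == m else false.
have pE s : p s -> s = m :: behead s by case: s => //= i s /eqP ->.
have [s2 s2ss ps2] : exists2 s, s \in ss & p s.
  case/mapP: mheads => s; rewrite mem_filter => /andP[s_neq0 sss] mE.
  by exists s => //; rewrite /p; case: (s) s_neq0 mE => //= i s' _ ->.
have Om_p s : s \in ss -> ~~ p s -> Om (- m) (mon s) = 0.
  move=> sss; have := allP ss_ord _ sss; case: s sss => [_ _ _|i s sss is_ord /= im].
    exact: Om_small.
  have {}im : i < m.
    rewrite lt_neqAle im; apply: (allP m_max); apply/mapP; exists (i :: s) => //.
    by rewrite mem_filter.
  apply: Om_small => /=; rewrite opprK im /=.
  move: is_ord; rewrite nonincreasing_cons => /andP[s_le _].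
  by apply: sub_all s_le => j /le_lt_trans; apply.
have /(@boolp.choice (seq int) K)[d dP] (s : seq int) : exists d : K,
    nonincreasing (m :: s) -> d != 0 /\ Om (- m) (mon (m :: s)) = d *: mon s.
  have [/Om_head[e e0 eE]|_] := boolP (nonincreasing (m :: s)); last by exists 0.
  by exists e.
have has_p : has p ss by apply/hasP; exists s2.
pose tails := [seq behead s | s <- ss & p s].
have tails_uniq : uniq tails.
  rewrite map_inj_in_uniq ?filter_uniq // => s s'; rewrite !mem_filter.
  by move=> /andP[/pE -> _] /andP[/pE -> _] /= ->.
have tail_ord s : s \in tails -> nonincreasing (m :: s) /\ m :: s \in ss.
  case/mapP => s'; rewrite mem_filter => /andP[/pE s'E s'ss] ->.
  by rewrite -s'E; split=> //; exact: (allP ss_ord).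
have tails_ord : all nonincreasing tails.
  apply/allP => s /tail_ord[]; by rewrite nonincreasing_cons => /andP[].
have sum_tails : \sum_(s <- tails) (c (m :: s) * d s) *: mon s = 0.
  have := congr1 (Om (- m)) sum0; rewrite linear0 linear_sum /= (bigID p) /=.
  rewrite [X in _ + X]big_seq_cond [X in _ + X]big1 => [|s /andP[sss ps]]; last first.
    by rewrite linearZ /= Om_p // scaler0.
  rewrite addr0 /tails big_map big_filter => sum_p; rewrite -[RHS]sum_p.
  rewrite big_seq_cond [RHS]big_seq_cond; apply: eq_bigr => s /andP[sss ps].
  have := allP ss_ord _ sss; rewrite (pE _ ps) /= => ms_ord.
  by rewrite linearZ /= (dP _ ms_ord).2 scalerA.
have c_tails s : s \in tails -> c (m :: s) = 0.
  move=> st; have [ms_ord _] := tail_ord s st.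
  suff /eqP : c (m :: s) * d s = 0 by rewrite mulf_eq0 (negPf (dP _ ms_ord).1) orbF => /eqP.
  apply: (IHN tails (fun s => c (m :: s) * d s)) => //.
  rewrite -ltnS; apply: leq_trans lt_N; rewrite ltnS /tails big_map big_filter.
  rewrite [X in (_ < X)%N](bigID p) /= ltn_addr //; apply: ltn_sum_has => // s'.
  by move=> /pE ->.
have c_p s : s \in ss -> p s -> c s = 0.
  move=> sss ps; rewrite (pE _ ps); apply: c_tails; apply/mapP; exists s => //.
  by rewrite mem_filter ps.
move=> s sss; have [ps|nps] := boolP (p s); first exact: c_p.
apply: (IHN [seq s <- ss | ~~ p s] c); rewrite ?mem_filter ?nps ?filter_uniq //.
- rewrite -ltnS; apply: leq_trans lt_N; rewrite ltnS big_filter.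
  rewrite [X in (_ < X)%N](bigID p) /= -[X in (X < _)%N]add0n ltn_add2r.
  by have := @ltn_sum_has _ ss p (fun=> 0%N) (fun s => (size s).+1); rewrite big1 //; apply.
- by apply/allP => s'; rewrite mem_filter => /andP[_]; exact: (allP ss_ord).
move: sum0; rewrite (bigID p) /= big_filter big_seq_cond big1 ?add0r // => s'.
by case/andP => s'ss ps'; rewrite c_p // scale0r.
Qed.

End Independence.

(** * Signed monomials at q = 0 *)

Section FermionicLimit.
Context {R : pzRingType} {V : lmodType R}.
Context (X Om : int -> {linear V -> V}) (mon : seq int -> V).
Hypothesis mon_cons : forall i s, mon (i :: s) = X i (mon s).
Hypothesis X_anti : forall k l w, X l (X (k + 1) w) = - X k (X (l + 1) w).
Hypothesis X_sq : forall k w, X k (X (k + 1) w) = 0.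
Hypothesis Om_nil : forall k, Om k (mon [::]) = 0.
Hypothesis Om_X : forall k m w,
  Om k (X m w) = (k == - m)%:R *: w - X (m + 1) (Om (k - 1) w).

Lemma fermion_Om_small j s : all (fun i => i < - j) s -> Om j (mon s) = 0.
Proof.
elim: s j => [|m s IHs] j /=; first by rewrite Om_nil.
case/andP=> mj sj; rewrite mon_cons Om_X IHs ?linear0 ?addr0; last first.
  by apply: sub_all sj => i; lia.
have -> : (j == - m) = false by apply/eqP; lia.
by rewrite scale0r.
Qed.

Lemma fermion_Om_head m s :
  nonincreasing (m :: s) -> Om (- m) (mon (m :: s)) = mon s.
Proof.
rewrite nonincreasing_cons => /andP[s_le _].
rewrite mon_cons Om_X eqxx scale1r fermion_Om_small ?linear0 ?addr0 //.
by apply: sub_all s_le => i; lia.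
Qed.

(** [c] bounds the entries of the monomial; the inductions below need it to
    prepend an entry to a monomial obtained recursively. *)
Definition signed_mon (c : int) (w : V) : Prop :=
  w = 0 \/ exists s, [/\ nonincreasing s, all (fun i => i <= c) s
    & w = mon s \/ w = - mon s].

Lemma signed_monN c w : signed_mon c w -> signed_mon c (- w).
Proof.
case=> [->|[s [s_ord s_le sE]]]; first by rewrite oppr0; left.
by right; exists s; split=> //; case: sE => ->; rewrite ?opprK; [right|left].
Qed.

Lemma signed_mon_prefix c w : signed_mon c w -> signed_mon c (X c w).
Proof.
case=> [->|[s [s_ord s_le sE]]]; first by rewrite linear0; left.
right; exists (c :: s); rewrite nonincreasing_cons s_ord /= s_le lexx; split=> //.
by rewrite mon_cons; case: sE => ->; rewrite ?linearN; [left|right].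
Qed.

Lemma signed_mon_trans c c' w : c <= c' -> signed_mon c w -> signed_mon c' w.
Proof.
move=> cc' [->|[s [s_ord s_le sE]]]; [by left | right; exists s; split=> //].
by apply: sub_all s_le => i /le_trans; apply.
Qed.

(** If [m] is smaller than the first entry [i], the relation moves [i - 1] to
    the front and leaves [m + 1] to be inserted into a shorter monomial.  The
    shift of [i] to [i - 1] is why a monomial with entries at most [c + 1] yields
    one with entries at most [c]. *)
Lemma fermion_X_stable m c s : m <= c -> nonincreasing s ->
  all (fun i => i <= c + 1) s -> signed_mon c (X m (mon s)).
Proof.
elim: s m c => [|i s IHs] m c mc.
  move=> _ _; right; exists [:: m]; rewrite /= mc; split=> //; left.
  by rewrite mon_cons.
move=> is_ord /= /andP[ic s_lec].
have := is_ord; rewrite nonincreasing_cons => /andP[s_lei s_ord].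
have [im|mi] := leP i m.
  right; exists (m :: i :: s); split; last by left; rewrite [RHS]mon_cons.
    rewrite nonincreasing_cons is_ord /= im andbT.
    by apply: sub_all s_lei => j ji; apply: le_trans im.
  rewrite /= mc (le_trans im mc) /=.
  by apply: sub_all s_lei => j ji; apply: le_trans (le_trans im mc).
rewrite mon_cons -[i](subrK 1) X_anti.
have [mi1|mi1] := eqVneq m (i - 1).
  by left; rewrite mi1 X_sq oppr0.
apply: signed_monN; apply: (@signed_mon_trans (i - 1)); first by lia.
apply: signed_mon_prefix; apply: IHs => //; first by lia.
by apply: sub_all s_lei => j; lia.
Qed.

(** Dually, moving [Om k] past the first entry [m] replaces [m] by [m + 1]. *)
Lemma fermion_Om_stable k c s : nonincreasing s -> all (fun i => i <= c) s ->
  signed_mon (c + 1) (Om k (mon s)).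
Proof.
elim: s k c => [|m s IHs] k c; first by rewrite Om_nil; left.
move=> ms_ord /= /andP[mc s_lec].
have := ms_ord; rewrite nonincreasing_cons => /andP[s_lem s_ord].
have [->|km] := eqVneq k (- m).
  rewrite fermion_Om_head //; right; exists s; split=> //; last by left.
  by apply: sub_all s_lec => i; lia.
rewrite mon_cons Om_X (negPf km) scale0r sub0r; apply: signed_monN.
apply: (@signed_mon_trans (m + 1)); first by lia.
by apply: signed_mon_prefix; apply: IHs.
Qed.

(** Up to sign, [Om k] replaces the first entries of the monomial by their
    successors until it deletes an entry, and [X (- k)] undoes this. *)
Lemma fermion_X_Om k s : nonincreasing s -> Om k (mon s) <> 0 ->
  X (- k) (Om k (mon s)) = mon s.
Proof.
elim: s k => [|m s IHs] k; first by rewrite Om_nil.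
move=> ms_ord; have := ms_ord; rewrite nonincreasing_cons => /andP[_ s_ord].
have [->|km] := eqVneq k (- m).
  by rewrite fermion_Om_head // opprK mon_cons.
rewrite mon_cons Om_X (negPf km) scale0r sub0r linearN X_anti opprK => Om_neq0.
have -> : - k + 1 = - (k - 1) by lia.
rewrite IHs // => Om0; apply: Om_neq0.
by rewrite Om0 linear0 oppr0.
Qed.

(** By [fermion_X_Om] both sides are equal to the monomial itself.  On the right
    this requires that [Om (- m - 1)] kills the monomial [b]; otherwise [b] is in
    the image of [X (m + 1)], and then [X m b = 0] since the relations make
    [X m (X (m + 1) w)] vanish. *)
Lemma fermion_commute m s : nonincreasing s ->
  Om (- m) (mon s) <> 0 -> X m (mon s) <> 0 ->
  X m (Om (- m) (mon s)) = Om (- m) (X m (mon s)).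
Proof.
move=> s_ord Om_neq0 X_neq0; have := fermion_X_Om s_ord Om_neq0.
rewrite opprK => ->; rewrite Om_X eqxx scale1r.
have [-> |] := pselect (Om (- m - 1) (mon s) = 0); first by rewrite linear0 subr0.
move/(fermion_X_Om s_ord); rewrite opprB opprK addrC => E.
by case: X_neq0; rewrite -E X_sq.
Qed.

End FermionicLimit.

(** * Base change *)

(** Working with a family indexed by sequences, rather than with a set of
    vectors, the injectivity of the family is part of the independence. *)
Lemma basis_of_family (R : pzRingType) (V : lmodType R) (J : eqType) (j0 : J)
    (m : J -> V) (Q : J -> Prop) :
  (forall x, lspan (fun u => exists2 j, Q j & u = m j) x) ->
  (forall (js : seq J) (c : J -> R), uniq js -> (forall j, j \in js -> Q j) ->
     \sum_(j <- js) c j *: m j = 0 -> forall j, j \in js -> c j = 0) ->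
  is_basis (fun u => exists2 j, Q j & u = m j).
Proof.
move=> span ind; split=> // s c s_uniq s_fam sum0 x xs.
have /(@boolp.choice V J)[f fP] (u : V) : exists j : J, u \in s -> Q j /\ u = m j.
  have [/s_fam[j Qj uE]|_] := boolP (u \in s); last by exists j0.
  by exists j.
have mfK u : u \in s -> m (f u) = u by move=> us; have [_ <-] := fP u us.
rewrite -(mfK x xs); apply: (ind [seq f u | u <- s] (fun j => c (m j))).
- rewrite map_inj_in_uniq // => u u' us u's uu'.
  by rewrite -(mfK u) // uu' mfK.
- by move=> j /mapP[u us ->]; have [] := fP u us.
- rewrite big_map -[RHS]sum0 big_seq [RHS]big_seq.
  by apply: eq_bigr => u us; rewrite mfK.
- by apply: map_f.
Qed.

Lemma lspan_family (R : pzRingType) (V : lmodType R) (J : eqType) (m : J -> V)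
    (Q : J -> Prop) x : lspan (fun u => exists2 j, Q j & u = m j) x ->
  exists (js : seq J) (c : J -> R),
    [/\ uniq js, forall j, j \in js -> Q j & x = \sum_(j <- js) c j *: m j].
Proof.
move: x; apply: lspan_ind => [|a x y [js [c [js_uniq jsQ ->]]] [ks [d [ks_uniq ksQ ->]]]|].
- by exists [::], (fun=> 0); split=> //; rewrite big_nil.
- pose js' := undup (js ++ ks).
  have widen (ls : seq J) (b : J -> R) : uniq ls -> {subset ls <= js'} ->
      \sum_(j <- ls) b j *: m j = \sum_(j <- js') (if j \in ls then b j else 0) *: m j.
    move=> ls_uniq ls_sub; rewrite [RHS](bigID (fun j => j \in ls)) /=.
    rewrite [X in _ = _ + X]big1 => [|j /negPf ->]; last by rewrite scale0r.
    rewrite addr0 -[RHS]big_filter (perm_big [seq j <- js' | j \in ls]) /=; last first.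
      apply: uniq_perm => //; first by rewrite filter_uniq ?undup_uniq.
      by move=> j; rewrite mem_filter andb_idr // => /ls_sub.
    by rewrite 2!big_filter; apply: eq_bigr => j ->.
  rewrite (widen js) // => [|j]; last by rewrite mem_undup mem_cat => ->.
  rewrite (widen ks) // => [|j]; last by rewrite mem_undup mem_cat => ->; rewrite orbT.
  exists js', (fun j => a * (if j \in js then c j else 0) + if j \in ks then d j else 0).
  split; first exact: undup_uniq.
    by move=> j; rewrite mem_undup mem_cat => /orP[/jsQ|/ksQ].
  rewrite scaler_sumr -big_split /=; apply: eq_bigr => j _.
  by rewrite scalerDl scalerA.
move=> _ [j Qj ->]; exists [:: j], (fun=> 1); split=> //.
  by move=> i; rewrite inE => /eqP ->.
by rewrite big_seq1 scale1r.
Qed.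

Lemma base_change_ind (A : pzRingType) (B : nzRingType) (f : {rmorphism A -> B})
    (L : lmodType A) (P : base_change f L -> Prop) :
  P 0 -> (forall c x y, P x -> P y -> P (c *: x + y)) ->
  (forall x, P (tens f x)) -> forall x, P x.
Proof.
move=> P0 PP Pt x; rewrite -[x]repK [rep x]monalgE.
elim/big_rec: _ => [|k u _ Pu].
  by rewrite [cls _ _](linear0 (cls (base_change_rel f (L := L)))).
rewrite malg_UZ; have -> : cls (base_change_rel f (L := L)) ((rep x)@_k *: << k >> + u) =
    (rep x)@_k *: tens f k + cls _ u.
  exact: (linearP (cls (base_change_rel f (L := L)))).
exact: PP.
Qed.

Lemma tens0 (A : pzRingType) (B : nzRingType) (f : {rmorphism A -> B})
    (L : lmodType A) : tens f (0 : L) = 0.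
Proof. by have := tensZ f 0 (0 : L); rewrite !scale0r rmorph0 scale0r. Qed.

Lemma base_change_span (A : pzRingType) (B : nzRingType) (f : {rmorphism A -> B})
    (L : lmodType A) (G : L -> Prop) :
  (forall x, lspan G x) ->
  forall x : base_change f L, lspan (fun u => exists2 x, G x & u = tens f x) x.
Proof.
move=> Gspan; apply: base_change_ind => [|c x y Px Py|x]; [exact: lspan0 | exact: lspanP |].
have := Gspan x; move: x; apply: lspan_ind => [|a x y Px Py|x Gx].
- by rewrite tens0; exact: lspan0.
- by rewrite tensD tensZ; exact: lspanP.
- by apply: lspan_gen; exists x.
Qed.

Lemma base_change_span_family (A : pzRingType) (B : nzRingType)
    (f : {rmorphism A -> B}) (L : lmodType A) (J : Type) (m : J -> L) (Q : J -> Prop) :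
  (forall x, lspan (fun u => exists2 j, Q j & u = m j) x) ->
  forall x : base_change f L, lspan (fun u => exists2 j, Q j & u = tens f (m j)) x.
Proof.
move=> m_span x; have := base_change_span (f := f) m_span x.
by apply: lspan_sub => _ [_ [j Qj ->] ->]; exists j.
Qed.

(** * Reduction of the lattice at q = 0 *)

Section Reduction.
Context {A : comNzRingType} {F : fieldType} (res : {rmorphism A -> F}).
Context {L : lmodType A} (X Om : int -> {linear L -> L}) (mon : seq int -> L).
Context (t : A) (g : nat -> A) (e : L -> A).
Hypothesis mon_cons : forall i s, mon (i :: s) = X i (mon s).
Hypothesis mon_span : forall x, lspan (fun u => exists2 s, nonincreasing s & u = mon s) x.
Hypothesis XX : forall k l w, X l (X (k + 1) w) + X k (X (l + 1) w) =
  t *: (X (k + 1) (X l w) + X (l + 1) (X k w)).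
Hypothesis XX_adjacent : forall k w, X k (X (k + 1) w) = t *: X (k + 1) (X k w).
Hypothesis Om_nil : forall k, Om k (mon [::]) = 0.
Hypothesis Om_X : forall k m x, exists n : nat, Om k (X m x) =
  ((k == - m)%:R : A) *: x + \sum_(r < n.+2) g r *: X (m + r%:Z) (Om (k - r%:Z) x).
Hypothesis res_t : res t = 0.
Hypothesis res_g0 : res (g 0%N) = 0.
Hypothesis res_g1 : res (g 1%N) = -1.
Hypothesis res_g2 : forall r, res (g r.+2) = 0.
Hypothesis eD : {morph e : x y / x + y}.
Hypothesis eZ : forall a x, e (a *: x) = a * e x.
Hypothesis e_nil : e (mon [::]) = 1.

Local Notation T := (base_change res L).
Context (Xr Omr : int -> {linear T -> T}).
Hypothesis Xr_tens : forall m x, Xr m (tens res x) = tens res (X m x).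
Hypothesis Omr_tens : forall m x, Omr m (tens res x) = tens res (Om m x).

Definition mon_red (s : seq int) : T := tens res (mon s).

Lemma red_span (x : T) : lspan (fun u => exists2 s, nonincreasing s & u = mon_red s) x.
Proof. exact: base_change_span_family mon_span x. Qed.

Lemma red_cons i s : mon_red (i :: s) = Xr i (mon_red s).
Proof. by rewrite /mon_red Xr_tens mon_cons. Qed.

Lemma red_X_sq k w : Xr k (Xr (k + 1) w) = 0.
Proof.
move: w; apply: base_change_ind => [|c x y Px Py|x].
- by rewrite 2!linear0.
- by rewrite 2!linearP Px Py scaler0 addr0.
by rewrite 2!Xr_tens XX_adjacent tensZ res_t scale0r.
Qed.

Lemma red_X_anti k l w : Xr l (Xr (k + 1) w) = - Xr k (Xr (l + 1) w).
Proof.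
move: w; apply: base_change_ind => [|c x y Px Py|x].
- by rewrite (linear0 (Xr (k + 1))) (linear0 (Xr (l + 1))) 2!linear0 oppr0.
- rewrite (linearP (Xr (k + 1))) (linearP (Xr (l + 1))) (linearP (Xr k)) (linearP (Xr l)).
  by rewrite Px Py opprD scalerN.
apply/eqP; rewrite -addr_eq0 !Xr_tens -tensD.
by rewrite XX tensZ res_t scale0r.
Qed.

Lemma red_Om_nil k : Omr k (mon_red [::]) = 0.
Proof. by rewrite [LHS]Omr_tens Om_nil tens0. Qed.

(** The Taylor coefficients reduce to 0, -1, 0, 0, ...: only the term with r = 1
    survives. *)
Lemma red_Om_X k m w :
  Omr k (Xr m w) = (k == - m)%:R *: w - Xr (m + 1) (Omr (k - 1) w).
Proof.
move: w; apply: base_change_ind => [|c x y Px Py|x].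
- by rewrite (linear0 (Xr m)) (linear0 (Omr k)) (linear0 (Omr (k - 1)))
    (linear0 (Xr (m + 1))) scaler0 subr0.
- rewrite (linearP (Xr m)) (linearP (Omr k)) (linearP (Omr (k - 1))) (linearP (Xr (m + 1))).
  by rewrite Px Py scalerBr scalerDr !scalerA (mulrC c) opprD addrACA.
rewrite !(Xr_tens, Omr_tens); have [n ->] := Om_X k m x.
rewrite tensD tensZ rmorph_nat; congr (_ + _).
rewrite !big_ord_recl tensD tensZ res_g0 scale0r add0r tensD tensZ res_g1 scaleN1r.
rewrite /= [X in _ + X](_ : _ = 0) ?addr0 //.
elim/big_rec: _ => [|r y _ yE]; first exact: tens0.
by rewrite tensD tensZ res_g2 scale0r add0r.
Qed.

(** The functional [e], reduced at q = 0, takes the value 1 there. *)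
Lemma red_nil_neq0 : mon_red [::] != 0.
Proof.
have hD : {morph (fun x => res (e x) : F^o) : x y / x + y}.
  by move=> x y; rewrite eD rmorphD.
have hZ a x : (res (e (a *: x)) : F^o) = res a *: (res (e x) : F^o).
  by rewrite eZ rmorphM.
pose f := mklin (base_change_lift_is_linear hD hZ).
have fE : f (mon_red [::]) = 1.
  by rewrite [LHS](base_change_lift_tens hD hZ) e_nil rmorph1.
by apply: contra_eq_neq fE => ->; rewrite linear0 eq_sym oner_neq0.
Qed.

Lemma red_basis : is_basis (fun u => exists2 s, nonincreasing s & u = mon_red s).
Proof.
apply: (basis_of_family [::] red_span) => ss c ss_uniq /allP ss_ord.
apply: (ordered_independent (Om := Omr)) => // [j s||].
- exact: (fermion_Om_small red_cons red_Om_nil red_Om_X).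
- move=> m s ms; exists 1; rewrite ?oner_neq0 // scale1r.
  exact: (fermion_Om_head red_cons red_Om_nil red_Om_X).
exact: red_nil_neq0.
Qed.

End Reduction.

(** * The lattice spanned by the ordered monomials *)

Section Lattice.
Context {A : comNzRingType} {K F : fieldType}.
Context (incl : {rmorphism A -> K}) (res : {rmorphism A -> F}).
Context {V : lmodType K} (X Om : int -> {linear V -> V}) (mon : seq int -> V).
Context (t : A) (g : nat -> A) (eps : {linear V -> K^o}).

Hypothesis incl_inj : injective incl.
Hypothesis K2 : (2 : K) != 0.
Hypothesis mon_cons : forall i s, mon (i :: s) = X i (mon s).
Hypothesis XX : forall k l w, X l (X (k + 1) w) + X k (X (l + 1) w) =
  incl t *: (X (k + 1) (X l w) + X (l + 1) (X k w)).
Hypothesis Om_nil : forall k, Om k (mon [::]) = 0.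
Hypothesis Om_X : forall k m w, exists n : nat,
  (forall r : nat, (n <= r)%N -> Om (k - r%:Z) w = 0) /\
  Om k (X m w) = (k == - m)%:R *: w +
    \sum_(r < n) incl (g r) *: X (m + r%:Z) (Om (k - r%:Z) w).
Hypothesis res_t : res t = 0.
Hypothesis res_g0 : res (g 0%N) = 0.
Hypothesis res_g1 : res (g 1%N) = -1.
Hypothesis res_g2 : forall r, res (g r.+2) = 0.
Hypothesis eps_nil : eps (mon [::]) = 1.
Hypothesis eps_cons : forall i s, eps (mon (i :: s)) = 0.
Hypothesis V_ind : forall P : V -> Prop,
  P 0 -> (forall c a b, P a -> P b -> P (c *: a + b)) ->
  P (mon [::]) -> (forall m a, P a -> P (X m a)) -> forall a, P a.

Local Notation VA := (restr incl V).

Definition ordered_mon (m : VA) : Prop := exists2 s, nonincreasing s & m = mon s.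

Local Notation L := (in_lspan ordered_mon).

Lemma XX_sorted k l w : X l (X (k + 1) w) =
  incl t *: (X (k + 1) (X l w) + X (l + 1) (X k w)) - X k (X (l + 1) w).
Proof. by rewrite -XX addrK. Qed.

(** For [k = l] the quadratic relation has equal terms, whence the factor 2. *)
Lemma XX_adjacent k w : X k (X (k + 1) w) = incl t *: X (k + 1) (X k w).
Proof.
apply: (scalerI K2); rewrite scalerA mulrC -scalerA !scaler_nat !mulr2n.
exact: XX.
Qed.

Lemma restr_linear (f : {linear V -> V}) : linear (f : VA -> VA).
Proof. by move=> a u w; exact: (linearP f (incl a)). Qed.

Lemma lattice_X m (w : VA) : w \in L -> (X m w : VA) \in L.
Proof.
move=> /in_lspanP Lw; apply/in_lspanP.
have := @ordered_span_stable A VA (fun m => mklin (restr_linear (X m))) t mon.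
apply=> // [k l u _|k u]; [exact: XX_sorted | exact: XX_adjacent].
Qed.

Lemma lattice_mon s : (mon s : VA) \in L.
Proof.
elim: s => [|i s IHs]; first by apply/in_lspanP/lspan_gen; exists [::].
by rewrite mon_cons; exact: lattice_X.
Qed.

Lemma lattice_Om k (w : VA) : w \in L -> (Om k w : VA) \in L.
Proof.
move=> /in_lspanP Lw; apply/in_lspanP; move: w Lw.
apply: (@lspan_map A VA VA _ _ (mklin (restr_linear (Om k)))) => _ [s _ ->] /=.
apply/in_lspanP; elim: s k => [|m s IHs] k; first by rewrite Om_nil rpred0.
have [n [_ OmE]] := Om_X k m (mon s); rewrite mon_cons OmE.
have -> : (k == - m)%:R *: mon s = ((k == - m)%:R : A) *: (mon s : VA).
  by rewrite [RHS]/(incl _ *: (mon s : V)) rmorph_nat.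
rewrite (@rpredD VA) ?rpredZ ?lattice_mon // (@rpred_sum VA) // => r _.
by rewrite -[_ *: _]/(g r *: (X (m + r%:Z) (Om (k - r%:Z) (mon s)) : VA)) rpredZ // lattice_X.
Qed.

Lemma Om_small j s : all (fun i => i < - j) s -> Om j (mon s) = 0.
Proof.
elim: s j => [|m s IHs] j /=; first by rewrite Om_nil.
case/andP=> mj sj; rewrite mon_cons; have [n [_ ->]] := Om_X j m (mon s).
have -> : (j == - m) = false by apply/eqP; lia.
rewrite scale0r add0r big1 // => r _; rewrite IHs ?linear0 ?scaler0 //.
by apply: sub_all sj => i; lia.
Qed.

(** [Om (- m)] may delete any of the leading entries equal to [m].  Deleting one
    which is not the first costs a power of [g 0], so the scalar reduces to 1 at
    q = 0 and in particular it is nonzero. *)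
Lemma Om_head m s : nonincreasing (m :: s) ->
  exists2 d : K, d != 0 & Om (- m) (mon (m :: s)) = d *: mon s.
Proof.
move=> ms_ord; suff [e e1 eE] : exists2 e : A, res e = 1 &
    Om (- m) (mon (m :: s)) = incl e *: mon s.
  exists (incl e) => //; rewrite -(rmorph0 incl) (inj_eq incl_inj).
  by apply: contra_eq_neq e1 => ->; rewrite rmorph0 eq_sym oner_neq0.
elim: s ms_ord => [|i s IHs] ms_ord.
  exists 1; rewrite ?rmorph1 // mon_cons scale1r.
  have [n [_ ->]] := Om_X (- m) m (mon [::]).
  rewrite eqxx scale1r big1 ?addr0 // => r _.
  by rewrite Om_nil linear0 scaler0.
have := ms_ord; rewrite nonincreasing_cons => /andP[is_le is_ord].
have small r : (0 < r)%N -> Om (- m - r%:Z) (mon (i :: s)) = 0.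
  by move=> r0; apply: Om_small; apply: sub_all is_le => j; lia.
have E : Om (- m) (mon [:: m, i & s]) =
    mon (i :: s) + incl (g 0%N) *: X m (Om (- m) (mon (i :: s))).
  rewrite [mon (m :: _)]mon_cons.
  have [[|n] [n0 ->]] := Om_X (- m) m (mon (i :: s)); rewrite eqxx scale1r.
    rewrite big_ord0 -[X in Om X (mon (i :: s))]subr0 (n0 0%N) //.
    by rewrite linear0 scaler0.
  rewrite big_ord_recl /= addr0 subr0 big1 ?addr0 // => r _.
  by rewrite small // linear0 scaler0.
have [im|im] := eqVneq i m; last first.
  exists 1; rewrite ?rmorph1 // scale1r E (Om_small (j := - m)).
    by rewrite linear0 scaler0 addr0.
  have {}im : i < m by move: is_le => /= /andP[im' _]; rewrite lt_neqAle im.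
  move: is_ord; rewrite opprK nonincreasing_cons /= im => /andP[s_le _].
  by apply: sub_all s_le => j /le_lt_trans; apply.
rewrite im in is_ord E *; have [e e1 eE] := IHs is_ord.
exists (1 + g 0%N * e); first by rewrite rmorphD rmorphM rmorph1 res_g0 mul0r addr0.
rewrite E eE linearZ /= -[X in incl _ *: (_ *: X)]mon_cons scalerA.
by rewrite rmorphD rmorphM rmorph1 scalerDl scale1r.
Qed.

Lemma mon_nil_neq0 : mon [::] != 0.
Proof.
by apply: contra_eq_neq eps_nil => ->; rewrite linear0 eq_sym oner_neq0.
Qed.

Lemma mon_independent (ss : seq (seq int)) (c : seq int -> K) :
  uniq ss -> (forall s, s \in ss -> nonincreasing s) ->
  \sum_(s <- ss) c s *: mon s = 0 -> forall s, s \in ss -> c s = 0.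
Proof.
move=> ss_uniq /allP ss_ord.
exact: (ordered_independent Om_small Om_head mon_nil_neq0).
Qed.

Lemma mon_span (w : V) : lspan (fun u => exists2 s, nonincreasing s & u = mon s) w.
Proof.
elim/V_ind: w => [|c a b Pa Pb||m a Pa].
- exact: lspan0.
- exact: lspanP.
- by apply: lspan_gen; exists [::].
apply: (@ordered_span_stable K V X (incl t) mon) => // [k l u _|k u].
  exact: XX_sorted.
exact: XX_adjacent.
Qed.

Definition monL (s : seq int) : sub_mod L := exist _ (mon s : VA) (lattice_mon s).

Lemma lattice_span (x : sub_mod L) :
  lspan (fun u => exists2 s, nonincreasing s & u = monL s) x.
Proof.
have /in_lspanP[r rG xE] := valP x.
elim: r rG x xE => [|[a u] r IHr] rG x xE.
  by rewrite (_ : x = 0); [exact: lspan0 | apply: val_inj; rewrite xE big_nil].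
have [s s_ord uE] := rG (a, u) (mem_head _ _); rewrite /= in uE.
have -> : x = a *: monL s + (x - a *: monL s) by rewrite addrC subrK.
apply: lspanP; first by apply: lspan_gen; exists s.
apply: IHr => [p pr|]; first by apply: rG; rewrite inE pr orbT.
apply: (addrI (a *: (mon s : VA))).
rewrite -[LHS]/(val (a *: monL s + (x - a *: monL s))) addrC subrK xE big_cons.
by rewrite /= uE.
Qed.

Lemma monL_independent (ss : seq (seq int)) (c : seq int -> A) :
  uniq ss -> (forall s, s \in ss -> nonincreasing s) ->
  \sum_(s <- ss) c s *: monL s = 0 -> forall s, s \in ss -> c s = 0.
Proof.
move=> ss_uniq ss_ord sum0 s sss; apply: incl_inj; rewrite rmorph0.
apply: (mon_independent (ss := ss) (c := fun s => incl (c s))) => //.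
have -> : \sum_(s <- ss) incl (c s) *: mon s = val (\sum_(s <- ss) c s *: monL s).
  by elim/big_rec2: _ => // i y1 y2 _ ->.
by rewrite sum0.
Qed.

Lemma lattice_basis : is_basis (fun u => exists2 s, nonincreasing s & u = monL s).
Proof.
exact: (basis_of_family [::] lattice_span monL_independent).
Qed.

Context (XL OmL : int -> {linear sub_mod L -> sub_mod L}).
Hypothesis XL_val : forall m x, val (XL m x) = X m (val x).
Hypothesis OmL_val : forall m x, val (OmL m x) = Om m (val x).

Lemma monL_cons i s : monL (i :: s) = XL i (monL s).
Proof. by apply: val_inj; rewrite XL_val /= mon_cons. Qed.

Lemma XXL k l w : XL l (XL (k + 1) w) + XL k (XL (l + 1) w) =
  t *: (XL (k + 1) (XL l w) + XL (l + 1) (XL k w)).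
Proof.
apply: val_inj.
rewrite -[LHS]/((val (XL l (XL (k + 1) w)) : V) + val (XL k (XL (l + 1) w))).
rewrite -[RHS]/(incl t *: ((val (XL (k + 1) (XL l w)) : V) + val (XL (l + 1) (XL k w)))).
by rewrite !XL_val XX.
Qed.

Lemma XXL_adjacent k w : XL k (XL (k + 1) w) = t *: XL (k + 1) (XL k w).
Proof.
apply: val_inj; rewrite -[RHS]/(incl t *: (val (XL (k + 1) (XL k w)) : V)).
by rewrite !XL_val XX_adjacent.
Qed.

Lemma OmL_nil k : OmL k (monL [::]) = 0.
Proof. by apply: val_inj; rewrite OmL_val /= Om_nil. Qed.

(** Padding the sum by two zero terms ensures that the terms with r = 0 and
    r = 1 are present. *)
Lemma OmL_X k m x : exists n : nat, OmL k (XL m x) = ((k == - m)%:R : A) *: x +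
  \sum_(r < n.+2) g r *: XL (m + r%:Z) (OmL (k - r%:Z) x).
Proof.
have [n [n0 OmE]] := Om_X k m (val x); exists n.
apply: val_inj; rewrite OmL_val XL_val OmE.
rewrite -[RHS]/(incl _ *: (val x : V) +
  (val (\sum_(r < n.+2) g r *: XL (m + r%:Z) (OmL (k - r%:Z) x)) : V)).
rewrite rmorph_nat; congr (_ + _).
pose f r := incl (g r) *: X (m + r%:Z) (Om (k - r%:Z) (val x)).
have -> : (val (\sum_(r < n.+2) g r *: XL (m + r%:Z) (OmL (k - r%:Z) x)) : V) =
    \sum_(r < n.+2) f r.
  by elim/big_rec2: _ => // r y1 y2 _ <-; rewrite /f -OmL_val -XL_val.
have f0 r : (n <= r)%N -> f r = 0.
  by move=> nr; rewrite /f (n0 r nr) (linear0 (X _)) scaler0.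
rewrite -[LHS]/(\sum_(r < n) f r); clearbody f.
by rewrite 2!big_ord_recr /= (f0 n) // (f0 n.+1) // !addr0.
Qed.

Lemma lattice_eps : exists e : sub_mod L -> A,
  [/\ {morph e : x y / x + y}, forall a x, e (a *: x) = a * e x,
      e (monL [::]) = 1 & forall x, incl (e x) = eps (val x)].
Proof.
have /(@boolp.choice (sub_mod L) A)[e eE] (x : sub_mod L) : exists a, incl a = eps (val x).
  have := lattice_span x; move: x; apply: lspan_ind => [|a x y [b bE] [c cE]|_ [s _ ->]].
  - by exists 0; rewrite rmorph0 -[RHS]/(eps 0) linear0.
  - exists (a * b + c); rewrite rmorphD rmorphM bE cE.
    by rewrite -[RHS]/(eps (incl a *: (val x : V) + val y)) linearP.
  case: s => [|i s]; first by exists 1; rewrite rmorph1 eps_nil.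
  by exists 0; rewrite rmorph0 eps_cons.
exists e; split=> // [x y|a x|]; apply: incl_inj.
- by rewrite rmorphD !eE -[LHS]/(eps ((val x : V) + val y)) linearD.
- by rewrite rmorphM !eE -[LHS]/(eps (incl a *: (val x : V))) linearZ.
- by rewrite eE rmorph1.
Qed.

(** The ordered monomials are at once a basis of the lattice over [A] and a basis
    of [V] over [K]. *)
Lemma lattice_incl_bij :
  bijective (base_change_lift incl (fun x : sub_mod L => (val x : V))).
Proof.
have hD : {morph (fun x : sub_mod L => (val x : V)) : x y / x + y} by [].
have hZ a (x : sub_mod L) : (val (a *: x) : V) = incl a *: (val x : V) by [].
pose f := mklin (base_change_lift_is_linear (W := V) hD hZ).
have fE x : f (tens incl x) = val x by exact: base_change_lift_tens.
rewrite -[base_change_lift _ _]/(f : _ -> _); clearbody f.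
have f_surj w : exists x, f x = w.
  have := mon_span w; move: w; apply: lspan_ind => [|a x y [b bE] [c cE]|_ [s _ ->]].
  - by exists 0; rewrite linear0.
  - by exists (a *: b + c); rewrite linearP bE cE.
  - by exists (tens incl (monL s)); rewrite fE.
have f_inj x : f x = 0 -> x = 0.
  have [ss [c [ss_uniq ss_ord ->]]] :=
    lspan_family (base_change_span_family (f := incl) lattice_span x).
  rewrite linear_sum => sum0; rewrite big_seq big1 // => s sss.
  rewrite (mon_independent (c := c) ss_uniq ss_ord _ sss) ?scale0r // -[RHS]sum0.
  by apply: eq_bigr => s' _; rewrite linearZ /= fE.
have [g0 g0E] := boolp.choice f_surj.
exists g0 => // x; apply/eqP; rewrite -subr_eq0; apply/eqP/f_inj.
by rewrite linearB /= g0E subrr.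
Qed.

Local Notation T := (base_change res (sub_mod L)).
Context (Xr Omr : int -> {linear T -> T}).
Hypothesis Xr_tens : forall m x, Xr m (tens res x) = tens res (XL m x).
Hypothesis Omr_tens : forall m x, Omr m (tens res x) = tens res (OmL m x).

Definition crystal (b : T) : Prop :=
  exists2 x : sub_mod L, ordered_mon (val x) & b = tens res x.

Local Notation rmon := (mon_red res monL).

Lemma crystalE : crystal = (fun b => exists2 s, nonincreasing s & b = rmon s).
Proof.
apply: funext => b; apply: propext; split=> [[x [s s_ord xs] ->]|[s s_ord ->]].
  have -> : x = monL s by apply: val_inj; exact: xs.
  exact: (ex_intro2 _ _ s s_ord (erefl (rmon s))).
exact: (ex_intro2 _ _ (monL s) (ex_intro2 _ _ s s_ord (erefl _)) (erefl _)).
Qed.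

Lemma rmon_cons i s : rmon (i :: s) = Xr i (rmon s).
Proof. exact: (red_cons monL_cons Xr_tens). Qed.

Lemma Xr_sq k w : Xr k (Xr (k + 1) w) = 0.
Proof. exact: (red_X_sq XXL_adjacent res_t Xr_tens). Qed.

Lemma Xr_anti k l w : Xr l (Xr (k + 1) w) = - Xr k (Xr (l + 1) w).
Proof. exact: (red_X_anti XXL res_t Xr_tens). Qed.

Lemma Omr_nil k : Omr k (rmon [::]) = 0.
Proof. exact: (red_Om_nil OmL_nil Omr_tens). Qed.

Lemma Omr_X k m w :
  Omr k (Xr m w) = (k == - m)%:R *: w - Xr (m + 1) (Omr (k - 1) w).
Proof. exact: (red_Om_X OmL_X res_g0 res_g1 res_g2 Xr_tens Omr_tens). Qed.

Lemma crystal_basis : is_basis crystal.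
Proof.
have [e [eD eZ e1 _]] := lattice_eps; rewrite crystalE.
exact: (red_basis monL_cons lattice_span OmL_nil OmL_X res_g0 res_g1 res_g2
  eD eZ e1 Xr_tens Omr_tens).
Qed.

Lemma signed_mon_crystal c w : signed_mon rmon c w ->
  crystal w \/ crystal (- w) \/ w = 0.
Proof.
rewrite crystalE => -[->|[s [s_ord _ [->|->]]]]; first by right; right.
  by left; exists s.
by right; left; exists s; rewrite ?opprK.
Qed.

Lemma crystal_X_stable m b : crystal b ->
  crystal (Xr m b) \/ crystal (- Xr m b) \/ Xr m b = 0.
Proof.
rewrite {1}crystalE => -[s s_ord ->]; have [c mc sc] := int_upper_bound m s.
apply: (signed_mon_crystal (c := c)).
apply: (fermion_X_stable rmon_cons Xr_anti Xr_sq mc s_ord).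
by apply: sub_all sc => i; lia.
Qed.

Lemma crystal_Om_stable k b : crystal b ->
  crystal (Omr k b) \/ crystal (- Omr k b) \/ Omr k b = 0.
Proof.
rewrite {1}crystalE => -[s s_ord ->]; have [c _ sc] := int_upper_bound 0 s.
apply: (signed_mon_crystal (c := c + 1)).
exact: (fermion_Om_stable rmon_cons Omr_nil Omr_X).
Qed.

Lemma crystal_comm m b : crystal b -> Omr (- m) b <> 0 -> Xr m b <> 0 ->
  Xr m (Omr (- m) b) = Omr (- m) (Xr m b).
Proof.
rewrite crystalE => -[s s_ord ->].
exact: (fermion_commute rmon_cons Xr_anti Xr_sq Omr_nil Omr_X).
Qed.

End Lattice.

(** * The crystal basis of a module isomorphic to the negative part *)

Lemma linear_factor (K : fieldType) (N V W : lmodType K) (f : {linear N -> V})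
    (h : {linear N -> W}) :
  injective f -> (forall w, exists a, w = f a) ->
  exists h' : {linear V -> W}, forall a, h' (f a) = h a.
Proof.
move=> f_inj f_surj; have [g gE] := boolp.choice f_surj.
have fK a : g (f a) = a by apply: f_inj; rewrite -gE.
have lin : linear (fun w => h (g w)).
  move=> c u w; rewrite (gE u) (gE w) -[in LHS](linearP f) !fK.
  by rewrite (linearP h).
by exists (mklin lin) => a /=; rewrite fK.
Qed.

(** Subtracting from [f] one of its eigenvalues removes a summand from the sum
    and multiplies the others by differences of eigenvalues, which induction
    shows to be the only reason for them to survive; [f] and [g] together
    separate the indices. *)
Lemma eigen_independent (K : fieldType) (V : lmodType K) (I : eqType)
    (f g : {linear V -> V}) (a b : I -> K) (s : seq I) (y : I -> V) :
  uniq s -> {in s &, forall i j, a i = a j -> b i = b j -> i = j} ->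
  (forall i, i \in s -> f (y i) = a i *: y i /\ g (y i) = b i *: y i) ->
  \sum_(i <- s) y i = 0 -> forall i, i \in s -> y i = 0.
Proof.
elim: s y => // i s IHs y /= /andP[i_s s_uniq] ab_inj eig sum0.
have step (h : {linear V -> V}) (c : I -> K) :
    (forall j, j \in i :: s -> h (y j) = c j *: y j) ->
    forall j, j \in s -> (c j - c i) *: y j = 0.
  move=> hE; apply: IHs => //.
  - by move=> j k js ks; apply: ab_inj; rewrite inE ?js ?ks orbT.
  - move=> j js; have [|fE gE] := eig j; first by rewrite inE js orbT.
    by rewrite !linearZ /= fE gE !scalerA mulrC (mulrC _ (b j)).
  have /(congr1 (fun w => h w - c i *: w)) := sum0.
  rewrite linear0 scaler0 subrr linear_sum scaler_sumr -sumrB /= big_cons.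
  rewrite hE ?mem_head // subrr add0r => E; rewrite -[RHS]E big_seq [RHS]big_seq.
  apply: eq_bigr => j js.
  by rewrite hE ?inE ?js ?orbT // scalerBl.
have y0 j : j \in s -> y j = 0.
  move=> js; have /eqP := step f a (fun j js => (eig j js).1) j js.
  rewrite scaler_eq0 subr_eq0 => /orP[/eqP aE|/eqP //].
  have /eqP := step g b (fun j js => (eig j js).2) j js.
  rewrite scaler_eq0 subr_eq0 => /orP[/eqP bE|/eqP //].
  case/negP: i_s; rewrite -(ab_inj j i) ?inE ?eqxx //; by rewrite js orbT.
move=> j; rewrite inE => /orP[/eqP -> {j}|]; last exact: y0.
by move: sum0; rewrite big_cons big_seq big1 ?addr0.
Qed.

Lemma span_graded (R : pzRingType) (V : lmodType R) (J I : eqType) (m : J -> V)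
    (Q : J -> Prop) (wt : J -> I) (S : I -> V -> Prop) x :
  (forall i, S i 0) -> (forall i a u v, S i u -> S i v -> S i (a *: u + v)) ->
  (forall j, Q j -> S (wt j) (m j)) ->
  lspan (fun u => exists2 j, Q j & u = m j) x ->
  exists (s : seq I) (y : I -> V),
    (forall i, i \in s -> (exists2 j, Q j & i = wt j) /\ S i (y i)) /\
    x = \sum_(i <- s) y i.
Proof.
move=> S0 SP Sm /lspan_family[js [c [js_uniq jsQ ->]]].
exists (undup [seq wt j | j <- js]), (fun i => \sum_(j <- js | wt j == i) c j *: m j).
split=> [i|].
  rewrite mem_undup => /mapP[j0 /jsQ Qj0 ->]; split; first by exists j0.
  rewrite big_seq_cond; elim/big_rec: _ => // j w /andP[js_j /eqP wj] Sw.
  by apply: SP => //; rewrite -wj; apply: Sm; apply: jsQ.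
under [RHS]eq_bigr do rewrite big_mkcond.
rewrite exchange_big /= big_seq [RHS]big_seq; apply: eq_bigr => j js_j.
rewrite -big_mkcond (eq_bigl (pred1 (wt j))) => [|i]; last by rewrite /= eq_sym.
rewrite -big_filter filter_pred1_uniq ?undup_uniq ?mem_undup ?map_f //.
by rewrite big_seq1.
Qed.

Definition base_change_fun {A : comNzRingType} {F : fieldType}
    (res : {rmorphism A -> F}) {L : lmodType A} (f : L -> L) :
    base_change res L -> base_change res L :=
  base_change_lift res (fun x => tens res (f x)).

(** The conditions on a crystal basis which concern the reduction.  They are
    stated for any copy [L] of the lattice, with inclusion [v] into the module
    and with the induced operators given by functions, so that they can be
    carried to another presentation of the same objects argument by argument. *)
Definition reduced_crystal_spec {A : comNzRingType} {F : fieldType}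
    (res : {rmorphism A -> F}) (V : Type) (L : lmodType A) (v : L -> V)
    (X Om : int -> V -> V) (B : base_change res L -> Prop) : Prop :=
  forall XL OmL : int -> L -> L,
  (forall m, linear (XL m)) -> (forall m, linear (OmL m)) ->
  (forall m x, v (XL m x) = X m (v x)) ->
  (forall m x, v (OmL m x) = Om m (v x)) ->
  let Xr m := base_change_fun (res := res) (XL m) in
  let Omr m := base_change_fun (res := res) (OmL m) in
  is_basis B /\
  forall m b, B b ->
    [/\ B (Xr m b) \/ B (- Xr m b) \/ Xr m b = 0,
      B (Omr m b) \/ B (- Omr m b) \/ Omr m b = 0 &
      Omr (- m) b <> 0 -> Xr m b <> 0 -> Xr m (Omr (- m) b) = Omr (- m) (Xr m b)].

(** The data of this section: [A] is the ring of regular scalars of [K], with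
    values in [F] at q = 0; [N] is the negative part with its generators [y] and
    the operators Omega; [V] is identified with it by [f].  The functional
    [epsN] is the augmentation, and [t] and [g] lift [p = q^2] and the Taylor
    coefficients [gam] to [A]. *)
Section CrystalOfModel.
Context {A : comNzRingType} {K F : fieldType}.
Context (incl : {rmorphism A -> K}) (res : {rmorphism A -> F}) (t : A) (g : nat -> A).
Context (p : K) (gam : nat -> K).
Context {N V : lmodType K} (f : {linear N -> V}).
Hypothesis incl_inj : injective incl.
Hypothesis K2 : (2 : K) != 0.
Hypothesis res_t : res t = 0.
Hypothesis res_g0 : res (g 0%N) = 0.
Hypothesis res_g1 : res (g 1%N) = -1.
Hypothesis res_g2 : forall r, res (g r.+2) = 0.
Hypothesis f_inj : injective f.
Hypothesis f_surj : forall w, exists a, w = f a.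
Context (y : int -> N -> N) (OmN : int -> {linear N -> N}) (v0 : N).
Context (epsN : {linear N -> K^o}).
Context (X Om : int -> {linear V -> V}) (mon : seq int -> V).
Hypothesis fX : forall m a, X m (f a) = f (y m a).
Hypothesis fOm : forall m a, Om m (f a) = f (OmN m a).
Hypothesis mon_nil : mon [::] = f v0.
Hypothesis mon_cons : forall i s, mon (i :: s) = X i (mon s).
Hypothesis tE : incl t = p.
Hypothesis gE : forall r, incl (g r) = gam r.
Hypothesis p_neq0 : p != 0.
Hypothesis yy : forall k l a, y (k + 1) (y l a) - p^-1 *: y l (y (k + 1) a) =
  p^-1 *: y k (y (l + 1) a) - y (l + 1) (y k a).
Hypothesis N_ind : forall P : N -> Prop,
  P 0 -> (forall c a b, P a -> P b -> P (c *: a + b)) ->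
  P v0 -> (forall m a, P a -> P (y m a)) -> forall a, P a.
Hypothesis OmN0 : forall k, OmN k v0 = 0.
Hypothesis OmN_y : forall k m a, exists n : nat,
    (forall r : nat, (n <= r)%N -> OmN (k - r%:Z) a = 0) /\
    OmN k (y m a) = (k == - m)%:R *: a +
      \sum_(r < n) gam r *: y (m + r%:Z) (OmN (k - r%:Z) a).
Hypothesis epsN0 : epsN v0 = 1.
Hypothesis epsN_y : forall m a, epsN (y m a) = 0.

Lemma model_ind (P : V -> Prop) :
  P 0 -> (forall c a b, P a -> P b -> P (c *: a + b)) ->
  P (mon [::]) -> (forall m a, P a -> P (X m a)) -> forall a, P a.
Proof.
rewrite mon_nil => P0 PP P1 PX w; have [a ->] := f_surj w.
elim/N_ind: a => [|c a b Pa Pb||m a Pa] //; first by rewrite linear0.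
  by rewrite linearP; apply: PP.
by rewrite -fX; apply: PX.
Qed.

Lemma model_quad k l w : X l (X (k + 1) w) + X k (X (l + 1) w) =
  incl t *: (X (k + 1) (X l w) + X (l + 1) (X k w)).
Proof.
have [a ->] := f_surj w; rewrite tE !fX -!linearD -linearZ; congr (f _).
move/move_terms: (yy k l a) => ->.
by rewrite scalerA divff // scale1r.
Qed.

Lemma model_Om_nil k : Om k (mon [::]) = 0.
Proof. by rewrite mon_nil fOm OmN0 linear0. Qed.

Lemma model_Om_X k m w : exists n : nat,
  (forall r : nat, (n <= r)%N -> Om (k - r%:Z) w = 0) /\
  Om k (X m w) = (k == - m)%:R *: w +
    \sum_(r < n) incl (g r) *: X (m + r%:Z) (Om (k - r%:Z) w).
Proof.
have [a ->] := f_surj w; have [n [n0 E]] := OmN_y k m a.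
exists n; split=> [r nr|]; first by rewrite fOm n0 // linear0.
rewrite fX fOm E linearP linear_sum; congr (_ + _); apply: eq_bigr => r _.
by rewrite gE linearZ /= -fX -fOm.
Qed.

Lemma model_eps : exists e : {linear V -> K^o},
  e (mon [::]) = 1 /\ forall i s, e (mon (i :: s)) = 0.
Proof.
have [e eE] := linear_factor epsN f_inj f_surj.
exists e; split=> [|i s]; first by rewrite mon_nil eE.
by have [a aE] := f_surj (mon s); rewrite mon_cons aE fX eE epsN_y.
Qed.

Local Notation L := (in_lspan (ordered_mon (incl := incl) mon)).
Local Notation VA := (restr incl V).

Lemma model_X_stable m (w : VA) : w \in L -> (X m w : VA) \in L.
Proof. exact: (lattice_X K2 mon_cons model_quad). Qed.

Lemma model_Om_stable m (w : VA) : w \in L -> (Om m w : VA) \in L.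
Proof. exact: (lattice_Om K2 mon_cons model_quad model_Om_nil model_Om_X). Qed.

Lemma model_lattice_basis : exists B : sub_mod L -> Prop, is_basis B.
Proof.
have [e [e1 _]] := model_eps.
exists (fun u => exists2 s, nonincreasing s & u = monL K2 mon_cons model_quad s).
exact: (lattice_basis incl_inj K2 mon_cons model_quad model_Om_nil model_Om_X res_g0 e1).
Qed.

Lemma model_incl_bij :
  bijective (base_change_lift incl (fun x : sub_mod L => (val x : V))).
Proof.
have [e [e1 _]] := model_eps.
exact: (lattice_incl_bij incl_inj K2 mon_cons model_quad model_Om_nil model_Om_X
  res_g0 e1 model_ind).
Qed.

Lemma model_mon_neq0 s : nonincreasing s -> mon s != 0.
Proof.
have [e [e1 _]] := model_eps.
move=> s_ord; apply/eqP => s0; have /eqP := oner_neq0 K; apply.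
have ind := mon_independent incl_inj K2 mon_cons model_Om_nil model_Om_X res_g0 e1.
apply: (ind [:: s] (fun=> 1) isT _ _ s (mem_head _ _)).
  by move=> s'; rewrite inE => /eqP ->.
by rewrite big_seq1 s0 scaler0.
Qed.

Section Weights.
Context (q : K) (h d : int) (Kop Dop : {linear V -> V}).
Hypothesis q0 : q != 0.
Hypothesis q_inj : injective (fun n : int => q ^ n).
Hypothesis Kop_X : forall i w, Kop (X i w) = q ^ (-2) *: X i (Kop w).
Hypothesis Dop_X : forall i w, Dop (X i w) = q ^ i *: X i (Dop w).
Hypothesis Kop_nil : Kop (mon [::]) = q ^ h *: mon [::].
Hypothesis Dop_nil : Dop (mon [::]) = q ^ d *: mon [::].

Definition mon_weight (s : seq int) : weight :=
  Weight (h - 2 * (size s)%:Z) 0 (d + \sum_(i <- s) i).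

Definition eigen_space (mu : weight) (w : V) : Prop :=
  Kop w = q ^ wt_h mu *: w /\ Dop w = q ^ wt_d mu *: w.

Lemma eigen_space0 mu : eigen_space mu 0.
Proof. by rewrite /eigen_space (linear0 Kop) (linear0 Dop) !scaler0. Qed.

Lemma eigen_spaceP mu c u v :
  eigen_space mu u -> eigen_space mu v -> eigen_space mu (c *: u + v).
Proof.
rewrite /eigen_space (linearP Kop) (linearP Dop) => -[-> ->] [-> ->].
by rewrite !scalerDr !scalerA !(mulrC c).
Qed.

Lemma mon_weightP s : eigen_space (mon_weight s) (mon s).
Proof.
elim: s => [|i s [/= IHK IHD]].
  by split; rewrite /= ?mulr0 ?subr0 ?big_nil ?addr0.
split; rewrite /= mon_cons ?Kop_X ?Dop_X ?IHK ?IHD linearZ scalerA -expfzDr //=.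
  by congr (q ^ _ *: _); rewrite -[(size s).+1]addn1 PoszD; ring.
by congr (q ^ _ *: _); rewrite big_cons; ring.
Qed.

(** The ordered monomials are weight vectors which generate the lattice, and the
    eigenvalues of K and D determine the weight because the powers of [q] are
    distinct. *)
Lemma model_weights : is_direct_sum
  (fun mu => wt_c mu = 0 /\ exists2 m : V, m != 0 & eigen_space mu m)
  (fun mu (u : sub_mod L) => eigen_space mu (val u)).
Proof.
have val0 : val (0 : sub_mod L) = 0 :> V by [].
split=> [x|s z s_uniq sz sum0].
  have := lattice_span K2 mon_cons model_quad x.
  case/(span_graded (S := fun mu (u : sub_mod L) => eigen_space mu (val u))
          (wt := mon_weight)) => [mu|mu a u v Su Sv|s _|s [z [sz xE]]].
  - exact: eigen_space0.
  - exact: (eigen_spaceP (incl a) Su Sv).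
  - exact: mon_weightP.
  exists s, z; split=> // mu /sz[[s' s'_ord ->] Sz]; split=> //; split=> //.
  by exists (mon s'); [exact: model_mon_neq0 | exact: mon_weightP].
move=> mu s_mu; apply: val_inj; rewrite val0.
apply: (@eigen_independent K V weight Kop Dop (fun mu => q ^ wt_h mu)
  (fun mu => q ^ wt_d mu) s (fun mu => val (z mu) : V)) => //.
- case=> [h1 c1 d1] [h2 c2 d2] /sz[[/= -> _] _] /sz[[/= -> _] _].
  by move=> /q_inj -> /q_inj ->.
- by move=> nu /sz[].
have -> : \sum_(mu <- s) (val (z mu) : V) = val (\sum_(mu <- s) z mu).
  by elim/big_rec2: _ => // nu y1 y2 _ ->.
by rewrite sum0.
Qed.

Local Notation T := (base_change res (sub_mod L)).
Local Notation crystal := (crystal (res := res) (incl := incl) (mon := mon)).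

Section ReducedCrystal.
Context (XL OmL : int -> {linear sub_mod L -> sub_mod L}).
Hypothesis XL_val : forall m x, val (XL m x) = X m (val x).
Hypothesis OmL_val : forall m x, val (OmL m x) = Om m (val x).
Context (Xr Omr : int -> {linear T -> T}).
Hypothesis Xr_tens : forall m x, Xr m (tens res x) = tens res (XL m x).
Hypothesis Omr_tens : forall m x, Omr m (tens res x) = tens res (OmL m x).

Lemma model_crystal_basis : is_basis crystal.
Proof.
have [e [e1 e2]] := model_eps.
exact: (crystal_basis incl_inj K2 mon_cons model_quad model_Om_nil model_Om_X
  res_g0 res_g1 res_g2 e1 e2 XL_val OmL_val Xr_tens Omr_tens).
Qed.

Lemma model_crystal_stable m b : crystal b ->
  [/\ crystal (Xr m b) \/ crystal (- Xr m b) \/ Xr m b = 0,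
      crystal (Omr m b) \/ crystal (- Omr m b) \/ Omr m b = 0 &
      Omr (- m) b <> 0 -> Xr m b <> 0 -> Xr m (Omr (- m) b) = Omr (- m) (Xr m b)].
Proof.
move=> Bb; split.
- exact: (crystal_X_stable K2 mon_cons model_quad res_t XL_val Xr_tens).
- exact: (crystal_Om_stable K2 mon_cons model_quad model_Om_nil model_Om_X
    res_g0 res_g1 res_g2 XL_val OmL_val Xr_tens Omr_tens).
exact: (crystal_comm K2 mon_cons model_quad model_Om_nil model_Om_X res_t
    res_g0 res_g1 res_g2 XL_val OmL_val Xr_tens Omr_tens).
Qed.

End ReducedCrystal.

Theorem model_crystal :
  [/\ (forall m (w : VA), w \in L -> (X m w : VA) \in L) /\
      (forall m (w : VA), w \in L -> (Om m w : VA) \in L),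
      exists B : sub_mod L -> Prop, is_basis B,
      bijective (base_change_lift incl (fun x : sub_mod L => (val x : V))),
      is_direct_sum
        (fun mu => wt_c mu = 0 /\ exists2 m : V, m != 0 & eigen_space mu m)
        (fun mu (u : sub_mod L) => eigen_space mu (val u)) /\
      (forall s, nonincreasing s -> exists2 mu,
        (wt_c mu = 0 /\ exists2 m : V, m != 0 & eigen_space mu m) &
        eigen_space mu (mon s)) &
      reduced_crystal_spec (res := res) (fun x : sub_mod L => (val x : V))
        (fun m w => X m w) (fun m w => Om m w) crystal].
Proof.
split.
- by split=> m w; [exact: model_X_stable | exact: model_Om_stable].
- exact: model_lattice_basis.
- exact: model_incl_bij.
- split; first exact: model_weights.
  move=> s s_ord; exists (mon_weight s); last exact: mon_weightP.
  by split=> //; exists (mon s); [exact: model_mon_neq0 | exact: mon_weightP].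
move=> XL OmL XL_lin OmL_lin XL_val OmL_val Xr Omr.
pose XL' m := mklin (XL_lin m); pose OmL' m := mklin (OmL_lin m).
have Xr_tens m x : base_change_map res (XL' m) (tens res x) = tens res (XL' m x).
  exact: base_change_map_tens.
have Omr_tens m x : base_change_map res (OmL' m) (tens res x) = tens res (OmL' m x).
  exact: base_change_map_tens.
split.
  exact: (model_crystal_basis (XL := XL') (OmL := OmL') XL_val OmL_val Xr_tens Omr_tens).
move=> m b.
exact: (model_crystal_stable (XL := XL') (OmL := OmL') XL_val OmL_val Xr_tens Omr_tens).
Qed.

End Weights.
End CrystalOfModel.

(** * Scalars regular at q = 0 *)

Section RegularScalars.
Context {F : fieldType}.

Lemma A0_poly_subproof (p : {poly F}) : FracField.tofrac p \in @in_A0 F.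
Proof.
by apply/asboolP; exists p, 1; rewrite hornerE oner_neq0 rmorph1 divr1.
Qed.

Definition A0_poly (p : {poly F}) : A0 F :=
  exist _ (FracField.tofrac p) (A0_poly_subproof p).

Lemma A0_res_poly p : A0_res (A0_poly p) = p.[0].
Proof.
by rewrite (@A0_resE _ _ p 1) ?hornerE ?divr1 ?oner_neq0 //=.
Qed.

Lemma A0_incl_poly p : A0_incl (A0_poly p) = FracField.tofrac p.
Proof. by []. Qed.

Lemma q_exprE n : @q F ^+ n = FracField.tofrac 'X^(2 * n).
Proof. by rewrite -exprM qhalf_expr. Qed.

Definition A0_q2 : A0 F := A0_poly 'X^4.

Lemma A0_q2E : A0_incl A0_q2 = q ^+ 2.
Proof. by rewrite q_exprE. Qed.

Lemma A0_res_q2 : A0_res A0_q2 = 0.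
Proof. by rewrite A0_res_poly hornerXn expr0n. Qed.

Definition A0_g (r : nat) : A0 F :=
  A0_poly (if r is r'.+1 then ('X^8 - 1) * 'X^(4 * r') else 'X^4).

Lemma A0_gE r : A0_incl (A0_g r) = g_taylor r.
Proof.
rewrite A0_incl_poly; case: r => [|r] /=; first by rewrite q_exprE.
by rewrite !q_exprE -tofrac1 -tofracB -tofracM mulnA.
Qed.

Lemma A0_res_g0 : A0_res (A0_g 0) = 0.
Proof. by rewrite A0_res_poly hornerXn expr0n. Qed.

Lemma A0_res_g1 : A0_res (A0_g 1) = -1.
Proof.
by rewrite A0_res_poly muln0 expr0 mulr1 hornerD hornerXn expr0n hornerN hornerC add0r.
Qed.

Lemma A0_res_g2 r : A0_res (A0_g r.+2) = 0.
Proof. by rewrite A0_res_poly hornerM [X in _ * X]hornerXn mulnS expr0n mulr0. Qed.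

Lemma A0_incl_inj : injective (@A0_incl F).
Proof. exact: val_inj. Qed.

Lemma Fq2_neq0 : [pchar F] =i pred0 -> (2 : Fq F) != 0.
Proof. by move/pchar_Fq/pcharf0P => ->. Qed.

End RegularScalars.

(** * The operators on the Verma module *)

Section VermaOperators.
Context {F : fieldType} (charF : [pchar F] =i pred0) (lam : weight).
Local Notation N := (Nq F).
Local Notation x := (@Nq_var F).
Local Notation q := (@q F).
Local Notation V := (over_Fq (rverma (F := F) lam)).

Definition hwv_map : {linear N -> V} := mklin (f := @Nq_hwv F lam : N -> V) (Nq_hwvP lam).

Lemma Omega_psiP : is_Omega_psi (@Omega_psi F).
Proof.
apply: the_suchP.
have [Om [Om1 Omx]] := omega_exists q_neq0 (@xop_quad F) (@Nq_ind F) (@Nq_rec_quad F).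
by exists Om; split=> [k|k m a]; [exact: Om1 | exact: Omx].
Qed.

(** Since [a |-> a v] is bijective, the operators Omega can be transported to the
    Verma module. *)
Lemma Omega_rvermaP : is_Omega_rverma (@Omega_rverma F lam).
Proof.
apply: the_suchP.
have H m : exists Om' : {linear V -> V}, forall a : N,
    Om' (Nq_to_Uq a *: hwv lam) = Nq_to_Uq (Omega_psi m a) *: hwv lam.
  (* the two sides differ by unfolding definitions, which is left to the kernel *)
  exact_no_check (linear_factor (hwv_map \o Omega_psi m) (f := hwv_map)
    (@Nq_hwv_inj F charF lam) (@Nq_hwv_surj F lam)).
have [Om OmE] := boolp.choice H.
exists Om; exact OmE.
Qed.

Lemma Omega_tildeE (hlam : in_hred lam) m (a : N) :
  Omega_tilde (rverma_Ored (F := F) hlam) m (hwv_map a) = hwv_map (Omega_psi m a).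
Proof.
have P : is_Omega_tilde (Omega_tilde (rverma_Ored (F := F) hlam)).
  by apply: the_suchP; exists (@Omega_rverma F lam).
exact: etrans (P m tt (hwv_map a)) (Omega_rvermaP m a).
Qed.

Lemma xminusE m (a : N) : xminus m (hwv_map a) = hwv_map (x m * a).
Proof. exact: esym (Nq_hwvM lam m a). Qed.

Lemma monomial_nil : monomial lam [::] = hwv_map 1 :> V.
Proof.
have -> : monomial lam [::] = hwv lam :> rverma (F := F) lam.
  by rewrite /monomial big_nil; exact: (scale1r (hwv lam)).
exact: esym (Nq_hwv1 lam).
Qed.

Lemma monomial_cons i s : monomial lam (i :: s) = xminus i (monomial lam s) :> V.
Proof. by rewrite /monomial big_cons; exact: esym (scalerA _ _ (hwv lam)). Qed.

End VermaOperators.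

(** * Weight operators and the augmentation *)

Lemma swap_act (K : fieldType) (A : algType K) (M : lmodType A)
    (a b : A) (c : K) (w : M) :
  a * b = c *: (b * a) + 0 -> a *: (b *: w) = c%:A *: (b *: (a *: w)).
Proof. by move=> E; rewrite scalerA E scaler_algP scale0r addr0 scalerA. Qed.

Lemma act_linear (K : fieldType) (A : algType K) (M : lmodType A) (a : A) :
  linear ((fun w : M => a *: w) : restr (in_alg A) M -> restr (in_alg A) M).
Proof. by move=> c u w; exact: scaler_algC. Qed.

Section VermaScalarsAndWeights.
Context {F : fieldType} (lam : weight).
Local Notation N := (Nq F).
Local Notation x := (@Nq_var F).
Local Notation q := (@q F).
Local Notation V := (over_Fq (rverma (F := F) lam)).
Local Notation hwv_map := (@hwv_map F lam).

Definition Nmul (m : int) (a : N) : N := x m * a.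

Lemma q2_neq0 : q ^+ 2 != 0.
Proof. exact: (expf_neq0 2 q_neq0). Qed.

Lemma Nmul_quad k l a :
  Nmul (k + 1) (Nmul l a) - (q ^+ 2)^-1 *: Nmul l (Nmul (k + 1) a) =
  (q ^+ 2)^-1 *: Nmul k (Nmul (l + 1) a) - Nmul (l + 1) (Nmul k a).
Proof. exact: (xx_mulr a (Nq_xx k l)). Qed.

Lemma Omega_psi_Nmul k m (a : N) : exists n : nat,
    (forall r : nat, (n <= r)%N -> Omega_psi (k - r%:Z) a = 0) /\
    Omega_psi k (Nmul m a) = (k == - m)%:R *: a +
      \sum_(r < n) g_taylor r *: Nmul (m + r%:Z) (Omega_psi (k - r%:Z) a).
Proof. exact: Omega_psiP.2. Qed.

Lemma Nq_augmentation : exists e : {linear N -> (Fq F)^o},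
  e 1 = 1 /\ forall m a, e (Nmul m a) = 0.
Proof.
have [W0|e e1 ex] := @Nq_rec_quad F (Fq F)^o (fun=> \0) 1.
  by move=> l u; rewrite /= addr0 scaler0.
by exists e; split=> // m a; exact: ex.
Qed.

Definition verma_K : {linear V -> V} :=
  mklin (act_linear (gK (@Uq_var F) true) (M := rverma lam)).
Definition verma_D : {linear V -> V} :=
  mklin (act_linear (gD (@Uq_var F) true) (M := rverma lam)).

Lemma verma_K_X i (w : V) : verma_K (xminus i w) = q ^ (-2) *: (xminus i (verma_K w) : V).
Proof.
apply: (swap_act (w : rverma lam)).
have E : gK (@Uq_var F) true * gx (@Uq_var F) false i * gK (@Uq_var F) false =
      q ^ (sgn false * 2) *: gx (@Uq_var F) false i.
  by apply: Uq_var_rel; exact: Rel_Kx.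
apply: (conj_swap E); by apply: Uq_var_rel; exact: (Rel_KV _ false).
Qed.

Lemma verma_D_X i (w : V) : verma_D (xminus i w) = q ^ i *: (xminus i (verma_D w) : V).
Proof.
apply: (swap_act (w : rverma lam)).
have E : gD (@Uq_var F) true * gx (@Uq_var F) false i * gD (@Uq_var F) false =
      q ^ i *: gx (@Uq_var F) false i.
  by apply: Uq_var_rel; exact: Rel_Dx.
apply: (conj_swap E); by apply: Uq_var_rel; exact: (Rel_DV _ false).
Qed.

Lemma hwv_eigen (u : Uq F) c : rverma_gen lam (u - c%:A) ->
  u *: hwv lam = c%:A *: hwv lam.
Proof.
by rewrite !hwvE => Gu; apply/cls_eq; exact: lspan_gen.
Qed.

Lemma verma_K_nil : verma_K (hwv_map 1) = q ^ wt_h lam *: hwv_map 1.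
Proof.
have := hwv_eigen (RV_K lam true); rewrite [sgn true * _]mul1r -Nq_hwv1.
by [].
Qed.

Lemma verma_D_nil : verma_D (hwv_map 1) = q ^ wt_d lam *: hwv_map 1.
Proof.
have := hwv_eigen (RV_D lam true); rewrite [sgn true * _]mul1r -Nq_hwv1.
by [].
Qed.

End VermaScalarsAndWeights.

(** * The crystal basis of the Verma module *)

(** The data to which [model_crystal] is applied, named at the types which it
    requires.  Each fact below has been proved before and is restated up to
    unfolding these names, a comparison which is left to the kernel. *)
Section NamedData.
Context {F : fieldType} (charF : [pchar F] =i pred0) (lam : weight).
Context (hlam : in_hred lam).

Definition K_ : fieldType := Fq F.
Definition A_ : comNzRingType := A0 F.
Definition incl_ : {rmorphism A_ -> K_}.
Proof. exact_no_check (@A0_incl F : {rmorphism A0 F -> Fq F}). Defined.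
Definition res_ : {rmorphism A_ -> F}.
Proof. exact_no_check (@A0_res F : {rmorphism A0 F -> F}). Defined.
Definition q_ : K_.
Proof. exact_no_check (@q F). Defined.
Definition taylor_ : nat -> K_.
Proof. exact_no_check (@g_taylor F). Defined.
Definition A_q2 : A_.
Proof. exact_no_check (@A0_q2 F). Defined.
Definition A_taylor : nat -> A_.
Proof. exact_no_check (@A0_g F). Defined.

Definition N_ : lmodType K_.
Proof. exact_no_check (Nq F : lmodType (Fq F)). Defined.
Definition one_ : N_.
Proof. exact_no_check (1 : Nq F). Defined.
Definition mul_ : int -> N_ -> N_.
Proof. exact_no_check (@Nmul F). Defined.
Definition Omega_N : int -> {linear N_ -> N_}.
Proof. exact_no_check (@Omega_psi F). Defined.

Definition V_ : lmodType K_.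
Proof. exact_no_check (over_Fq (rverma (F := F) lam) : lmodType (Fq F)). Defined.
Definition map_ : {linear N_ -> V_}.
Proof. exact_no_check (hwv_map (F := F) lam). Defined.
Definition X_ (m : int) : {linear V_ -> V_}.
Proof.
exact_no_check (@xminus F (rverma lam) m :
  {linear over_Fq (rverma lam) -> over_Fq (rverma lam)}).
Defined.
Definition Omega_ : int -> {linear V_ -> V_}.
Proof. exact_no_check (Omega_tilde (rverma_Ored (F := F) hlam)). Defined.
Definition mon_ : seq int -> V_.
Proof. exact_no_check (@monomial F lam). Defined.
Definition Kop_ : {linear V_ -> V_}.
Proof. exact_no_check (verma_K (F := F) lam). Defined.
Definition Dop_ : {linear V_ -> V_}.
Proof. exact_no_check (verma_D (F := F) lam). Defined.

Lemma incl_inj_ : injective incl_. Proof. exact_no_check (@A0_incl_inj F). Qed.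
Lemma two_neq0 : (2 : K_) != 0. Proof. exact_no_check (@Fq2_neq0 F charF). Qed.
Lemma res_q2 : res_ A_q2 = 0. Proof. exact_no_check (@A0_res_q2 F). Qed.
Lemma res_taylor0 : res_ (A_taylor 0) = 0. Proof. exact_no_check (@A0_res_g0 F). Qed.
Lemma res_taylor1 : res_ (A_taylor 1) = -1. Proof. exact_no_check (@A0_res_g1 F). Qed.
Lemma res_taylor2 r : res_ (A_taylor r.+2) = 0.
Proof. exact_no_check (@A0_res_g2 F r). Qed.
Lemma incl_q2 : incl_ A_q2 = q_ ^+ 2. Proof. exact_no_check (@A0_q2E F). Qed.
Lemma incl_taylor r : incl_ (A_taylor r) = taylor_ r. Proof. exact_no_check (@A0_gE F r). Qed.
Lemma q2_neq0_ : q_ ^+ 2 != 0. Proof. exact_no_check (@q2_neq0 F). Qed.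
Lemma q_neq0_ : q_ != 0. Proof. exact_no_check (@q_neq0 F). Qed.
Lemma q_inj_ : injective (fun n : int => q_ ^ n). Proof. exact_no_check (@q_exprz_inj F). Qed.

Lemma mul_quad k l a :
  mul_ (k + 1) (mul_ l a) - (q_ ^+ 2)^-1 *: mul_ l (mul_ (k + 1) a) =
  (q_ ^+ 2)^-1 *: mul_ k (mul_ (l + 1) a) - mul_ (l + 1) (mul_ k a).
Proof. exact_no_check (@Nmul_quad F k l a). Qed.
Lemma N_ind_ (P : N_ -> Prop) :
  P 0 -> (forall c a b, P a -> P b -> P (c *: a + b)) ->
  P one_ -> (forall m a, P a -> P (mul_ m a)) -> forall a, P a.
Proof. exact_no_check (@Nq_ind F P). Qed.
Lemma Omega_N_one k : Omega_N k one_ = 0.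
Proof. exact_no_check ((@Omega_psiP F).1 k). Qed.
Lemma Omega_N_mul k m a : exists n : nat,
  (forall r : nat, (n <= r)%N -> Omega_N (k - r%:Z) a = 0) /\
  Omega_N k (mul_ m a) = (k == - m)%:R *: a +
    \sum_(r < n) taylor_ r *: mul_ (m + r%:Z) (Omega_N (k - r%:Z) a).
Proof. exact_no_check (@Omega_psi_Nmul F k m a). Qed.
Lemma augmentation_ : exists e : {linear N_ -> K_^o},
  e one_ = 1 /\ forall m a, e (mul_ m a) = 0.
Proof. exact_no_check (@Nq_augmentation F). Qed.

Lemma map_inj_ : injective map_.
Proof. exact_no_check (@Nq_hwv_inj F charF lam). Qed.
Lemma map_surj_ w : exists a, w = map_ a.
Proof. exact_no_check (@Nq_hwv_surj F lam w). Qed.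
Lemma X_map m a : X_ m (map_ a) = map_ (mul_ m a).
Proof. exact_no_check (@xminusE F lam m a). Qed.
Lemma Omega_map m a : Omega_ m (map_ a) = map_ (Omega_N m a).
Proof. exact_no_check (@Omega_tildeE F charF lam hlam m a). Qed.
Lemma mon_nil_ : mon_ [::] = map_ one_.
Proof. exact_no_check (@monomial_nil F lam). Qed.
Lemma mon_cons_ i s : mon_ (i :: s) = X_ i (mon_ s).
Proof. exact_no_check (@monomial_cons F lam i s). Qed.
Lemma Kop_X_ i w : Kop_ (X_ i w) = q_ ^ (-2) *: X_ i (Kop_ w).
Proof. exact_no_check (@verma_K_X F lam i w). Qed.
Lemma Dop_X_ i w : Dop_ (X_ i w) = q_ ^ i *: X_ i (Dop_ w).
Proof. exact_no_check (@verma_D_X F lam i w). Qed.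
Lemma Kop_nil_ : Kop_ (mon_ [::]) = q_ ^ wt_h lam *: mon_ [::].
Proof. rewrite mon_nil_; exact_no_check (@verma_K_nil F lam). Qed.
Lemma Dop_nil_ : Dop_ (mon_ [::]) = q_ ^ wt_d lam *: mon_ [::].
Proof. rewrite mon_nil_; exact_no_check (@verma_D_nil F lam). Qed.

Local Notation L_ := (in_lspan (ordered_mon (incl := incl_) mon_)).
Local Notation LA_ := (restr incl_ V_).
Local Notation crystal_ := (crystal (res := res_) (incl := incl_) (mon := mon_)).
Local Notation eigen_ := (eigen_space q_ Kop_ Dop_).

Lemma named_crystal :
  [/\ (forall m (w : LA_), w \in L_ -> (X_ m w : LA_) \in L_) /\
      (forall m (w : LA_), w \in L_ -> (Omega_ m w : LA_) \in L_),
      exists B : sub_mod L_ -> Prop, is_basis B,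
      bijective (base_change_lift incl_ (fun x : sub_mod L_ => (val x : V_))),
      is_direct_sum
        (fun mu => wt_c mu = 0 /\ exists2 m : V_, m != 0 & eigen_ mu m)
        (fun mu (u : sub_mod L_) => eigen_ mu (val u)) /\
      (forall s, nonincreasing s -> exists2 mu,
        (wt_c mu = 0 /\ exists2 m : V_, m != 0 & eigen_ mu m) &
        eigen_ mu (mon_ s)) &
      reduced_crystal_spec (res := res_) (fun x : sub_mod L_ => (val x : V_))
        (fun m w => X_ m w) (fun m w => Omega_ m w) crystal_].
Proof.
have [e [e1 ex]] := augmentation_.
exact (model_crystal incl_inj_ two_neq0 res_q2 res_taylor0 res_taylor1 res_taylor2
  map_inj_ map_surj_ X_map Omega_map mon_nil_ mon_cons_ incl_q2 incl_taylor q2_neq0_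
  mul_quad N_ind_ Omega_N_one Omega_N_mul e1 ex q_neq0_ q_inj_ Kop_X_ Dop_X_
  Kop_nil_ Dop_nil_).
Qed.

End NamedData.

Lemma reduction_wt_tens (F : fieldType) (M : Ored (F := F))
    (L : submodClosed (over_A0 M)) mu (x : sub_mod L) :
  lattice_wt mu x -> reduction_wt mu (tens (@A0_res F) x).
Proof. by move=> x_mu; apply: lspan_gen; exists x. Qed.

(** Every element of [B] being the class of a weight vector of the lattice, [B]
    is the union of its weight parts; the other conditions are those of
    [reduced_crystal_spec] for the operators induced on the reduction. *)
Lemma crystal_basis_of_reduction (F : fieldType) (M : Ored (F := F))
    (L : submodClosed (over_A0 M)) (B : reduction L -> Prop) :
  is_crystal_lattice L ->
  (forall b, B b -> exists2 mu, is_weight (M := M) mu &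
     exists2 x : sub_mod L, weight_space (M := M) mu (val x) & b = tens (@A0_res F) x) ->
  reduced_crystal_spec (res := @A0_res F) (L := sub_mod L)
    (fun x : sub_mod L => (val x : over_Fq M)) (fun m w => xminus m w)
    (fun m w => Omega_tilde M m w) B ->
  is_crystal_basis B.
Proof.
move=> lat wts spec.
destruct (spec (fun m => restr_op (lattice_xminus lat m))
  (fun m => restr_op (lattice_Omega lat m))
  (fun m => restr_op_is_linear (lattice_xminus lat m))
  (fun m => restr_op_is_linear (lattice_Omega lat m))
  (fun _ _ => erefl) (fun _ _ => erefl)) as [basis stable].
exists lat.
- exact basis.
- move=> b; split=> [Bb|[mu _ []]]; last by [].
  have [mu mu_wt [x x_mu bE]] := wts b Bb.
  by exists mu => //; split=> //; rewrite bE; exact: reduction_wt_tens.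
(* the maps induced on the reduction agree by definition *)
- exact_no_check (fun m b Bb => let: And3 H _ _ := stable m b Bb in H).
- exact_no_check (fun m b Bb => let: And3 _ H _ := stable m b Bb in H).
exact_no_check (fun m b Bb => let: And3 _ _ H := stable m b Bb in H).
Qed.

Section CrystalBasis.
Context {F : fieldType} (charF : [pchar F] =i pred0) (lam : weight).
Context (hlam : in_hred lam).
Local Notation M := (rverma_Ored (F := F) hlam).
Local Notation L := (crystal_L (F := F) lam).

Lemma verma_crystal_lattice : is_crystal_lattice (M := M) L.
Proof.
have [[XL OmL] free bij [wts _] _] := @named_crystal F charF lam hlam.
split.
- exact_no_check free.
- exact_no_check bij.
- exact_no_check wts.
- exact_no_check OmL.
- exact_no_check XL.
Qed.

Local Notation LM := (L : submodClosed (over_A0 M)).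
Local Notation B := (crystal_B (F := F) (lam := lam)).

Lemma verma_crystal_reduction : reduced_crystal_spec (res := @A0_res F)
  (L := sub_mod LM) (fun x : sub_mod LM => (val x : over_Fq M)) (fun m w => xminus m w)
  (fun m w => Omega_tilde M m w) B.
Proof.
have [_ _ _ _ H] := @named_crystal F charF lam hlam.
exact_no_check H.
Qed.

Lemma verma_weights : forall s, nonincreasing s -> exists2 mu, is_weight (M := M) mu &
  weight_space (M := M) mu (monomial lam s).
Proof.
have [_ _ _ [_ H] _] := @named_crystal F charF lam hlam.
exact_no_check H.
Qed.

End CrystalBasis.

Theorem theorem9p0p2 (F : fieldType) (charF : [pchar F] =i pred0)
    (lam : weight) (hlam : in_hred lam) :
  is_crystal_basis (M := rverma_Ored (F := F) hlam)
    (L := crystal_L (F := F) lam) (crystal_B (lam := lam)).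
Proof.
refine (crystal_basis_of_reduction (M := rverma_Ored (F := F) hlam)
  (L := crystal_L (F := F) lam) (verma_crystal_lattice charF hlam) _
  (@verma_crystal_reduction F charF lam hlam)).
intros b [x [s s_ord xs] bE].
destruct (verma_weights charF hlam s_ord) as [mu mu_wt s_mu].
exists mu; first exact mu_wt.
refine (ex_intro2 _ _ x _ bE).
exact (eq_ind_r (weight_space (M := rverma_Ored (F := F) hlam) mu) s_mu xs).
Qed.
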